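(* Let $\mathcal G$ be an étale groupoid. The following conditions are equivalent: (i) $\mathcal G$ is strongly amenable at infinity; (ii) there exists a net $(k_i)_{i\in I}$ of bounded positive definite continuous kernels on $\mathcal G*_r\mathcal G$ supported in tubes such that (a) for every $i$, the restriction of $k_i$ to the diagonal of $\mathcal G*_r\mathcal G$ is uniformly bounded by $1$; (b) $\lim_i k_i=1$ uniformly on tubes.
   Context: Conventions. Locally compact spaces are Hausdorff and second countable. A locally compact groupoid $\mathcal G$ is a groupoid with a locally compact (Hausdorff, second countable) topology, continuous structure maps, and open range and source maps $r,s:\mathcal G\to\mathcal G^{(0)}=X$; $\mathcal G^x=r^{-1}(x)$. It is étale if $r$ is a local homeomorphism. A left $\mathcal G$-space $(Y,p)$ is a locally compact space $Y$ with a continuous map $p:Y\to X$ and a continuous map $(\gamma,y)\mapsto\gamma y$ from $\{(\gamma,y): s(\gamma)=p(y)\}$ to $Y$ with $p(\gamma y)=r(\gamma)$, $p(y)y=y$, $(\gamma_2\gamma_1)y=\gamma_2(\gamma_1y)$. $Y\rtimes\mathcal G=\{(y,\gamma):p(y)=r(\gamma)\}$ is the groupoid with unit space $Y$, $r(y,\gamma)=y$, $s(y,\gamma)=\gamma^{-1}y$, $(y,\gamma)(\gamma^{-1}y,\gamma_1)=(y,\gamma\gamma_1)$. A locally compact groupoid is amenable if there is a net $(m_i)$, $m_i=(m_i^x)_{x\in X}$ with $m_i^x$ a probability measure on $\mathcal G^x$, such that $x\mapsto\int f\,dm_i^x$ is continuous for every $f\in C_c(\mathcal G)$ and $\lim_i\|\gamma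 m_i^{s(\gamma)}-m_i^{r(\gamma)}\|_1=0$ uniformly on compact subsets of $\mathcal G$. $\mathcal G$ is strongly amenable at infinity if there is a left $\mathcal G$-space $(Y,p)$ with $p$ proper, surjective and having a continuous section $X\to Y$, such that $Y\rtimes\mathcal G$ is amenable. $\mathcal G*_r\mathcal G=\{(\gamma,\gamma_1)\in\mathcal G\times\mathcal G:r(\gamma)=r(\gamma_1)\}$. A function $k:\mathcal G*_r\mathcal G\to\mathbb C$ is a positive definite kernel if for every $x\in X$, $n$ and $\gamma_1,\dots,\gamma_n\in\mathcal G^x$ the matrix $[k(\gamma_i,\gamma_j)]$ is positive semidefinite. A tube is a subset of $\mathcal G*_r\mathcal G$ whose image under $(\gamma,\gamma_1)\mapsto\gamma^{-1}\gamma_1$ is relatively compact in $\mathcal G$. *)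

(* Defs.v *)
From HB Require Import structures.
From mathcomp Require Import all_boot all_order all_algebra.
From mathcomp Require Import all_classical all_reals all_analysis.
From mathcomp Require Import complex.

Set Implicit Arguments.
Unset Strict Implicit.
Unset Printing Implicit Defensive.

Import Order.TTheory GRing.Theory Num.Theory.
Import numFieldNormedType.Exports.

Local Open Scope classical_set_scope.
Local Open Scope ring_scope.

(* "Locally compact" always includes Hausdorff and second countable. *)
Definition lc_space (T : topologicalType) : Prop :=
  [/\ hausdorff_space T, locally_compact [set: T] & @second_countable T].

Definition open_map (S T : topologicalType) (f : S -> T) : Prop :=
  forall U : set S, open U -> open (f @` U).

Definition proper_map (S T : topologicalType) (f : S -> T) : Prop :=
  forall K : set T, compact K -> compact (f @^-1` K).

Definition local_homeomorphism (S T : topologicalType) (f : S -> T) : Prop :=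
  forall x : S, exists U : set S,
    [/\ open_nbhs x U, open (f @` U), {within U, continuous f} &
      exists g : T -> S,
        {within f @` U, continuous g} /\ (forall y, U y -> g (f y) = y)].

Record directed (I : Type) (le : I -> I -> Prop) : Prop := Directed {
  directed_inhabited : inhabited I;
  directed_refl : forall i, le i i;
  directed_trans : forall i j k, le i j -> le j k -> le i k;
  directed_ub : forall i j, exists k, le i k /\ le j k
}.

(* A groupoid with set of arrows G and unit space X. The product [gmul g h] is
   meaningful only when [gs g = gr h]; its other values are arbitrary and are
   never used. *)
Record groupoid (X G : Type) := Groupoid {
  gr : G -> X;
  gs : G -> X;
  gu : X -> G;
  ginv : G -> G;
  gmul : G -> G -> G;
  gr_u : forall x, gr (gu x) = x;
  gs_u : forall x, gs (gu x) = x;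
  gr_inv : forall g, gr (ginv g) = gs g;
  gs_inv : forall g, gs (ginv g) = gr g;
  gr_mul : forall g h, gs g = gr h -> gr (gmul g h) = gr g;
  gs_mul : forall g h, gs g = gr h -> gs (gmul g h) = gs h;
  gmulA : forall g h k, gs g = gr h -> gs h = gr k ->
    gmul (gmul g h) k = gmul g (gmul h k);
  gmul_ul : forall g, gmul (gu (gr g)) g = g;
  gmul_ur : forall g, gmul g (gu (gs g)) = g;
  gmul_Vl : forall g, gmul (ginv g) g = gu (gs g);
  gmul_Vr : forall g, gmul g (ginv g) = gu (gr g)
}.

Section GroupoidTheory.
Variables (X G : Type) (Gd : groupoid X G).

Lemma ginv_uniq g h : gs Gd g = gr Gd h -> gmul Gd g h = gu Gd (gr Gd g) ->
  h = ginv Gd g.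
Proof.
move=> gh e; rewrite -[LHS](gmul_ul Gd) -gh -gmul_Vl gmulA ?gs_inv//.
by rewrite e -(gs_inv Gd g) gmul_ur.
Qed.

Lemma ginvK g : ginv Gd (ginv Gd g) = g.
Proof. by apply/esym/ginv_uniq; rewrite ?gs_inv// gmul_Vl gr_inv. Qed.

Lemma ginv_u x : ginv Gd (gu Gd x) = gu Gd x.
Proof.
apply/esym/ginv_uniq; rewrite ?gs_u ?gr_u//.
by have := gmul_ur Gd (gu Gd x); rewrite gs_u.
Qed.

Lemma ginv_mul g h : gs Gd g = gr Gd h ->
  ginv Gd (gmul Gd g h) = gmul Gd (ginv Gd h) (ginv Gd g).
Proof.
move=> gh; have hg : gs Gd (ginv Gd h) = gr Gd (ginv Gd g).
  by rewrite gs_inv gr_inv.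
apply/esym/ginv_uniq; first by rewrite gs_mul// gr_mul// gr_inv.
rewrite [in RHS]gr_mul//.
have -> : gmul Gd (gmul Gd g h) (gmul Gd (ginv Gd h) (ginv Gd g)) =
          gmul Gd g (gmul Gd (gmul Gd h (ginv Gd h)) (ginv Gd g)).
  have hV : gs Gd h = gr Gd (ginv Gd h) by rewrite gr_inv.
  by rewrite !gmulA ?gr_mul.
by rewrite gmul_Vr -gh -(gr_inv Gd g) gmul_ul gmul_Vr.
Qed.

End GroupoidTheory.

(* As [gr] is a continuous left inverse of the continuous map [gu], the latter
   is an embedding: X has the topology of the subspace of units of G. *)
Definition lc_groupoid (X G : topologicalType) (Gd : groupoid X G) : Prop :=
  [/\ lc_space G /\ lc_space X,
      [/\ continuous (gr Gd), continuous (gs Gd), continuous (gu Gd) &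
          continuous (ginv Gd)],
      {within [set gh : G * G | gs Gd gh.1 = gr Gd gh.2],
        continuous (fun gh => gmul Gd gh.1 gh.2)} &
      open_map (gr Gd) /\ open_map (gs Gd)].

Definition etale (X G : topologicalType) (Gd : groupoid X G) : Prop :=
  local_homeomorphism (gr Gd).

Section Amenability.
Variable R : realType.
Variables (X G : topologicalType) (Gd : groupoid X G).

(* The fibre G^x, with the subspace topology; it is pointed by the unit at x
   because measurable types of the library must be pointed. *)
Definition fibre (x : X) : Type := [set g : G | gr Gd g = x].

HB.instance Definition _ (x : X) := Topological.on (fibre x).

Definition fibre_unit (x : X) : fibre x :=
  exist _ (gu Gd x) (mem_set (gr_u Gd x)).

HB.instance Definition _ (x : X) := isPointed.Build (fibre x) (fibre_unit x).

Definition borel_fibre (x : X) := g_sigma_algebraType (@open (fibre x)).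

Lemma translate_subproof (g : G) (h : fibre (gs Gd g)) :
  gmul Gd g (val h) \in [set k | gr Gd k = gr Gd g].
Proof. by apply/mem_set/gr_mul; rewrite (set_mem (valP h)). Qed.

Definition translate (g : G) (h : borel_fibre (gs Gd g)) :
    borel_fibre (gr Gd g) :=
  exist _ (gmul Gd g (val h)) (translate_subproof h).

(* Total variation of a signed measure. *)
Definition tv_norm d (T : measurableType d) (nu : set T -> \bar R) : \bar R :=
  ereal_sup [set v | exists n (F : 'I_n -> set T),
    [/\ forall i, measurable (F i), trivIset [set: 'I_n] F &
        v = (\sum_(i < n) `|nu (F i)|)%E]].

Definition cintegral d (T : measurableType d)
    (mu : {measure set T -> \bar R}) (f : T -> R[i]) : R[i] :=
  Complex (Rintegral mu [set: T] (fun t => complex.Re (f t)))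
          (Rintegral mu [set: T] (fun t => complex.Im (f t))).

Definition Cc (f : G -> R[i]) : Prop :=
  continuous (f : G -> R[i]^o) /\ compact (closure [set g | f g != 0]).

Definition amenable : Prop :=
  exists (I : Type) (le : I -> I -> Prop)
         (m : I -> forall x : X, probability (borel_fibre x) R),
  [/\ directed le,
      forall (i : I) (f : G -> R[i]), Cc f ->
        continuous (fun x => cintegral (m i x) (fun h => f (val h)) : R[i]^o) &
      forall K : set G, compact K -> forall e : R, 0 < e ->
        exists i0, forall i, le i0 i -> forall g, K g ->
          (tv_norm (fun A => pushforward (m i (gs Gd g)) (@translate g) A
                             - m i (gr Gd g) A) <= e%:E)%E].

End Amenability.

(* As for [gmul], [gact g y] is meaningful only when [gs g = gp y]. *)
Record gspace (X G Y : Type) (Gd : groupoid X G) := Gspace {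
  gp : Y -> X;
  gact : G -> Y -> Y;
  gp_act : forall g y, gs Gd g = gp y -> gp (gact g y) = gr Gd g;
  gact_u : forall y, gact (gu Gd (gp y)) y = y;
  gactA : forall g h y, gs Gd g = gr Gd h -> gs Gd h = gp y ->
    gact (gmul Gd g h) y = gact g (gact h y)
}.

Definition lc_gspace (X G Y : topologicalType) (Gd : groupoid X G)
    (A : gspace Y Gd) : Prop :=
  [/\ lc_space Y, continuous (gp A) &
      {within [set gy : G * Y | gs Gd gy.1 = gp A gy.2],
        continuous (fun gy => gact A gy.1 gy.2)}].

Section Semidirect.
Variables (X G Y : Type) (Gd : groupoid X G) (A : gspace Y Gd).

Definition sd_arrow : set (Y * G) := [set a | gp A a.1 = gr Gd a.2].
Implicit Types a b : sd_arrow.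

Definition sd_r (a : sd_arrow) : Y := (val a).1.
Definition sd_s (a : sd_arrow) : Y := gact A (ginv Gd (val a).2) (val a).1.

Lemma sd_u_subproof (y : Y) : (y, gu Gd (gp A y)) \in sd_arrow.
Proof. by apply/mem_set; rewrite /sd_arrow /= gr_u. Qed.

Definition sd_u (y : Y) : sd_arrow :=
  exist _ (y, gu Gd (gp A y)) (sd_u_subproof y).

Lemma sd_inv_subproof (a : sd_arrow) :
  (sd_s a, ginv Gd (val a).2) \in sd_arrow.
Proof.
apply/mem_set; rewrite /sd_arrow /sd_s /= gp_act// gs_inv.
by have /set_mem/= -> := valP a.
Qed.

Definition sd_inv (a : sd_arrow) : sd_arrow :=
  exist _ (sd_s a, ginv Gd (val a).2) (sd_inv_subproof a).

(* For composable a and b the pair below lies in [sd_arrow] (see [sd_mulE]);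
   the default value of [insubd] is only a filler for the other pairs. *)
Definition sd_mul (a b : sd_arrow) : sd_arrow :=
  insubd a ((val a).1, gmul Gd (val a).2 (val b).2).

Lemma sd_p a : gp A (val a).1 = gr Gd (val a).2.
Proof. exact: set_mem (valP a). Qed.

Lemma sd_comp a b : sd_s a = sd_r b -> gs Gd (val a).2 = gr Gd (val b).2.
Proof.
move=> ab; rewrite -(sd_p b) -/(sd_r b) -ab.
by rewrite /sd_s gp_act ?gr_inv// gs_inv sd_p.
Qed.

Lemma sd_mulE a b : sd_s a = sd_r b ->
  val (sd_mul a b) = ((val a).1, gmul Gd (val a).2 (val b).2).
Proof.
move=> ab; rewrite val_insubd ifT//.
by apply/mem_set; rewrite /sd_arrow /= gr_mul ?sd_p//; exact: sd_comp.
Qed.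

Lemma sd_val_inj a b : (val a).1 = (val b).1 -> (val a).2 = (val b).2 -> a = b.
Proof.
move=> e1 e2; apply: val_inj.
by rewrite [LHS]surjective_pairing e1 e2 -surjective_pairing.
Qed.

Lemma sd_r_u y : sd_r (sd_u y) = y. Proof. by []. Qed.

Lemma sd_s_u y : sd_s (sd_u y) = y.
Proof. by rewrite /sd_s /= ginv_u gact_u. Qed.

Lemma sd_r_inv a : sd_r (sd_inv a) = sd_s a. Proof. by []. Qed.

Lemma sd_s_inv a : sd_s (sd_inv a) = sd_r a.
Proof.
rewrite /sd_s /= ginvK -gactA ?gr_inv ?gs_inv ?sd_p//.
by rewrite gmul_Vr -sd_p gact_u.
Qed.

Lemma sd_r_mul a b : sd_s a = sd_r b -> sd_r (sd_mul a b) = sd_r a.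
Proof. by move=> ab; rewrite /sd_r sd_mulE. Qed.

Lemma sd_s_mul a b : sd_s a = sd_r b -> sd_s (sd_mul a b) = sd_s b.
Proof.
move=> ab; have gab := sd_comp ab; rewrite /sd_s sd_mulE//= ginv_mul//.
by rewrite gactA ?gs_inv ?gr_inv ?sd_p// -/(sd_s a) ab.
Qed.

Lemma sd_mulA a b c : sd_s a = sd_r b -> sd_s b = sd_r c ->
  sd_mul (sd_mul a b) c = sd_mul a (sd_mul b c).
Proof.
move=> ab bc; have abc : sd_s (sd_mul a b) = sd_r c by rewrite sd_s_mul.
have abc' : sd_s a = sd_r (sd_mul b c) by rewrite sd_r_mul.
apply: sd_val_inj; rewrite !sd_mulE//=.
by rewrite gmulA//; exact: sd_comp.
Qed.

Lemma sd_mul_ul a : sd_mul (sd_u (sd_r a)) a = a.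
Proof.
apply: sd_val_inj; rewrite sd_mulE ?sd_s_u//=.
by rewrite /sd_r sd_p gmul_ul.
Qed.

Lemma sd_mul_ur a : sd_mul a (sd_u (sd_s a)) = a.
Proof.
apply: sd_val_inj; rewrite sd_mulE//=.
by rewrite /sd_s gp_act ?gs_inv ?sd_p// gr_inv gmul_ur.
Qed.

Lemma sd_mul_Vl a : sd_mul (sd_inv a) a = sd_u (sd_s a).
Proof.
apply: sd_val_inj; rewrite sd_mulE ?sd_s_inv//=.
by rewrite /sd_s gp_act ?gs_inv ?sd_p// gr_inv gmul_Vl.
Qed.

Lemma sd_mul_Vr a : sd_mul a (sd_inv a) = sd_u (sd_r a).
Proof. by apply: sd_val_inj; rewrite sd_mulE//= /sd_r sd_p gmul_Vr. Qed.

Definition semidirect : groupoid Y sd_arrow :=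
  Groupoid sd_r_u sd_s_u sd_r_inv sd_s_inv sd_r_mul sd_s_mul sd_mulA
    sd_mul_ul sd_mul_ur sd_mul_Vl sd_mul_Vr.

End Semidirect.

Definition strongly_amenable_at_infinity (R : realType) (X G : topologicalType)
    (Gd : groupoid X G) : Prop :=
  exists (Y : topologicalType) (A : gspace Y Gd),
  [/\ lc_gspace A,
      proper_map (gp A),
      forall x, exists y, gp A y = x,
      exists sigma : X -> Y, continuous sigma /\ forall x, gp A (sigma x) = x &
      amenable R (semidirect A)].

Section Kernels.
Variable R : realType.
Variables (X G : topologicalType) (Gd : groupoid X G).

Definition rprod : set (G * G) := [set gh | gr Gd gh.1 = gr Gd gh.2].

Definition tube (T : set (G * G)) : Prop :=
  T `<=` rprod /\ precompact [set gmul Gd (ginv Gd gh.1) gh.2 | gh in T].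

Definition psd n (M : 'M[R[i]]_n) : Prop :=
  forall z : 'I_n -> R[i],
    0 <= \sum_(i < n) \sum_(j < n) (z i)^* * M i j * z j.

(* A kernel is a function on [rprod]; it is represented by a function on G * G
   whose values off [rprod] are arbitrary and are never used. *)
Definition positive_definite (k : G * G -> R[i]) : Prop :=
  forall (x : X) n (g : 'I_n -> G), (forall i, gr Gd (g i) = x) ->
    psd (\matrix_(i, j) k (g i, g j)).

Definition bounded_kernel (k : G * G -> R[i]) : Prop :=
  exists M : R, forall gh, rprod gh -> `|k gh| <= M%:C%C.

Definition continuous_kernel (k : G * G -> R[i]) : Prop :=
  {within rprod, continuous (k : G * G -> R[i]^o)}.

Definition supported_in_tube (k : G * G -> R[i]) : Prop :=
  exists T, tube T /\ forall gh, rprod gh -> k gh != 0 -> T gh.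

Definition bounded_by1_on_diagonal (k : G * G -> R[i]) : Prop :=
  forall g, `|k (g, g)| <= 1.

Definition tends_to1_on_tubes (I : Type) (le : I -> I -> Prop)
    (k : I -> G * G -> R[i]) : Prop :=
  forall T, tube T -> forall e : R, 0 < e ->
    exists i0, forall i, le i0 i -> forall gh, T gh ->
      `|k i gh - 1| <= e%:C%C.

End Kernels.

(* Main.v *)
Require Import Defs.
From HB Require Import structures.
From mathcomp Require Import all_boot all_order all_algebra.
From mathcomp Require Import all_classical all_reals all_analysis.
From mathcomp Require Import measurable_realfun.
From mathcomp Require Import complex.
From mathcomp Require Import ring lra.

(* From measures to kernels.  Let m be almost invariant measures on the fibres
   of Y x| G and sigma a section of Y -> X.  For g with range x put y = g^-1 sigma(x);
   let v_g(eta) be the square root of c(g^-1 eta) m^y{g^-1 eta}, where c is a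
   compactly supported cut-off, and k(g, h) = sum_eta v_g(eta) v_h(eta).  By Dini's
   argument the cut-off loses little mass over a compact subset of Y, so k is
   close to 1 on a tube as soon as m is almost invariant there.

   From kernels to measures.  The real part of a kernel is on each G^x a positive
   matrix with boundedly many nonzero entries per row.  The iteration
   q' = (b + q^2) / 2, started at q = 0 with b = 1 - a, gives square roots of a up to
   an arbitrarily small uniform error, and these are again continuous with boundedly
   many nonzero entries per row.  Squaring and normalizing their rows gives probabilities mu_g on
   G^(r g) with finite support contained in finitely many continuous sections
   g k_j(s g), continuous in g and with mu_g close to mu_h when g^-1 h lies in a given
   compact set.  Choose one such system for each n, with error e_n -> 0 and compact
   sets O_n exhausting G.  The space Y of all families (on one fibre G^x) of
   densities along the same sections with the same bounds is proper over X by a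
   Tychonoff argument; G acts on it by translation; the chosen systems give the
   section X -> Y; and the values at the unit of x are the measures required for
   the amenability of Y x| G. *)

Set Implicit Arguments.
Unset Strict Implicit.
Unset Printing Implicit Defensive.

Import Order.TTheory GRing.Theory Num.Theory.
Import numFieldNormedType.Exports.

Local Open Scope classical_set_scope.
Local Open Scope ring_scope.

(** * Square roots of matrices with finite rows *)

(** The exact square root of a kernel is in general not supported in a tube, whereas each finite
    stage of the iteration is a polynomial in the kernel and keeps continuity and thin support. Its
    error is controlled by running the same iteration on the number 1: the increments there are at
    most [1 / n] and dominate the matrix increments, so no spectral theory is needed. A fibrewise
    Stone-Cech compactification would be the obvious choice of [Y], but it is in general not second
    countable; hence a sequence of densities, and a topology given by countably many coordinates.
    Continuous sections of [r] exist only locally. Each one therefore carries a weight that vanishes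
    before the section breaks down, and masses are bounded by weights: every continuity proof splits
    into the points where the weight is nonzero, and those where it forces the limit 0. Different
    sections may pass through the same arrow, so comparing coefficients is meaningless. Almost
    invariance is tested on arbitrary functions bounded by 1, which amounts to the total variation
    distance of the measures. *)

Section FiniteSums.
Variables (R : realType) (T : choiceType).
Implicit Types (f g v w : T -> R) (a b : T -> T -> R).

Definition finsupp f := exists s : seq T, forall i, f i != 0 -> i \in s.

(** Meaningful only under [finsupp], which is therefore carried through all the rules below. *)
Definition fsum f : R := \sum_(i \in [set: T]) f i.

Lemma fsumE f (s : seq T) : uniq s -> (forall i, f i != 0 -> i \in s) ->
  fsum f = \sum_(i <- s) f i.
Proof.
move=> us fs; rewrite /fsum -(fsbig_widen [set` s] setT)//; last first.
  move=> i [_ /= si]; apply/eqP; apply: contraT => fi0.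
  by exfalso; apply: si; rewrite /= fs.
by rewrite -fsbig_seq.
Qed.

Lemma finsuppU f g : finsupp f -> finsupp g ->
  exists2 s : seq T, uniq s &
    (forall i, f i != 0 -> i \in s) /\ (forall i, g i != 0 -> i \in s).
Proof.
move=> [s fs] [t gt]; exists (undup (s ++ t)); first exact: undup_uniq.
split=> i hi; rewrite mem_undup mem_cat.
  by rewrite fs.
by rewrite (gt _ hi) orbT.
Qed.

Lemma sub_finsupp f g : (forall i, g i != 0 -> f i != 0) -> finsupp f ->
  finsupp g.
Proof. by move=> gf [s fs]; exists s => i /gf/fs. Qed.

Lemma finsuppD f g : finsupp f -> finsupp g -> finsupp (fun i => f i + g i).
Proof.
move=> ff fg; have [s _ [fs gs]] := finsuppU ff fg; exists s => i.
apply: contraNT => si; have [f0 g0] : f i = 0 /\ g i = 0.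
  by split; apply/eqP; apply: contraNT si; [exact: fs|exact: gs].
by rewrite f0 g0 addr0.
Qed.

Lemma finsuppMl f g : finsupp f -> finsupp (fun i => f i * g i).
Proof. by apply: sub_finsupp => i; rewrite mulf_eq0 negb_or => /andP[]. Qed.

Lemma finsuppMr f g : finsupp g -> finsupp (fun i => f i * g i).
Proof. by apply: sub_finsupp => i; rewrite mulf_eq0 negb_or => /andP[]. Qed.

Lemma finsupp_sqr f : finsupp f -> finsupp (fun i => f i ^+ 2).
Proof. by apply: sub_finsupp => i; rewrite expf_eq0. Qed.

Lemma fsumD f g : finsupp f -> finsupp g ->
  fsum (fun i => f i + g i) = fsum f + fsum g.
Proof.
move=> ff fg; have [s us [fs gs]] := finsuppU ff fg.
rewrite (fsumE us fs) (fsumE us gs) -big_split /=; apply: fsumE => // i.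
apply: contraNT => si; have [f0 g0] : f i = 0 /\ g i = 0.
  by split; apply/eqP; apply: contraNT si; [exact: fs|exact: gs].
by rewrite f0 g0 addr0.
Qed.

Lemma fsumZ c f : finsupp f -> fsum (fun i => c * f i) = c * fsum f.
Proof.
move=> ff; have [s us [fs _]] := finsuppU ff ff.
rewrite (fsumE us fs) mulr_sumr; apply: fsumE => // i.
by rewrite mulf_eq0 negb_or => /andP[_ /fs].
Qed.

Lemma eq_fsum f g : f =1 g -> fsum f = fsum g.
Proof. by move=> /funext ->. Qed.

Lemma ler_fsum f g : finsupp f -> finsupp g -> (forall i, f i <= g i) ->
  fsum f <= fsum g.
Proof.
move=> ff fg fg1; have [s us [fs gs]] := finsuppU ff fg.
by rewrite (fsumE us fs) (fsumE us gs) ler_sum.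
Qed.

Lemma fsum_pt f i0 : (forall i, i != i0 -> f i = 0) -> fsum f = f i0.
Proof.
move=> h; rewrite (@fsumE _ [:: i0])// ?big_seq1// => i.
by rewrite inE; apply: contraNT => /h ->.
Qed.

Lemma ler_fsum_seq f (s : seq T) : uniq s -> finsupp f -> (forall i, 0 <= f i) ->
  \sum_(i <- s) f i <= fsum f.
Proof.
move=> us [t ft] f0.
have ut : uniq (undup (s ++ t)) by apply: undup_uniq.
rewrite (fsumE ut); last by move=> i /ft it; rewrite mem_undup mem_cat it orbT.
have E : \sum_(i <- undup (s ++ t) | i \in s) f i = \sum_(i <- s) f i.
  rewrite -big_filter; apply: perm_big; apply: uniq_perm => //.
    by rewrite filter_uniq.
  by move=> i; rewrite mem_filter mem_undup mem_cat; case: (i \in s).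
by rewrite [leRHS](bigID (fun i => i \in s)) /= E lerDl; apply: sumr_ge0.
Qed.

Lemma ler_fsum1 f i : finsupp f -> (forall i, 0 <= f i) -> f i <= fsum f.
Proof.
by move=> ff f0; have := @ler_fsum_seq f [:: i] isT ff f0; rewrite big_seq1.
Qed.

Lemma fsum_ge0 f : finsupp f -> (forall i, 0 <= f i) -> 0 <= fsum f.
Proof. by move=> ff f0; have := @ler_fsum_seq f [::] isT ff f0; rewrite big_nil. Qed.

(** One finite rectangle has to contain the whole support; finiteness of each row and each column
    separately would not do. *)
Lemma exchange_fsum (F : T -> T -> R) (s t : seq T) :
  (forall i j, F i j != 0 -> (i \in s) && (j \in t)) ->
  fsum (fun i => fsum (F i)) = fsum (fun j => fsum (F^~ j)).
Proof.
move=> h; have us := undup_uniq s; have ut := undup_uniq t.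
have E1 i : fsum (F i) = \sum_(j <- undup t) F i j.
  by apply: fsumE => // j /h/andP[_]; rewrite mem_undup.
have E2 j : fsum (F^~ j) = \sum_(i <- undup s) F i j.
  by apply: fsumE => // i /h/andP[]; rewrite mem_undup.
rewrite (fsumE us); last first.
  move=> i; rewrite mem_undup; apply: contraNT => si; rewrite E1 big1// => j _.
  by apply/eqP; apply: contraNT si => /h/andP[].
rewrite (fsumE ut); last first.
  move=> j; rewrite mem_undup; apply: contraNT => sj; rewrite E2 big1// => i _.
  by apply/eqP; apply: contraNT sj => /h/andP[].
under eq_bigr do rewrite E1.
under [RHS]eq_bigr do rewrite E2.
exact: exchange_big.
Qed.

(** * Matrices with finite rows and their norms on finitely supported vectors *)

Definition rowfin a := forall i, finsupp (a i).
Definition colfin a := rowfin (fun i j => a j i).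
Definition symk a := forall i j, a i j = a j i.
(** The matrix [a] as an operator; [km] is the matrix product and [idk] the identity. *)
Definition ap a v i := fsum (fun j => a i j * v j).
Definition km a b i j := fsum (fun z => a i z * b z j).
Definition idk (i j : T) : R := (i == j)%:R.

Lemma rowfin_nb a : rowfin a ->
  exists nb : T -> seq T, forall i j, a i j != 0 -> j \in nb i.
Proof. by move=> ra; have [nb h] := choice ra; exists nb => i j; exact: h. Qed.

Lemma symk_colfin a : symk a -> rowfin a -> colfin a.
Proof. by move=> sa ra j; apply: sub_finsupp (ra j) => i; rewrite sa. Qed.

Lemma finsupp_ap a v : colfin a -> finsupp v -> finsupp (ap a v).
Proof.
move=> /rowfin_nb[nb anb] [s vs]; exists (flatten (map nb s)) => i.
apply: contraNT => si; rewrite /ap /fsum fsbig1// => j _.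
have [->|vj] := eqVneq (v j) 0; first by rewrite mulr0.
suff -> : a i j = 0 by rewrite mul0r.
apply/eqP; apply: contraNT si => /anb ij.
by apply/flatten_mapP; exists j => //; exact: vs.
Qed.

Lemma symk_km a : symk a -> symk (km a a).
Proof.
by move=> sa i j; apply: eq_fsum => z; rewrite mulrC (sa z j) (sa i z).
Qed.

Lemma rowfin_km a b : rowfin a -> rowfin b -> rowfin (km a b).
Proof.
move=> /rowfin_nb[na ha] /rowfin_nb[nb hb] i.
exists (flatten (map nb (na i))) => j; apply: contraNT => si.
rewrite /km /fsum fsbig1// => z _; apply/eqP; apply: contraNT si.
rewrite mulf_eq0 negb_or => /andP[/ha iz /hb zj].
by apply/flatten_mapP; exists z.
Qed.

Lemma colfin_km a b : colfin a -> colfin b -> colfin (km a b).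
Proof.
move=> ca cb j; apply: sub_finsupp (rowfin_km cb ca j) => i.
by congr (_ != _); apply: eq_fsum => z; rewrite mulrC.
Qed.

Lemma ap_km a b v : colfin b -> rowfin a -> rowfin b -> finsupp v ->
  ap (km a b) v = ap a (ap b v).
Proof.
move=> sb ra rb fv; apply: funext => i; rewrite /ap /km.
have [s as_] := ra i; have [t vt] := fv.
transitivity (fsum (fun j => fsum (fun z => a i z * b z j * v j))).
  apply: eq_fsum => j; rewrite mulrC -fsumZ; last exact: finsuppMl.
  by apply: eq_fsum => z; rewrite mulrC.
rewrite (@exchange_fsum _ t s).
  apply: eq_fsum => z; rewrite -fsumZ; last exact: finsuppMr.
  by apply: eq_fsum => j; rewrite mulrA.
move=> j z; rewrite !mulf_eq0 !negb_or => /andP[/andP[/as_ -> _] /vt ->]//.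
Qed.

Lemma ap_sym a v w : symk a -> rowfin a -> finsupp v -> finsupp w ->
  fsum (fun i => ap a v i * w i) = fsum (fun i => v i * ap a w i).
Proof.
move=> sa ra [s vs] [t wt].
transitivity (fsum (fun i => fsum (fun j => a i j * v j * w i))).
  apply: eq_fsum => i; rewrite mulrC -fsumZ; last exact: finsuppMl.
  by apply: eq_fsum => j; rewrite mulrC.
rewrite (@exchange_fsum _ t s).
  apply: eq_fsum => j; rewrite -fsumZ; last exact: finsuppMl.
  by apply: eq_fsum => i; rewrite sa mulrA (mulrC (v j)).
by move=> i j; rewrite !mulf_eq0 !negb_or => /andP[/andP[_ /vs ->] /wt ->].
Qed.

Definition bndk a (c : R) := forall v, finsupp v ->
  fsum (fun i => ap a v i ^+ 2) <= c ^+ 2 * fsum (fun i => v i ^+ 2).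

Lemma apD a b v : rowfin a -> rowfin b ->
  ap (fun i j => a i j + b i j) v = fun i => ap a v i + ap b v i.
Proof.
move=> ra rb; apply: funext => i; rewrite /ap -fsumD; try exact: finsuppMl.
by apply: eq_fsum => j; rewrite mulrDl.
Qed.

Lemma apZ a v c : rowfin a -> ap (fun i j => c * a i j) v = fun i => c * ap a v i.
Proof.
move=> ra; apply: funext => i; rewrite /ap -fsumZ; try exact: finsuppMl.
by apply: eq_fsum => j; rewrite mulrA.
Qed.

Lemma bndkZ a c d : rowfin a -> colfin a -> bndk a c ->
  bndk (fun i j => d * a i j) (d * c).
Proof.
move=> ra sa ac v fv; rewrite apZ//.
under eq_fsum do rewrite exprMn.
rewrite fsumZ; last by apply: finsupp_sqr; exact: finsupp_ap.
by rewrite exprMn -[leRHS]mulrA ler_wpM2l ?sqr_ge0//; exact: ac.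
Qed.

(** The triangle inequality without square roots: termwise, [(c + d) (d x^2 + c y^2) - c d (x + y)^2
    = (d x - c y)^2]. The argument divides by [c d], so a zero bound, which makes the vector itself
    vanish, is treated apart. *)
Lemma bndkD a b (c d : R) : rowfin a -> rowfin b -> colfin a -> colfin b ->
  0 <= c -> 0 <= d -> bndk a c -> bndk b d ->
  bndk (fun i j => a i j + b i j) (c + d).
Proof.
move=> ra rb sa sb; rewrite le_eqVlt => /predU1P[<- d0 a0 bd v fv|c0].
  rewrite add0r apD//; suff -> : ap a v = fun=> 0.
    by under eq_fsum do rewrite add0r; exact: bd.
  apply: funext => i; have fa := finsupp_ap sa fv.
  have := a0 _ fv; rewrite expr0n mul0r => h; apply/eqP.
  rewrite -sqrf_eq0 eq_le sqr_ge0 andbT; apply: le_trans h.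
  apply: (@ler_fsum1 (fun i => ap a v i ^+ 2)); last by move=> j; exact: sqr_ge0.
  exact: finsupp_sqr.
rewrite le_eqVlt => /predU1P[<- ac b0 v fv|d0 ac bd v fv].
  rewrite addr0 apD//; suff -> : ap b v = fun=> 0.
    by under eq_fsum do rewrite addr0; exact: ac.
  apply: funext => i; have fa := finsupp_ap sb fv.
  have := b0 _ fv; rewrite expr0n mul0r => h; apply/eqP.
  rewrite -sqrf_eq0 eq_le sqr_ge0 andbT; apply: le_trans h.
  apply: (@ler_fsum1 (fun i => ap b v i ^+ 2)); last by move=> j; exact: sqr_ge0.
  exact: finsupp_sqr.
rewrite apD//; have fx := finsupp_ap sa fv; have fy := finsupp_ap sb fv.
have {ac}/(_ _ fv) ac := ac; have {bd}/(_ _ fv) bd := bd.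
set x := ap a v in fx ac *; set y := ap b v in fy bd *.
set N := fsum (fun i => v i ^+ 2) in ac bd *.
set Sx := fsum (fun i => x i ^+ 2) in ac *; set Sy := fsum (fun i => y i ^+ 2) in bd *.
have cd0 : 0 < c * d by rewrite mulr_gt0.
rewrite -(ler_pM2l cd0).
apply: (@le_trans _ _ ((c + d) * (d * Sx + c * Sy))); last first.
  have h1 : d * Sx <= d * (c ^+ 2 * N) by rewrite ler_pM2l.
  have h2 : c * Sy <= c * (d ^+ 2 * N) by rewrite ler_pM2l.
  have -> : c * d * ((c + d) ^+ 2 * N) =
    (c + d) * (d * (c ^+ 2 * N) + c * (d ^+ 2 * N)) by ring.
  by rewrite ler_pM2l ?lerD// addr_gt0.
have fxy : finsupp (fun i => (x i + y i) ^+ 2) by exact/finsupp_sqr/finsuppD.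
have fx2 := finsupp_sqr fx; have fy2 := finsupp_sqr fy.
rewrite -fsumZ// /Sx /Sy -!fsumZ// -fsumD; try exact: finsuppMr.
rewrite -fsumZ; last by apply: finsuppD; apply: finsuppMr.
apply: ler_fsum.
- exact: finsuppMr.
- by apply: finsuppMr; apply: finsuppD; apply: finsuppMr.
move=> i; rewrite -subr_ge0.
have -> : (c + d) * (d * x i ^+ 2 + c * y i ^+ 2) - c * d * (x i + y i) ^+ 2 =
  (d * x i - c * y i) ^+ 2 by ring.
exact: sqr_ge0.
Qed.

Lemma bndk_km a b c d : rowfin a -> rowfin b -> colfin b ->
  bndk a c -> bndk b d -> bndk (km a b) (c * d).
Proof.
move=> ra rb sb ac bd v fv; rewrite ap_km//.
apply: le_trans (ac _ (finsupp_ap sb fv)) _.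
by rewrite exprMn -[leRHS]mulrA ler_wpM2l ?sqr_ge0//; exact: bd.
Qed.

(** The entry is one coordinate of the image of the basis vector at [j]. *)
Lemma bndk_entry a (c : R) i j : colfin a -> 0 <= c -> bndk a c ->
  `|a i j| <= c.
Proof.
move=> sa c0 ac; have fv : finsupp (idk j).
  by exists [:: j] => z; rewrite /idk pnatr_eq0 eqb0 negbK inE eq_sym.
have := ac _ fv.
have -> : fsum (fun i => idk j i ^+ 2) = 1.
  rewrite (@fsum_pt _ j) /idk ?eqxx ?expr1n// => z; rewrite eq_sym => /negPf ->.
  by rewrite expr0n.
have E z : ap a (idk j) z = a z j.
  rewrite /ap (@fsum_pt _ j) /idk ?eqxx ?mulr1// => k; rewrite eq_sym => /negPf ->.
  by rewrite mulr0.
rewrite mulr1 => h; rewrite -(@ler_sqr _ `|a i j|) ?nnegrE// real_normK ?num_real//.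
apply: le_trans h; rewrite -E.
apply: (@ler_fsum1 (fun i => ap a (idk j) i ^+ 2)); last by move=> z; exact: sqr_ge0.
by apply: finsupp_sqr; exact: finsupp_ap.
Qed.

Lemma rowfin_idk : rowfin idk.
Proof.
by move=> i; exists [:: i] => j; rewrite /idk pnatr_eq0 eqb0 negbK inE eq_sym.
Qed.

Lemma symk_idk : symk idk. Proof. by move=> i j; rewrite /idk eq_sym. Qed.

Lemma km_idkl a i j : km idk a i j = a i j.
Proof.
rewrite /km (@fsum_pt _ i) /idk ?eqxx ?mul1r// => z; rewrite eq_sym => /negPf ->.
by rewrite mul0r.
Qed.

Lemma km_idkr a i j : km a idk i j = a i j.
Proof.
rewrite /km (@fsum_pt _ j) /idk ?eqxx ?mulr1// => z /negPf ->.
by rewrite mulr0.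
Qed.

Lemma ap_idk v : ap idk v = v.
Proof.
apply: funext => i; rewrite /ap (@fsum_pt _ i) /idk ?eqxx ?mul1r// => z.
by rewrite eq_sym => /negPf ->; rewrite mul0r.
Qed.

Lemma rowfinD a b : rowfin a -> rowfin b -> rowfin (fun i j => a i j + b i j).
Proof. by move=> ra rb i; apply: finsuppD. Qed.

Lemma rowfinZ c a : rowfin a -> rowfin (fun i j => c * a i j).
Proof. by move=> ra i; apply: finsuppMr. Qed.

Definition psdk a := forall v, finsupp v -> 0 <= fsum (fun i => v i * ap a v i).

(** Bounded row sums and symmetry give [0 <= a <= 1] as forms, whence [a^2 <= a] and [|v - a v|^2 =
    |v|^2 - 2 <v, a v> + |a v|^2 <= |v|^2 - |a v|^2]. *)
Lemma bndk_psd1 a : symk a -> rowfin a -> psdk a ->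
  (forall i, fsum (fun j => `|a i j|) <= 1) ->
  bndk (fun i j => idk i j + -1 * a i j) 1.
Proof.
move=> sa ra pa a1 v fv; rewrite apD ?apZ ?ap_idk//; last 2 first.
- exact: rowfin_idk.
- exact: rowfinZ.
rewrite expr1n mul1r.
have quad w : finsupp w ->
    fsum (fun i => w i * ap a w i) <= fsum (fun i => w i ^+ 2).
  move=> fw; have [s ws] := fw.
  have fabs : rowfin (fun i j => `|a i j|).
    by move=> i; apply: sub_finsupp (ra i) => j; rewrite normr_eq0.
  have us := undup_uniq s.
  have wE (f : T -> R) : fsum (fun i => w i * f i) = \sum_(i <- undup s) w i * f i.
    apply: fsumE => // i; rewrite mem_undup mulf_eq0 negb_or => /andP[/ws//].
  have apE i : ap a w i = \sum_(j <- undup s) a i j * w j.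
    by apply: fsumE => // j; rewrite mem_undup mulf_eq0 negb_or => /andP[_ /ws].
  have w2E : fsum (fun i => w i ^+ 2) = \sum_(i <- undup s) w i ^+ 2.
    by apply: fsumE => // i; rewrite mem_undup expf_eq0 /= => /ws.
  have rowE i : \sum_(j <- undup s) `|a i j| <= 1.
    by apply: le_trans (a1 i); apply: ler_fsum_seq.
  rewrite wE w2E.
  (* Schur test: [|w i w j| <= (w i^2 + w j^2) / 2], and each half is summed along the rows, the
     second one after exchanging the indices by symmetry. *)
  apply: (@le_trans _ _ (\sum_(i <- undup s) \sum_(j <- undup s)
     (`|a i j| * (w i ^+ 2 / 2) + `|a i j| * (w j ^+ 2 / 2)))).
    apply: ler_sum => i _; rewrite apE mulr_sumr; apply: ler_sum => j _.
    apply: le_trans (ler_norm _) _; rewrite mulrCA normrM -mulrDr.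
    apply: ler_wpM2l => //; rewrite -mulrDl ler_pdivlMr// normrM.
    have := sqr_ge0 (`|w i| - `|w j|); rewrite sqrrB !real_normK ?num_real//.
    by rewrite mulr_natr; lra.
  under eq_bigr do rewrite big_split /=.
  rewrite big_split /=.
  rewrite [X in _ + X <= _]exchange_big /=.
  have half : \sum_(i <- undup s) \sum_(j <- undup s) `|a i j| * (w i ^+ 2 / 2) <=
      (\sum_(i <- undup s) w i ^+ 2) / 2.
    rewrite mulr_suml; apply: ler_sum => i _; rewrite -mulr_suml.
    by rewrite ler_piMl// divr_ge0// sqr_ge0.
  have half' : \sum_(j <- undup s) \sum_(i <- undup s) `|a i j| * (w j ^+ 2 / 2) <=
      (\sum_(i <- undup s) w i ^+ 2) / 2.
    apply: le_trans half; apply: ler_sum => i _; apply: ler_sum => j _.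
    by rewrite sa.
  lra.
have ca := symk_colfin sa ra.
have fa := finsupp_ap ca fv.
set u := ap a v in fa *.
have fau := finsupp_ap ca fa.
have fuu := finsupp_sqr fa; have fvv := finsupp_sqr fv.
have fvu : finsupp (fun i => v i * u i) by apply: finsuppMl.
have fnu : finsupp (fun i => -1 * u i) by apply: finsuppMr.
have fvmu : finsupp (fun i => v i + -1 * u i) by apply: finsuppD.
(* With [u = a v], this is positivity of the form at [v - u] combined with [quad] at [u]. *)
have h1 : fsum (fun i => u i ^+ 2) <= fsum (fun i => v i * u i).
  have := pa _ fvmu; have := quad _ fa.
  have E : ap a (fun i => v i + -1 * u i) = fun i => u i + -1 * ap a u i.
    apply: funext => i; rewrite /u /ap -/u -fsumZ; last exact: finsuppMl.
    rewrite -fsumD; [|exact: finsuppMl|by apply: finsuppMr; exact: finsuppMl].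
    by apply: eq_fsum => j; rewrite mulrDr mulrCA.
  rewrite E.
  have -> : fsum (fun i => (v i + -1 * u i) * (u i + -1 * ap a u i)) =
    fsum (fun i => v i * u i) + (-1 * fsum (fun i => u i ^+ 2) +
      (-1 * fsum (fun i => v i * ap a u i) + fsum (fun i => u i * ap a u i))).
    have fvau : finsupp (fun i => v i * ap a u i) by apply: finsuppMl.
    have fuau : finsupp (fun i => u i * ap a u i) by apply: finsuppMl.
    have g1 : finsupp (fun i => -1 * u i ^+ 2) by apply: finsuppMr.
    have g2 : finsupp (fun i => -1 * (v i * ap a u i)) by apply: finsuppMr.
    have g12 : finsupp (fun i => -1 * (v i * ap a u i) + u i * ap a u i).
      exact: finsuppD.
    rewrite -!fsumZ// -fsumD// -fsumD// -?fsumD//; last exact: finsuppD.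
    by apply: eq_fsum => i; ring.
  rewrite -(ap_sym sa ra fv fa) -/u.
  under [X in _ -> 0 <= _ + (_ + (-1 * X + _)) -> _]eq_fsum do rewrite -expr2.
  lra.
have -> : fsum (fun i => (v i + -1 * u i) ^+ 2) =
    fsum (fun i => v i ^+ 2) + (- 2 * fsum (fun i => v i * u i) +
       fsum (fun i => u i ^+ 2)).
  have f2 : finsupp (fun i => -2 * (v i * u i)) by apply: finsuppMr.
  rewrite -fsumZ// -fsumD// -fsumD//; last exact: finsuppD.
  by apply: eq_fsum => i; ring.
have : 0 <= fsum (fun i => u i ^+ 2).
  by apply: fsum_ge0 => // i; exact: sqr_ge0.
lra.
Qed.

(** The iteration for [b = 1]. It bounds the norms of the matrix iterates ([bndk_sqk]) and of their
    increments ([bndk_sqkB]). *)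
Fixpoint sqr_seq n : R := if n is m.+1 then 2^-1 * (1 + sqr_seq m ^+ 2) else 0.

Lemma sqr_seq_bounds n : 0 <= sqr_seq n <= 1.
Proof.
elim: n => [|n /andP[h0 h1]] /=; first by rewrite lexx ler01.
have : 0 <= sqr_seq n ^+ 2 <= 1 by rewrite sqr_ge0 expr_le1.
by lra.
Qed.

Lemma sqr_seq_nd n : sqr_seq n <= sqr_seq n.+1.
Proof.
by have := sqr_ge0 (1 - sqr_seq n); rewrite /= sqrrB expr1n mul1r mulr2n; lra.
Qed.

Lemma sqr_seq_step n : sqr_seq n.+2 - sqr_seq n.+1 <= sqr_seq n.+1 - sqr_seq n.
Proof.
have /andP[a0 a1] := sqr_seq_bounds n; have /andP[b0 b1] := sqr_seq_bounds n.+1.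
have -> : sqr_seq n.+2 - sqr_seq n.+1 =
    2^-1 * (sqr_seq n.+1 + sqr_seq n) * (sqr_seq n.+1 - sqr_seq n).
  rewrite -[sqr_seq n.+2]/(2^-1 * (1 + sqr_seq n.+1 ^+ 2)).
  rewrite -[X in _ - X = _]/(2^-1 * (1 + sqr_seq n ^+ 2)).
  by move: (sqr_seq n) (sqr_seq n.+1) => x y; ring.
by apply: ler_piMl; [rewrite subr_ge0 sqr_seq_nd|lra].
Qed.

(** The increments do not grow, so [n] times the current one is at most the sum of the [n] previous
    ones, which telescopes. *)
Lemma sqr_seq_gap n : n%:R * (sqr_seq n.+1 - sqr_seq n) <= sqr_seq n.
Proof.
elim: n => [|n IH]; first by rewrite mul0r.
have st := sqr_seq_step n.
rewrite -natr1 mulrDl mul1r.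
have : n%:R * (sqr_seq n.+2 - sqr_seq n.+1) <= n%:R * (sqr_seq n.+1 - sqr_seq n).
  by rewrite ler_wpM2l.
lra.
Qed.

Lemma sqr_seq_small (e : R) : 0 < e -> exists n, sqr_seq n.+1 - sqr_seq n <= e.
Proof.
move=> e0; exists (Num.bound e^-1); set n := Num.bound _.
have := sqr_seq_gap n; have /andP[_] := sqr_seq_bounds n.
move=> h1 h2; have {h1 h2} h := le_trans h2 h1.
have n0 : 0 < n%:R :> R by rewrite ltr0n.
rewrite -(ler_pM2l n0); apply: le_trans h _.
rewrite -ler_pdivrMr// mul1r.
by apply/ltW/archi_boundP; rewrite invr_ge0 ltW.
Qed.

(** * The iteration on matrices, compared with the iteration on numbers *)

Section Sqrt.
Variable b : T -> T -> R.
Hypotheses (sb : symk b) (rb : rowfin b) (b1 : bndk b 1).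

Fixpoint sqk n : T -> T -> R :=
  if n is m.+1 then fun i j => 2^-1 * (b i j + km (sqk m) (sqk m) i j)
  else fun _ _ => 0.

Lemma symk_sqk n : symk (sqk n).
Proof.
elim: n => [|n IH]//= i j; rewrite sb; congr (_ * (_ + _)); exact: symk_km.
Qed.

Lemma rowfin_sqk n : rowfin (sqk n).
Proof.
elim: n => [|n IH] /=; first by move=> i; exists [::] => j; rewrite eqxx.
by apply: rowfinZ; apply: rowfinD => //; exact: rowfin_km.
Qed.

Lemma bndk_sqk n : bndk (sqk n) (sqr_seq n).
Proof.
elim: n => [|n IH].
  move=> v fv; rewrite expr0n mul0r /ap.
  have -> : (fun i => fsum (fun j => sqk 0 i j * v j) ^+ 2) = fun=> 0.
    apply: funext => i; suff -> : fsum (fun j => sqk 0 i j * v j) = 0 by rewrite expr0n.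
    by rewrite /fsum fsbig1// => j _; rewrite mul0r.
  by rewrite /fsum fsbig1.
have rq := rowfin_sqk n; have sq := symk_sqk n.
have cq := symk_colfin sq rq; have cb := symk_colfin sb rb.
apply: (bndkZ (a := fun i j => b i j + km (sqk n) (sqk n) i j)).
- by apply: rowfinD => //; exact: rowfin_km.
- by apply: rowfinD => //; exact: colfin_km.
apply: bndkD => //; first exact: rowfin_km.
- exact: colfin_km.
- exact: sqr_ge0.
- by rewrite expr2; apply: bndk_km.
Qed.

(** The noncommutative form of [x^2 - y^2 = x (x - y) + (x - y) y]. *)
Lemma kmB n m i j :
  km (sqk n) (sqk n) i j - km (sqk m) (sqk m) i j =
  km (sqk n) (fun i j => sqk n i j - sqk m i j) i j +
  km (fun i j => sqk n i j - sqk m i j) (sqk m) i j.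
Proof.
have rn := rowfin_sqk n; have rm := rowfin_sqk m.
have fnm : finsupp (fun j => sqk n i j - sqk m i j).
  by apply: finsuppD => //; apply: sub_finsupp (rm i) => k; rewrite oppr_eq0.
rewrite /km -fsumD; try exact: finsuppMl.
rewrite -[X in _ - X]mul1r -mulNr -fsumZ; last exact: finsuppMl.
rewrite -fsumD; [|exact: finsuppMl|by apply: finsuppMr; exact: finsuppMl].
by apply: eq_fsum => z; ring.
Qed.

(** By [kmB] the increments of matrices and of numbers obey the same recurrence, and norms are
    subadditive and submultiplicative. *)
Lemma bndk_sqkB n :
  bndk (fun i j => sqk n.+1 i j - sqk n i j) (sqr_seq n.+1 - sqr_seq n).
Proof.
elim: n => [|n IH].
  have -> : sqr_seq 1 - sqr_seq 0 = sqr_seq 1 by rewrite subr0.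
  have -> : (fun i j => sqk 1 i j - sqk 0 i j) = sqk 1.
    by apply: funext => i; apply: funext => j; rewrite subr0.
  exact: bndk_sqk.
set D := fun i j => sqk n.+1 i j - sqk n i j.
have rn := rowfin_sqk n; have rm := rowfin_sqk n.+1.
have sn := symk_sqk n; have sm := symk_sqk n.+1.
have sD : symk D by move=> i j; rewrite /D sn sm.
have rD : rowfin D.
  by move=> i; apply: finsuppD => //; apply: sub_finsupp (rn i) => k; rewrite oppr_eq0.
have -> : (fun i j => sqk n.+2 i j - sqk n.+1 i j) =
    fun i j => 2^-1 * (km (sqk n.+1) D i j + km D (sqk n) i j).
  apply: funext => i; apply: funext => j; rewrite -kmB.
  rewrite -[sqk n.+2 i j]/(2^-1 * (b i j + km (sqk n.+1) (sqk n.+1) i j)).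
  rewrite -[sqk n.+1 i j]/(2^-1 * (b i j + km (sqk n) (sqk n) i j)).
  ring.
have -> : sqr_seq n.+2 - sqr_seq n.+1 =
    2^-1 * (sqr_seq n.+1 * (sqr_seq n.+1 - sqr_seq n) +
            (sqr_seq n.+1 - sqr_seq n) * sqr_seq n).
  rewrite -[sqr_seq n.+2]/(2^-1 * (1 + sqr_seq n.+1 ^+ 2)).
  rewrite -[X in _ - X = _]/(2^-1 * (1 + sqr_seq n ^+ 2)).
  by move: (sqr_seq n) (sqr_seq n.+1) => x y; ring.
have cD := symk_colfin sD rD.
have cn := symk_colfin sn rn; have cm := symk_colfin sm rm.
have kD := bndk_km rm rD cD (bndk_sqk n.+1) IH.
have kD' := bndk_km rD rn cn IH (bndk_sqk n).
have e0 : 0 <= sqr_seq n.+1 - sqr_seq n by rewrite subr_ge0 sqr_seq_nd.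
have q0 m : 0 <= sqr_seq m by case/andP: (sqr_seq_bounds m).
apply: (bndkZ (a := fun i j => km (sqk n.+1) D i j + km D (sqk n) i j)).
- by apply: rowfinD; exact: rowfin_km.
- by apply: rowfinD; exact: colfin_km.
have rk := rowfin_km rm rD; have ck := colfin_km cm cD.
have rk' := rowfin_km rD rn; have ck' := colfin_km cD cn.
apply: (bndkD rk rk' ck ck' _ _ kD kD'); apply: mulr_ge0 => //.
Qed.

End Sqrt.

(* With [S = 1 - q n], [S^2 - a = b - 2 q n + (q n)^2 = 2 (q n.+1 - q n)] for
   [b = 1 - a]. *)
Definition sqrtk a n i j :=
  idk i j - sqk (fun i j => idk i j + -1 * a i j) n i j.

(** The error matrix has norm at most twice the scalar increment, and the norm bounds every entry:
    hence the [e / 2], and the uniformity in [i] and [j]. *)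
Lemma sqrt_kernel a (e : R) : symk a -> rowfin a -> psdk a ->
  (forall i, fsum (fun j => `|a i j|) <= 1) -> 0 < e ->
  exists n, forall i j, `|km (sqrtk a n) (sqrtk a n) i j - a i j| <= e.
Proof.
move=> sa ra pa a1 e0; have e20 : 0 < e / 2 by rewrite divr_gt0.
have [n hn] := sqr_seq_small e20; exists n => i j.
set b := fun i j => idk i j + -1 * a i j; set S := sqrtk a n.
have rb : rowfin b by apply: rowfinD; [exact: rowfin_idk|exact: rowfinZ].
have sb : symk b by move=> k l; rewrite /b sa symk_idk.
have b1 : bndk b 1 by exact: bndk_psd1.
have rq := rowfin_sqk rb n; have sq := symk_sqk sb n.
have rS : rowfin S.
  move=> k; apply: finsuppD; first exact: rowfin_idk.
  by apply: sub_finsupp (rq k) => l; rewrite oppr_eq0.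
have -> : km S S i j - a i j = 2 * (sqk b n.+1 i j - sqk b n i j).
  have -> : km S S i j = idk i j - 2 * sqk b n i j + km (sqk b n) (sqk b n) i j.
    have f1 : finsupp (fun z => idk i z * idk z j).
      by apply: finsuppMl; exact: rowfin_idk.
    have f2 : finsupp (fun z => idk i z * sqk b n z j).
      by apply: finsuppMl; exact: rowfin_idk.
    have f3 : finsupp (fun z => sqk b n i z * idk z j) by apply: finsuppMl.
    have f4 : finsupp (fun z => sqk b n i z * sqk b n z j) by apply: finsuppMl.
    transitivity (fsum (fun z => idk i z * idk z j + (-1 * (idk i z * sqk b n z j) +
       (-1 * (sqk b n i z * idk z j) + sqk b n i z * sqk b n z j)))).
      by apply: eq_fsum => z; rewrite /S /sqrtk -/b; ring.
    have g2 : finsupp (fun z => -1 * (idk i z * sqk b n z j)) by apply: finsuppMr.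
    have g3 : finsupp (fun z => -1 * (sqk b n i z * idk z j)) by apply: finsuppMr.
    rewrite fsumD//; last by apply: finsuppD => //; exact: finsuppD.
    rewrite fsumD//; last exact: finsuppD.
    rewrite fsumD// !fsumZ//.
    have := km_idkl idk i j; rewrite /km => ->.
    have := km_idkl (sqk b n) i j; rewrite /km => ->.
    have := km_idkr (sqk b n) i j; rewrite /km => ->.
    ring.
  rewrite -[sqk b n.+1 i j]/(2^-1 * (b i j + km (sqk b n) (sqk b n) i j)) /b; field => //.
have /andP[q0 _] := sqr_seq_bounds n.
rewrite normrM gtr0_norm// mulrC -ler_pdivlMr//; apply: le_trans hn.
apply: (bndk_entry (a := fun i j => sqk b n.+1 i j - sqk b n i j)).
- apply: symk_colfin => [k l|k]; first by rewrite sq (symk_sqk sb n.+1).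
  apply: finsuppD; first exact: (rowfin_sqk rb n.+1).
  by apply: sub_finsupp (rq k) => l; rewrite oppr_eq0.
- by rewrite subr_ge0 sqr_seq_nd.
- exact: bndk_sqkB.
Qed.
End FiniteSums.

(** * Local sections of an etale groupoid *)

Section Topology.
Variable R : realType.

(** Used at the zeros of a weight: nothing is known there about the section, and only domination by
    the weight gives the limit. *)
Lemma cvg_dom0 (I : Type) (F : set_system I) {FF : Filter F} (f w : I -> R) :
  w @ F --> (0 : R) -> (\forall i \near F, `|f i| <= `|w i|) -> f @ F --> (0 : R).
Proof.
move=> w0 fw; apply/cvgr0Pnorm_lt => e e0.
have we := (cvgr0Pnorm_lt w).1 w0 e e0.
by apply: filterS2 fw (we FF) => i; exact: le_lt_trans.
Qed.

Lemma cvg_sumr (I J : Type) (F : set_system I) {FF : Filter F} (l : seq J)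
    (f : J -> I -> R) (a : J -> R) : (forall j, f j @ F --> a j) ->
  (fun i => \sum_(j <- l) f j i) @ F --> \sum_(j <- l) a j.
Proof.
move=> fa; elim: l => [|j l IH].
  by under eq_fun do rewrite big_nil; rewrite big_nil; exact: cvg_cst.
by under eq_fun do rewrite big_cons; rewrite big_cons; exact: cvgD.
Qed.

Lemma lc_nbhs (T : topologicalType) (lcT : lc_space T) (x : T) :
  exists U, [/\ nbhs x U, compact U & closed U].
Proof.
have [_ lc _] := lcT; have [U nU [cU clU]] := lc x I; exists U; split=> //.
by move: nU; rewrite /within /=; apply: filterS => y; exact.
Qed.

(** Compactness in its near-covering form, applied to the filter of lists that eventually contain a
    given list. *)
Lemma compact_seq (T : topologicalType) (I : Type) (Q : I -> T -> bool) (K : set T) :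
  compact K -> (forall x, K x -> exists i, \forall y \near x, Q i y) ->
  exists l : seq I, forall x, K x -> has (Q^~ x) l.
Proof.
move=> /compact_near_coveringP cK hQ.
(* No equality test is available on [I], so inclusion of lists is expressed through [has]. *)
pose sub (l l' : seq I) := forall q : pred I, has q l -> has q l'.
pose F : set_system (seq I) := filter_from setT (fun l0 => [set l | sub l0 l]).
have FF : Filter F.
  apply: filter_from_filter; first by exists [::].
  move=> l l' _ _; exists (l ++ l') => // l2 h; split=> q hq; apply: h;
    by rewrite has_cat hq ?orbT.
suff : \forall l \near F, K `<=` (fun x => has (Q^~ x) l).
  by move=> [l _ hl]; exists l => x Kx; apply: (hl l).
apply: cK => x Kx; have [i hi] := hQ x Kx.
exists ([set y | Q i y], [set l | sub [:: i] l]) => /=.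
  by split => //; exists [:: i].
by move=> [y l] /= [Qy]; apply; rewrite /= Qy.
Qed.

Lemma urysohn_lc (T : topologicalType) (lcT : lc_space T) (x : T) (U : set T) :
  nbhs x U -> exists w : T -> R, [/\ continuous w, forall y, 0 <= w y <= 1,
    \forall y \near x, w y = 1 & forall y, w y != 0 -> U y].
Proof.
move=> xU; have [hT lc _] := lcT.
have cr := @locally_compact_completely_regular T R lc hT.
have : uniform_separator [set x] (~` U°).
  apply: cr; first exact/open_closedC/open_interior.
  by move=> /=; apply; exact: xU.
move=> /uniform_separatorP => /(_ R)[f [cf f01 fx fU]].
have fx0 : f x = 0 by apply: fx; exists x.
(* Doubling and truncating gives the value 1 on the whole neighbourhood [f < 1/2] and not only at
   [x]. *)
exists (fun y => Num.min 1 (2 * (1 - f y))).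
have c1 : continuous (fun y => 2 * (1 - f y)).
  move=> y; apply: cvgM; first exact: cvg_cst.
  by apply: cvgB; [exact: cvg_cst|exact: cf].
split=> [y|y||y].
- exact: (continuous_min (cvg_cst _) (c1 y)).
- have : `[0, 1]%classic (f y) by apply: f01; exists y.
  rewrite /= in_itv /= => /andP[h0 h1].
  by rewrite le_min ler01 ge_min lexx/= mulr_ge0// subr_ge0.
- have : \forall y \near x, f y < 2^-1.
    have := cf x; rewrite /continuous_at fx0 => /cvgr_lt; apply.
    by rewrite invr_gt0.
  apply: filterS => y yf; apply/min_idPl.
  have : 2^-1 = 1/2 :> R by rewrite div1r.
  by move: yf; lra.
- apply: contraPP => Uy; suff -> : f y = 1.
    by rewrite subrr mulr0 (min_idPr _)// eqxx.
  by apply: fU; exists y => //= /interior_subset.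
Qed.

End Topology.

(** * Weighted local sections of the range map, and kernels that are continuous along them *)

Section WeightedSections.
Variable R : realType.
Variables (X G : topologicalType) (Gd : groupoid X G).
Hypotheses (lcG : lc_groupoid Gd) (etG : etale Gd).
Local Notation r := (gr Gd).
Local Notation s := (gs Gd).
Local Notation u := (gu Gd).
Local Notation inv := (ginv Gd).
Local Notation "g ** h" := (gmul Gd g h) (at level 40, left associativity).

Lemma r_cont : continuous r. Proof. by case: lcG => _ [? ? ? ?]. Qed.
Lemma s_cont : continuous s. Proof. by case: lcG => _ [? ? ? ?]. Qed.
Lemma u_cont : continuous u. Proof. by case: lcG => _ [? ? ? ?]. Qed.
Lemma inv_cont : continuous inv. Proof. by case: lcG => _ [? ? ? ?]. Qed.
Lemma G_haus : hausdorff_space G. Proof. by case: lcG => [[[]]]. Qed.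
Lemma X_lc : lc_space X. Proof. by case: lcG => [[]]. Qed.
Lemma X_haus : hausdorff_space X. Proof. by case: X_lc. Qed.
Lemma G_lc : lc_space G. Proof. by case: lcG => [[]]. Qed.

(** The product is continuous only on composable pairs, so composability is required eventually and
    at the limit. *)
Lemma gmul_cvg (I : Type) (F : set_system I) {FF : Filter F} (f h : I -> G) a b :
  f @ F --> a -> h @ F --> b -> (\forall i \near F, s (f i) = r (h i)) ->
  s a = r b -> (fun i => f i ** h i) @ F --> a ** b.
Proof.
move=> fa hb fh ab; have [_ _ mc _] := lcG.
have /subspace_continuousP/(_ (a, b) ab) cm := mc.
have fhc : (fun i => (f i, h i)) @ F --> within [set gh : G * G | s gh.1 = r gh.2]
    (nbhs (a, b)).
  move=> A; rewrite /within /= => wA.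
  have nA : nbhs ((fun i => (f i, h i)) @ F) [set z | s z.1 = r z.2 -> A z].
    exact: (cvg_pair fa hb) wA.
  by apply: filterS2 fh nA => i /= e; apply.
exact: cvg_trans (cvg_app (fun gh => gh.1 ** gh.2) fhc) cm.
Qed.

Lemma r_inj_near (g : G) : exists U : set G,
  nbhs g U /\ forall a b, U a -> U b -> r a = r b -> a = b.
Proof.
have [U [oU _ _ [k [_ kr]]]] := etG g; exists U; split.
  exact: open_nbhs_nbhs.
by move=> a b Ua Ub e; rewrite -(kr _ Ua) e kr.
Qed.

Lemma arrow_neq_near (I : Type) (F : set_system I) {FF : Filter F} (f h : I -> G) (a b : G) :
  f @ F --> a -> h @ F --> b -> a != b -> \forall i \near F, f i != h i.
Proof.
move=> fa hb ab; have := G_haus; rewrite open_hausdorff => /(_ _ _ ab).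
case=> -[A B] /= [aA bB] [oA oB AB].
have nA : nbhs a A by apply: open_nbhs_nbhs; split => //; exact/set_mem.
have nB : nbhs b B by apply: open_nbhs_nbhs; split => //; exact/set_mem.
have fA : \forall i \near F, A (f i) := fa _ nA.
have hB : \forall i \near F, B (h i) := hb _ nB.
apply: filterS2 fA hB => i Ai Bi; apply/eqP => e.
have : (A `&` B) (f i) by split => //; rewrite e.
by rewrite (eqP AB).
Qed.

(** Local injectivity of [r] in the form used throughout: arrows with the same range and a common
    limit end up equal, so one section may replace another in a limit. *)
Lemma arrow_eq_near (I : Type) (F : set_system I) {FF : Filter F} (f h : I -> G) (a : G) :
  f @ F --> a -> h @ F --> a -> (\forall i \near F, r (f i) = r (h i)) ->
  \forall i \near F, f i = h i.
Proof.
move=> fa ha rfh; have [U [aU inj]] := r_inj_near a.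
have fA : \forall i \near F, U (f i) := fa _ aU.
have hB : \forall i \near F, U (h i) := ha _ aU.
by apply: filterS3 rfh fA hB => i e Uf Uh; exact: inj.
Qed.

(* A local section of the range map together with a weight: [pk] is only
   meaningful where the weight [pw] is nonzero. *)
Record wsec := Wsec {
  pw : X -> R;
  pk : X -> G;
  pw_cont : continuous pw;
  pw01 : forall x, 0 <= pw x <= 1;
  pk_sec : forall x, pw x != 0 -> r (pk x) = x;
  pk_cont : forall x, pw x != 0 -> {for x, continuous pk}
}.

(** A bump function on [G]: the weight carried to the image of the section, which meets each fibre
    of [r] at most once. *)
Definition chi (p : wsec) (g : G) : R :=
  if pk p (r g) == g then pw p (r g) else 0.

Lemma chi01 p g : 0 <= chi p g <= 1.
Proof. by rewrite /chi; case: ifP => _; [exact: pw01|rewrite lexx ler01]. Qed.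

Lemma chi_ge0 p g : 0 <= chi p g.
Proof. by case/andP: (chi01 p g). Qed.

Lemma chi_pk p x : r (pk p x) = x -> chi p (pk p x) = pw p x.
Proof. by move=> e; rewrite /chi e eqxx. Qed.

Lemma chi_neq0 p g : chi p g != 0 -> pk p (r g) = g /\ pw p (r g) != 0.
Proof. by rewrite /chi; case: ifP => [/eqP|_ /eqP]. Qed.

(** Where the weight vanishes it dominates. Elsewhere, near an arrow of the section all arrows lie
    on it since [r] is locally injective, and an arrow off the section stays apart from it since [G]
    is Hausdorff. *)
Lemma chi_cont p : continuous (chi p).
Proof.
move=> g; rewrite /continuous_at.
have wr : (fun h => pw p (r h)) @ g --> pw p (r g).
  by apply: continuous_comp; [exact: r_cont|exact: pw_cont].
have [w0|w0] := eqVneq (pw p (r g)) 0.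
  have -> : chi p g = 0 by rewrite /chi w0; case: ifP.
  apply: (@cvg_dom0 _ _ _ _ _ (fun h => pw p (r h))); first by rewrite -w0.
  by apply: nearW => h; rewrite /chi; case: ifP => // _; rewrite normr0.
have kc : (fun h => pk p (r h)) @ g --> pk p (r g).
  by apply: continuous_comp; [exact: r_cont|exact: pk_cont].
have w0n : \forall h \near g, pw p (r h) != 0 by exact: (cvgr_neq0 (pw p (r g)) wr w0).
have [e|ne] := eqVneq (pk p (r g)) g.
  have -> : chi p g = pw p (r g) by rewrite /chi e eqxx.
  apply: cvg_trans wr; apply: near_eq_cvg.
  have kg : (fun h => pk p (r h)) @ g --> g by rewrite -{2}e.
  have : \forall h \near g, pk p (r h) = h.
    have ig : (fun h : G => h) @ g --> g by exact: cvg_id.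
    apply: (arrow_eq_near kg ig); apply: filterS w0n => h; exact: pk_sec.
  by apply: filterS => h eh; rewrite /chi eh eqxx.
have -> : chi p g = 0 by rewrite /chi (negPf ne).
apply: (@cvg_trans _ ((fun=> 0 : R) @ g)); last exact: cvg_cst.
apply: near_eq_cvg.
by apply: filterS (arrow_neq_near kc cvg_id ne) => h eh; rewrite /chi (negPf eh).
Qed.

Lemma wsec_ex (g0 : G) (V : set G) : nbhs g0 V -> exists p : wsec,
  (\forall g \near g0, chi p g = 1) /\ (forall x, pw p x != 0 -> V (pk p x)).
Proof.
move=> gV; have [U [[oU Ug0] orU _ [k [kc kr]]]] := etG g0.
have kcx x : (r @` U) x -> {for x, continuous k}.
  move=> Ux; move: kc; rewrite continuous_open_subspace// => /(_ x); apply.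
  exact: mem_set.
have rUg0 : (r @` U) (r g0) by exists g0.
have W : nbhs (r g0) (r @` U `&` k @^-1` V).
  apply: filterI; first exact: open_nbhs_nbhs.
  by apply: (kcx _ rUg0); rewrite kr.
have [w [wc w01 w1 wW]] := urysohn_lc R X_lc W.
have ks x : w x != 0 -> r (k x) = x by move=> /wW[[h Uh <-] _]; rewrite kr.
have kw x : w x != 0 -> {for x, continuous k} by move=> /wW[/kcx].
exists (Wsec wc w01 ks kw); split; last by move=> x /= /wW[].
have w1r : \forall g \near g0, w (r g) = 1 by apply: (r_cont w1).
have nU : nbhs g0 U by exact: open_nbhs_nbhs.
by apply: filterS2 w1r nU => g e Ug; rewrite /chi /= kr// eqxx.
Qed.

Lemma unit_wsec_subproof x : (1 : R) != 0 -> {for x, continuous u}.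
Proof. by move=> _; exact: u_cont. Qed.

Lemma one01 (x : X) : 0 <= (1 : R) <= 1. Proof. by rewrite ler01 lexx. Qed.

Definition unit_wsec : wsec :=
  Wsec (fun x => cvg_cst (1 : R)) one01 (fun x _ => gr_u Gd x) unit_wsec_subproof.

(** Each fibre of [r] meets [D] in at most [size l] arrows. Asking for the value 1 makes the
    property stable under products ([chi_pcomp]). *)
Definition thin (D : set G) :=
  exists l : seq wsec, forall g, D g -> has (fun p => chi p g == 1) l.

Lemma thinS D D' : D `<=` D' -> thin D' -> thin D.
Proof. by move=> DD' [l hl]; exists l => g /DD'/hl. Qed.

Lemma thinU D D' : thin D -> thin D' -> thin (D `|` D').
Proof.
move=> [l hl] [l' hl']; exists (l ++ l') => g [/hl|/hl'] h; rewrite has_cat h//.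
by rewrite orbT.
Qed.

Lemma thin_unit : thin (range u).
Proof.
by exists [:: unit_wsec] => _ [x _ <-] /=; rewrite /chi/= gr_u eqxx eqxx.
Qed.

Lemma thin_compact D : compact D -> thin D.
Proof.
move=> cD; apply: (@compact_seq _ _ (fun p g => chi p g == 1) D cD) => g _.
have [p [hp _]] := wsec_ex (filterT : nbhs g setT).
by exists p; apply: filterS hp => h /eqP.
Qed.

Lemma thin_precompact D : precompact D -> thin D.
Proof.
by rewrite precompactE => /thin_compact; apply: thinS; exact: subset_closure.
Qed.

Section Compose.
Variables p q : wsec.
Let cw x := pw p x * pw q (s (pk p x)).
Let ck x := pk p x ** pk q (s (pk p x)).

Let cw_neq0 x : cw x != 0 -> pw p x != 0 /\ pw q (s (pk p x)) != 0.
Proof. by rewrite /cw mulf_eq0 negb_or => /andP[]. Qed.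

Let sp_cont x : pw p x != 0 -> (fun y => s (pk p y)) @ x --> s (pk p x).
Proof.
by move=> h; apply: continuous_comp; [exact: pk_cont|exact: s_cont].
Qed.

Let cw_cont : continuous cw.
Proof.
move=> x; rewrite /continuous_at; have wx : pw p @ x --> pw p x := @pw_cont p x.
have [w0|w0] := eqVneq (pw p x) 0.
  rewrite {2}/cw w0 mul0r; apply: (@cvg_dom0 _ _ _ _ _ (pw p)).
    by rewrite -w0.
  apply: nearW => y; rewrite /cw normrM ler_piMr//.
  by have /andP[h0 h1] := pw01 q (s (pk p y)); rewrite ger0_norm.
apply: cvgM => //; apply: (cvg_comp _ _ (sp_cont w0)); exact: pw_cont.
Qed.

Let cw01 x : 0 <= cw x <= 1.
Proof.
have /andP[h0 h1] := pw01 q (s (pk p x)); have /andP[k0 k1] := pw01 p x.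
by rewrite mulr_ge0// mulr_ile1.
Qed.

Let ck_sec x : cw x != 0 -> r (ck x) = x.
Proof. by move=> /cw_neq0[h k]; rewrite gr_mul ?pk_sec. Qed.

Let ck_cont x : cw x != 0 -> {for x, continuous ck}.
Proof.
move=> /cw_neq0[h k]; rewrite /continuous_at /ck.
have kp : pk p @ x --> pk p x by exact: pk_cont.
have kq : (fun y => pk q (s (pk p y))) @ x --> pk q (s (pk p x)).
  by apply: (cvg_comp _ _ (sp_cont h)); exact: pk_cont.
apply: gmul_cvg => //; last by rewrite pk_sec.
have wq : (fun y => pw q (s (pk p y))) @ x --> pw q (s (pk p x)).
  by apply: (cvg_comp _ _ (sp_cont h)); exact: pw_cont.
by apply: filterS (cvgr_neq0 _ wq k) => y /pk_sec ->.
Qed.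

Definition pcomp := Wsec cw_cont cw01 ck_sec ck_cont.

Lemma chi_pcomp g h : s g = r h -> chi p g = 1 -> chi q h = 1 ->
  chi pcomp (g ** h) = 1.
Proof.
move=> gh pg qh; have [|kp _] := @chi_neq0 p g; first by rewrite pg oner_neq0.
have [|kq _] := @chi_neq0 q h; first by rewrite qh oner_neq0.
move: pg qh; rewrite /chi kp kq !eqxx /= /ck /cw => pg qh.
by rewrite gr_mul// kp gh kq eqxx pg qh mulr1.
Qed.

End Compose.

Definition gprod (D D' : set G) : set G :=
  [set k | exists g h, [/\ D g, D' h, s g = r h & k = g ** h]].

Lemma thinM D D' : thin D -> thin D' -> thin (gprod D D').
Proof.
move=> [l hl] [l' hl'].
exists (flatten [seq [seq pcomp p q | q <- l'] | p <- l]) => _ [g [h [Dg Dh gh ->]]].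
have pg := hl g Dg; have qh := hl' h Dh.
elim: l {hl} pg => //= p l IH /orP[/eqP pg|/IH k]; last by rewrite has_cat k orbT.
rewrite has_cat has_map; apply/orP; left.
by apply: sub_has qh => q /eqP qh /=; rewrite chi_pcomp.
Qed.

Section Normalize.
Variables (l : seq wsec) (p : wsec).
Let S g := \sum_(q <- l) chi q g.
Let nw x := pw p x / Num.max 1 (S (pk p x)).

Let M_ge1 x : 1 <= Num.max 1 (S (pk p x)).
Proof. by rewrite le_max lexx. Qed.

Let S_cont : continuous S.
Proof.
move=> g; apply: cvg_sumr => q; exact: chi_cont.
Qed.

Let nw_le x : `|nw x| <= `|pw p x|.
Proof.
rewrite normrM ler_piMr// ger0_norm ?invr_ge0 ?(le_trans ler01)//.
by rewrite invf_le1// (lt_le_trans ltr01).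
Qed.

Let nw_cont : continuous nw.
Proof.
move=> x; rewrite /continuous_at; have wx : pw p @ x --> pw p x := @pw_cont p x.
have [w0|w0] := eqVneq (pw p x) 0.
  rewrite {2}/nw w0 mul0r; apply: (@cvg_dom0 _ _ _ _ _ (pw p)).
    by rewrite -w0.
  by apply: nearW => y; exact: nw_le.
apply: cvgM => //; apply: cvgV; first by rewrite gt_eqF// (lt_le_trans ltr01).
have Sk : (fun y => S (pk p y)) @ x --> S (pk p x).
  by apply: continuous_comp; [exact: pk_cont|exact: S_cont].
exact: (continuous_max (cvg_cst _) Sk).
Qed.

Let nw01 x : 0 <= nw x <= 1.
Proof.
have /andP[h0 h1] := pw01 p x.
have nw0 : 0 <= nw x by rewrite divr_ge0// (le_trans ler01).
by rewrite nw0 -(ger0_norm nw0) (le_trans (nw_le x))// ger0_norm.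
Qed.

Let nw_neq0 x : nw x != 0 -> pw p x != 0.
Proof. by rewrite /nw mulf_eq0 negb_or => /andP[]. Qed.

Definition pnorm := Wsec nw_cont nw01 (fun x h => pk_sec (nw_neq0 h))
  (fun x h => pk_cont (nw_neq0 h)).

Lemma chi_pnorm g : chi pnorm g = chi p g / Num.max 1 (S g).
Proof.
by rewrite /chi /= /nw; case: ifP => [/eqP ->//|_]; rewrite mul0r.
Qed.

End Normalize.

(** Dividing by the maximum of 1 and the sum avoids the zeros of the sum off [D]; on [D] some [chi]
    is 1, so the maximum is the sum. *)
Lemma thin_partition D : thin D -> exists l : seq wsec,
  forall g, D g -> \sum_(p <- l) chi p g = 1.
Proof.
move=> [l hl]; exists [seq pnorm l p | p <- l] => g Dg.
rewrite big_map; under eq_bigr do rewrite chi_pnorm.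
rewrite -mulr_suml; suff S1 : 1 <= \sum_(p <- l) chi p g.
  by rewrite (max_idPr S1) divff// gt_eqF// (lt_le_trans ltr01).
have := hl g Dg; elim: l {hl} => //= p l IH.
rewrite big_cons => /orP[/eqP ->|/IH h].
  by rewrite lerDl; apply: sumr_ge0 => q _; case/andP: (chi01 q g).
by rewrite (le_trans h)// lerDr; case/andP: (chi01 p g).
Qed.

Lemma arrow_mulVK g h : r g = r h -> g ** (inv g ** h) = h.
Proof.
move=> gh; rewrite -gmulA ?gr_inv ?gs_inv//.
by rewrite gmul_Vr gh gmul_ul.
Qed.

Lemma arrow_mulK g h : s g = r h -> inv g ** (g ** h) = h.
Proof.
move=> gh; rewrite -gmulA ?gs_inv ?gr_inv//.
by rewrite gmul_Vl gh gmul_ul.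
Qed.

Lemma rinv_mul g h : r g = r h -> r (inv g ** h) = s g.
Proof. by move=> gh; rewrite gr_mul ?gs_inv// gr_inv. Qed.

(** The products [chi p (inv g ** h) * F h] add up to [F h], and each is nonzero at most at
    [h = g ** pk p (s g)]. The number of terms does not depend on [g]; this is the source of all
    continuity and uniform bounds for sums over fibres. *)
Lemma fibre_sum (D : set G) (l : seq wsec) g (F : G -> R) :
  (forall h, D h -> \sum_(p <- l) chi p h = 1) ->
  (forall h, F h != 0 -> r h = r g /\ D (inv g ** h)) ->
  finsupp F /\
  fsum F = \sum_(p <- l) pw p (s g) * F (g ** pk p (s g)).
Proof.
move=> hl hF.
have FE h : F h = \sum_(p <- l) chi p (inv g ** h) * F h.
  rewrite -mulr_suml; have [->|/hF[_ /hl ->]] := eqVneq (F h) 0.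
    by rewrite mulr0.
  by rewrite mul1r.
have term p h : chi p (inv g ** h) * F h != 0 -> h = g ** pk p (s g).
  rewrite mulf_eq0 negb_or => /andP[/chi_neq0[kp _] /hF[rh _]].
  by rewrite -[LHS](arrow_mulVK (esym rh)) -{1}kp rinv_mul.
have fterm p : finsupp (fun h => chi p (inv g ** h) * F h).
  by exists [:: g ** pk p (s g)] => h /term ->; rewrite inE.
have sumE (l' : seq wsec) :
    finsupp (fun h => \sum_(p <- l') chi p (inv g ** h) * F h) /\
    fsum (fun h => \sum_(p <- l') chi p (inv g ** h) * F h) =
    \sum_(p <- l') fsum (fun h => chi p (inv g ** h) * F h).
  elim: l' => [|p l' [IH1 IH2]].
    under eq_fsum do rewrite big_nil; rewrite big_nil; split.
      by exists [::] => h; rewrite big_nil eqxx.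
    by rewrite (@fsum_pt _ _ _ g).
  under eq_fsum do rewrite big_cons.
  rewrite big_cons -IH2 fsumD//; split => //.
  under eq_fun do rewrite big_cons; exact: finsuppD.
have [fl El] := sumE l; split.
  by apply: sub_finsupp fl => h; rewrite -FE.
rewrite (eq_fsum FE) El; apply: eq_bigr => p _.
rewrite (@fsum_pt _ _ _ (g ** pk p (s g))); last first.
  by move=> h; apply: contraNeq => /term ->.
have [w0|w0] := eqVneq (pw p (s g)) 0.
  rewrite w0 mul0r; apply/eqP; apply: contraT => /[dup] /term _.
  rewrite mulf_eq0 negb_or => /andP[/chi_neq0[kp kw] /hF[rh _]].
  by move: kw; rewrite rinv_mul ?w0 ?eqxx// rh.
by rewrite arrow_mulK ?pk_sec// chi_pk// pk_sec.
Qed.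

(* Real continuous kernels on [G *_r G], extended by 0; a thin set takes the
   place of a compact one so that [idk] qualifies. *)
Definition tkern (a : G -> G -> R) :=
  [/\ exists2 D, thin D & forall g h, a g h != 0 -> r g = r h /\ D (inv g ** h),
      exists M : R, forall g h, `|a g h| <= M &
      forall g h, r g = r h ->
        (fun z => a z.1 z.2) @ within (rprod Gd) (nbhs (g, h)) --> a g h].

Lemma tkern_cvg a (I : Type) (F : set_system I) {FF : Filter F} (f h : I -> G)
    (g k : G) : tkern a -> f @ F --> g -> h @ F --> k ->
  (\forall i \near F, r (f i) = r (h i)) -> r g = r k ->
  (fun i => a (f i) (h i)) @ F --> a g k.
Proof.
move=> [_ _ ac] fg hk fh gk.
have fhc : (fun i => (f i, h i)) @ F --> within (rprod Gd) (nbhs (g, k)).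
  move=> A; rewrite /within /= => wA.
  have nA : nbhs ((fun i => (f i, h i)) @ F) [set z | rprod Gd z -> A z].
    exact: (cvg_pair fg hk) wA.
  by apply: filterS2 fh nA => i /= e; apply.
exact: cvg_trans (cvg_app (fun z => a z.1 z.2) fhc) (ac _ _ gk).
Qed.

Lemma tkern_rowfin a : tkern a -> rowfin a.
Proof.
move=> [[D tD aD] _ _] g; have [l hl] := thin_partition tD.
have [|//] := @fibre_sum D l g (a g) hl.
by move=> h /aD[-> //].
Qed.

(** [fibre_sum] turns the product into a sum over a fixed list of sections, which gives bound and
    continuity; the support comes from [g^-1 h = (g^-1 z) (z^-1 h)]. *)
Lemma tkern_km a b : tkern a -> tkern b -> tkern (km a b).
Proof.
move=> ta tb; have [[D tD aD] [M aM] ac] := ta; have [[D' tD' bD] [N bN] bc] := tb.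
have [l hl] := thin_partition tD.
have kmE g h : km a b g h =
    \sum_(p <- l) pw p (s g) * (a g (g ** pk p (s g)) * b (g ** pk p (s g)) h).
  rewrite /km; have [|_ ->//] := @fibre_sum D l g (fun z => a g z * b z h) hl.
  by move=> z; rewrite mulf_eq0 negb_or => /andP[/aD[-> ?] _].
split.
- exists (gprod D D'); first exact: thinM.
  move=> g h kgh; have [z] : exists z, a g z * b z h != 0.
    apply: contrapT => /forallNP H; move: kgh; rewrite /km /fsum fsbig1 ?eqxx//.
    by move=> z _; apply/eqP; apply: contraT => /H.
  rewrite mulf_eq0 negb_or => /andP[/aD[gz Dgz] /bD[zh Dzh]].
  split; first by rewrite gz.
  exists (inv g ** z), (inv z ** h); split=> //.
    by rewrite gs_mul ?gs_inv// gr_mul ?gs_inv// gr_inv.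
  rewrite gmulA ?gs_inv//; last by rewrite gr_mul ?gs_inv// gr_inv.
  by rewrite arrow_mulVK.
- exists (\sum_(p <- l) M * N) => g h; rewrite kmE.
  apply: le_trans (ler_norm_sum _ _ _) _; apply: ler_sum => p _.
  have /andP[p0 p1] := pw01 p (s g).
  rewrite normrM (ger0_norm p0); apply: le_trans (ler_piMl _ p1) _ => //.
  by rewrite normrM ler_pM.
- move=> g h gh; have -> : (fun z => km a b z.1 z.2) = fun z => \sum_(p <- l)
      pw p (s z.1) * (a z.1 (z.1 ** pk p (s z.1)) * b (z.1 ** pk p (s z.1)) z.2).
    by apply: funext => z; exact: kmE.
  rewrite kmE; apply: cvg_sumr => p.
  set F := within _ _.
  have c1 : (fun z : G * G => z.1) @ F --> g.
    by apply: cvg_trans (cvg_app _ (cvg_within _)) _; exact: cvg_fst.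
  have c2 : (fun z : G * G => z.2) @ F --> h.
    by apply: cvg_trans (cvg_app _ (cvg_within _)) _; exact: cvg_snd.
  have rF : \forall z \near F, r z.1 = r z.2 by rewrite /F near_withinE; apply: nearW.
  have cs : (fun z : G * G => s z.1) @ F --> s g by apply: (cvg_comp _ _ c1); exact: s_cont.
  have cw : (fun z : G * G => pw p (s z.1)) @ F --> pw p (s g).
    by apply: (cvg_comp _ _ cs); exact: pw_cont.
  have [w0|w0] := eqVneq (pw p (s g)) 0.
    rewrite w0 mul0r.
    apply: (@cvg_dom0 _ _ _ _ _ (fun z : G * G => pw p (s z.1) * (M * N))).
      by rewrite -[0](mul0r (M * N)) -w0; apply: cvgM => //; exact: cvg_cst.
    apply: nearW => z; rewrite normrM [leRHS]normrM ler_wpM2l//.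
    by rewrite normrM (le_trans _ (ler_norm _))// ler_pM.
  have ck : (fun z : G * G => pk p (s z.1)) @ F --> pk p (s g).
    by apply: (cvg_comp _ _ cs); exact: pk_cont.
  have wn : \forall z \near F, pw p (s z.1) != 0 by exact: cvgr_neq0 cw w0.
  have cm : (fun z : G * G => z.1 ** pk p (s z.1)) @ F --> g ** pk p (s g).
    apply: gmul_cvg => //; last by rewrite pk_sec.
    by apply: filterS wn => z /pk_sec ->.
  apply: cvgM => //; apply: cvgM; apply: tkern_cvg => //.
  + by apply: filterS wn => z /pk_sec k; rewrite gr_mul ?k.
  + by rewrite gr_mul ?pk_sec.
  + by apply: filterS2 rF wn => z rz /pk_sec k; rewrite gr_mul ?k.
  + by rewrite gr_mul ?pk_sec.
Qed.

Lemma tkernD a b : tkern a -> tkern b -> tkern (fun g h => a g h + b g h).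
Proof.
move=> [[D tD aD] [M aM] ac] [[D' tD' bD] [N bN] bc]; split.
- exists (D `|` D'); first exact: thinU.
  move=> g h; have [a0|/aD[? ?] _] := eqVneq (a g h) 0; last by split => //; left.
  by rewrite a0 add0r => /bD[? ?]; split => //; right.
- by exists (M + N) => g h; rewrite (le_trans (ler_normD _ _))// lerD.
- by move=> g h gh; apply: cvgD; [exact: ac|exact: bc].
Qed.

Lemma tkernZ c a : tkern a -> tkern (fun g h => c * a g h).
Proof.
move=> [[D tD aD] [M aM] ac]; split.
- by exists D => // g h; rewrite mulf_eq0 negb_or => /andP[_ /aD].
- by exists (`|c| * M) => g h; rewrite normrM ler_wpM2l.
- by move=> g h gh; apply: cvgM; [exact: cvg_cst|exact: ac].
Qed.

(** The diagonal is open in [rprod] because [r] is locally injective, and closed because [G] is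
    Hausdorff. *)
Lemma tkern_idk : tkern (@idk R G).
Proof.
split.
- exists (range u); first exact: thin_unit.
  move=> g h; rewrite /idk pnatr_eq0 eqb0 negbK => /eqP <-; split => //.
  by rewrite gmul_Vl; exists (s g).
- by exists 1 => g h; rewrite /idk; case: (g == h); rewrite ?normr1 ?normr0.
- move=> g h gh; set F := within _ _.
  have c1 : (fun z : G * G => z.1) @ F --> g.
    by apply: cvg_trans (cvg_app _ (cvg_within _)) _; exact: cvg_fst.
  have c2 : (fun z : G * G => z.2) @ F --> h.
    by apply: cvg_trans (cvg_app _ (cvg_within _)) _; exact: cvg_snd.
  have rF : \forall z \near F, r z.1 = r z.2 by rewrite /F near_withinE; apply: nearW.
  apply: (@cvg_trans _ ((fun=> idk R g h) @ F)); last exact: cvg_cst.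
  apply: near_eq_cvg; rewrite /idk.
  have [e|ne] := eqVneq g h.
    have c2' : (fun z : G * G => z.2) @ F --> g by rewrite e.
    by apply: filterS (arrow_eq_near c1 c2' rF) => z ->; rewrite eqxx.
  by apply: filterS (arrow_neq_near c1 c2 ne) => z /negPf ->.
Qed.

Lemma tkern_sqk b n : tkern b -> tkern (sqk b n).
Proof.
move=> tb; elim: n => [|n IH] /=; last first.
  by apply: tkernZ; apply: tkernD => //; exact: tkern_km.
split.
- by exists set0; [exists [::]|move=> g h; rewrite eqxx].
- by exists 0 => g h; rewrite normr0.
- by move=> g h _; exact: cvg_cst.
Qed.

Lemma tkern_sqrtk a n : tkern a -> tkern (sqrtk a n).
Proof.
move=> ta.
have -> : sqrtk a n = fun g h => idk R g h + -1 * sqk (fun i j => idk R i j + -1 * a i j) n g h.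
  by apply: funext => g; apply: funext => h; rewrite /sqrtk mulN1r.
apply: tkernD; first exact: tkern_idk.
apply: tkernZ; apply: tkern_sqk; apply: tkernD; first exact: tkern_idk.
exact: tkernZ.
Qed.

End WeightedSections.

(** * Densities from kernels *)

Section Densities.
Variable R : realType.
Variables (X G : topologicalType) (Gd : groupoid X G).
Hypotheses (lcG : lc_groupoid Gd) (etG : etale Gd).
Local Notation r := (gr Gd).
Local Notation s := (gs Gd).
Local Notation u := (gu Gd).
Local Notation inv := (ginv Gd).
Local Notation "g ** h" := (gmul Gd g h) (at level 40, left associativity).

(** The integral of [th] against the measure at [g]. Where a weight vanishes the evaluation point is
    arbitrary, but [density] then makes its coefficient 0. *)
Definition average (L : nat) (P : nat -> wsec R Gd) (phi : nat -> G -> R) (g : G)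
    (th : G -> R) : R :=
  \sum_(j < L) phi j g * th (g ** pk (P j) (s g)).

(* [phi j g] is the mass at [g ** pk (P j) (s g)] of a probability on the fibre of
   [r g]; the points for different [j] may coincide. *)
Definition density (L : nat) (P : nat -> wsec R Gd) (phi : nat -> G -> R) :=
  [/\ forall j, continuous (phi j),
      forall j g, 0 <= phi j g <= pw (P j) (s g) &
      forall g, \sum_(j < L) phi j g = 1].

Lemma tkern_rowsum (a : G -> G -> R) : tkern Gd a ->
  exists2 C : R, 0 < C & forall g, fsum (fun h => `|a g h|) <= C.
Proof.
move=> [[D tD aD] [M aM] _]; have [l hl] := thin_partition lcG etG tD.
(* The 1 keeps the bound positive when [l] is empty or [M] is 0; it is inverted later. *)
exists (\sum_(p <- l) `|M| + 1); first by rewrite ltr_wpDl//; exact: sumr_ge0.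
move=> g; have [|_ ->] := @fibre_sum _ _ _ _ D l g (fun h => `|a g h|) hl.
  by move=> h; rewrite normr_eq0 => /aD[->].
rewrite -[leLHS]addr0 lerD// ler_sum// => p _; have /andP[p0 p1] := pw01 p (s g).
by rewrite (le_trans (ler_piMl _ p1))// (le_trans (aM _ _))// ler_norm.
Qed.

Lemma psdkZ (a : G -> G -> R) (c : R) : 0 <= c -> rowfin a -> symk a -> psdk a ->
  psdk (fun g h => c * a g h).
Proof.
move=> c0 ra sa pa v fv; rewrite apZ//.
have -> : (fun i => v i * (c * ap a v i)) = fun i => c * (v i * ap a v i).
  by apply: funext => i; rewrite mulrCA.
by rewrite fsumZ ?mulr_ge0 ?pa//; exact: finsuppMl.
Qed.

(** From [2 t |x - y| |x + y| <= (x - y)^2 + t^2 (x + y)^2]. Being additive, it can be summed over a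
    fibre in place of the Cauchy-Schwarz inequality. *)
Lemma sqr_diff_bound (x y t : R) : 0 < t ->
  `|x ^+ 2 - y ^+ 2| <= (2 * t)^-1 * (x - y) ^+ 2 + t * (x ^+ 2 + y ^+ 2).
Proof.
move=> t0; have t20 : 0 < 2 * t by rewrite mulr_gt0.
rewrite -(ler_pM2l t20) mulrDr mulrA divff ?gt_eqF// mul1r.
have h : (x + y) ^+ 2 <= 2 * (x ^+ 2 + y ^+ 2).
  rewrite -subr_ge0; have -> : 2 * (x ^+ 2 + y ^+ 2) - (x + y) ^+ 2 = (x - y) ^+ 2.
    by ring.
  exact: sqr_ge0.
have h' : 2 * t * `|x ^+ 2 - y ^+ 2| <= (x - y) ^+ 2 + t ^+ 2 * (x + y) ^+ 2.
  rewrite subr_sqr normrM -(real_normK (num_real (x - y))).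
  rewrite -(real_normK (num_real (x + y))) -subr_ge0.
  set p := `|x - y|; set q := `|x + y|.
  have -> : p ^+ 2 + t ^+ 2 * q ^+ 2 - 2 * t * (p * q) = (p - t * q) ^+ 2 by ring.
  exact: sqr_ge0.
apply: le_trans h' _; rewrite lerD2l.
have : t ^+ 2 * (x + y) ^+ 2 <= t ^+ 2 * (2 * (x ^+ 2 + y ^+ 2)).
  by rewrite ler_wpM2l ?sqr_ge0.
by rewrite expr2; lra.
Qed.

(** The measures are the squares of the vectors. Norms at most 1 and inner product at least [1 - d]
    give [|xi g - xi h|^2 <= 2 d]; [sqr_diff_bound] with parameter [e] then costs [e^-1 d + 2 e],
    and the two defects of mass cost [2 d]. *)
Lemma density_of_vectors (xi : G -> G -> R) (e d : R) :
  0 < e -> 0 <= d -> tkern Gd xi ->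
  (forall g, fsum (fun h => xi g h ^+ 2) <= 1) ->
  exists L P phi, density L P phi /\
    forall g h (th : G -> R), (forall z, `|th z| <= 1) ->
      1 - d <= fsum (fun z => xi g z ^+ 2) ->
      1 - d <= fsum (fun z => xi h z ^+ 2) ->
      1 - d <= fsum (fun z => xi g z * xi h z) ->
      `|average L P phi g th - average L P phi h th| <=
      e^-1 * d + 2 * e + 2 * d.
Proof.
move=> e0 d0 txi M1; have [[D tD xD] _ _] := txi.
have rf := tkern_rowfin lcG etG txi.
have [l hl] := thin_partition lcG etG tD.
pose U := unit_wsec R lcG.
pose M g := fsum (fun h => xi g h ^+ 2).
have sumE g (th : G -> R) : fsum (fun h => xi g h ^+ 2 * th h) =
    \sum_(p <- l) pw p (s g) * (xi g (g ** pk p (s g)) ^+ 2 * th (g ** pk p (s g))).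
  have [|_ ->//] := @fibre_sum _ _ _ _ D l g (fun h => xi g h ^+ 2 * th h) hl.
  by move=> h; rewrite mulf_eq0 negb_or expf_eq0 => /andP[/xD[->]].
have ME g : M g = \sum_(p <- l) pw p (s g) * xi g (g ** pk p (s g)) ^+ 2.
  have := sumE g (fun=> 1); rewrite /M; under eq_fsum do rewrite mulr1.
  by move=> ->; apply: eq_bigr => p _; rewrite mulr1.
have M0 g : 0 <= M g.
  by apply: fsum_ge0; [exact: finsupp_sqr|move=> h; exact: sqr_ge0].
pose psi (p : wsec R Gd) (g : G) := pw p (s g) * xi g (g ** pk p (s g)) ^+ 2.
have xi1 g h : xi g h ^+ 2 <= 1.
  apply: le_trans (M1 g).
  apply: (@ler_fsum1 _ _ (fun h => xi g h ^+ 2)); first exact: finsupp_sqr.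
  by move=> z; exact: sqr_ge0.
have psi0 p g : 0 <= psi p g <= pw p (s g).
  have /andP[p0 p1] := pw01 p (s g).
  by rewrite mulr_ge0 ?sqr_ge0//= ler_piMr.
have psic p : continuous (psi p).
  move=> g; rewrite /continuous_at.
  have cs : s @ g --> s g by exact: (s_cont lcG).
  have cw : (fun g => pw p (s g)) @ g --> pw p (s g).
    by apply: (cvg_comp _ _ cs); exact: pw_cont.
  have [w0|w0] := eqVneq (pw p (s g)) 0.
    rewrite {2}/psi w0 mul0r; apply: (@cvg_dom0 _ _ _ _ _ (fun g => pw p (s g))).
      by rewrite -w0.
    apply: nearW => h; have /andP[a0 a1] := psi0 p h.
    by rewrite !ger0_norm//; exact: le_trans a1.
  have ck : (fun g => pk p (s g)) @ g --> pk p (s g).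
    by apply: (cvg_comp _ _ cs); exact: pk_cont.
  have wn : \forall h \near g, pw p (s h) != 0 by exact: cvgr_neq0 cw w0.
  have ig : (fun h : G => h) @ g --> g by exact: cvg_id.
  have cm : (fun g => g ** pk p (s g)) @ g --> g ** pk p (s g).
    apply: gmul_cvg => //; last by rewrite pk_sec.
    by apply: filterS wn => z /pk_sec ->.
  apply: cvgM => //; rewrite expr2; under eq_fun do rewrite expr2.
  apply: cvgM; (apply: (tkern_cvg txi) => //; last by rewrite gr_mul ?pk_sec);
    by apply: filterS wn => z /pk_sec k; rewrite gr_mul ?k.
have Mc : continuous M.
  have -> : M = fun g => \sum_(p <- l) psi p g by apply: funext.
  by move=> g; apply: cvg_sumr => p; exact: psic.
(* Index 0 is the unit section, whose point at [g] is [g] itself. It receives the missing mass, so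
   the total is exactly 1 without a division by [M g], which may be 0. *)
exists (size l).+1, (nth U (U :: l)),
  (fun j g => if j is i.+1 then psi (nth U l i) g else 1 - M g).
have avE g th : average (size l).+1 (nth U (U :: l)) (fun j g =>
    if j is i.+1 then psi (nth U l i) g else 1 - M g) g th =
    (1 - M g) * th g + fsum (fun h => xi g h ^+ 2 * th h).
  rewrite /average big_ord_recl /= gmul_ur; congr (_ + _).
  rewrite sumE (big_nth U) big_mkord; apply: eq_bigr => j _ /=.
  by rewrite /psi mulrA.
split; first split.
- move=> [|j] //; move=> g; apply: cvgB; [exact: cvg_cst|exact: Mc].
- move=> [|j] g //=; first by rewrite subr_ge0 M1 gerBl M0.
- move=> g; have := avE g (fun=> 1); rewrite /average.
  under eq_bigr do rewrite mulr1; move=> ->.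
  by under eq_fsum do rewrite mulr1; rewrite mulr1 subrK.
move=> g h th th1 Mg Mh Ngh; rewrite !avE.
have fg := finsupp_sqr (rf g); have fh := finsupp_sqr (rf h).
have -> : (1 - M g) * th g + fsum (fun z => xi g z ^+ 2 * th z) -
   ((1 - M h) * th h + fsum (fun z => xi h z ^+ 2 * th z)) =
   fsum (fun z => (xi g z ^+ 2 - xi h z ^+ 2) * th z) +
   ((1 - M g) * th g - (1 - M h) * th h).
  have -> : fsum (fun z => (xi g z ^+ 2 - xi h z ^+ 2) * th z) =
     fsum (fun z => xi g z ^+ 2 * th z) - fsum (fun z => xi h z ^+ 2 * th z).
    rewrite -mulN1r -fsumZ; last exact: finsuppMl.
    rewrite -fsumD; [|exact: finsuppMl|by apply: finsuppMr; exact: finsuppMl].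
    by apply: eq_fsum => z; ring.
  ring.
have bnd k : 1 - d <= M k -> `|(1 - M k) * th k| <= d.
  move=> Mk; have Mk1 : 0 <= 1 - M k by rewrite subr_ge0; exact: M1.
  rewrite normrM ger0_norm//; apply: le_trans (ler_piMr Mk1 (th1 k)) _; lra.
apply: le_trans (ler_normD _ _) _; apply: lerD; last first.
  apply: le_trans (ler_normB _ _) _.
  by have := bnd g Mg; have := bnd h Mh; lra.
have fgh : finsupp (fun z => xi g z * xi h z) by apply: finsuppMl.
have fd : finsupp (fun z => (xi g z - xi h z) ^+ 2).
  apply: finsupp_sqr; apply: finsuppD => //.
  by apply: sub_finsupp (rf h) => z; rewrite oppr_eq0.
have [sq usq [sg sh]] := finsuppU fg fh.
have f1 : finsupp (fun z => (xi g z ^+ 2 - xi h z ^+ 2) * th z).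
  apply: finsuppMl; apply: finsuppD => //.
  by apply: sub_finsupp fh => z; rewrite oppr_eq0.
have f2 : finsupp (fun z => `|(xi g z ^+ 2 - xi h z ^+ 2) * th z|).
  by apply: sub_finsupp f1 => z; rewrite normr_eq0.
have normle : `|fsum (fun z => (xi g z ^+ 2 - xi h z ^+ 2) * th z)| <=
    fsum (fun z => `|(xi g z ^+ 2 - xi h z ^+ 2) * th z|).
  have [t ut [ht _]] := finsuppU f1 f1.
  rewrite (fsumE ut ht) (@fsumE _ _ _ t)//; first exact: ler_norm_sum.
  by move=> i; rewrite normr_eq0; exact: ht.
apply: le_trans normle _.
have f3 : finsupp (fun z => (2 * e)^-1 * (xi g z - xi h z) ^+ 2).
  by apply: finsuppMr.
have f4 : finsupp (fun z => e * (xi g z ^+ 2 + xi h z ^+ 2)).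
  by apply: finsuppMr; exact: finsuppD.
apply: (@le_trans _ _ (fsum (fun z => (2 * e)^-1 * (xi g z - xi h z) ^+ 2 +
    e * (xi g z ^+ 2 + xi h z ^+ 2)))).
  apply: ler_fsum => //; first exact: finsuppD.
  move=> z; rewrite normrM; apply: le_trans (ler_piMr _ (th1 z)) _ => //.
  exact: sqr_diff_bound.
rewrite fsumD// !fsumZ//; last exact: finsuppD.
have -> : fsum (fun z => (xi g z - xi h z) ^+ 2) =
    M g + (M h + - 2 * fsum (fun z => xi g z * xi h z)).
  have f5 : finsupp (fun z => -2 * (xi g z * xi h z)) by apply: finsuppMr.
  rewrite -fsumZ// -fsumD// -fsumD//; last exact: finsuppD.
  by apply: eq_fsum => z; ring.
rewrite fsumD//.
apply: lerD.
  have -> : e^-1 * d = (2 * e)^-1 * (2 * d) by field; rewrite gt_eqF.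
  apply: ler_wpM2l; first by rewrite invr_ge0 mulr_ge0// ltW.
  have m1 : M g <= 1 := M1 g; have m2 : M h <= 1 := M1 h.
  lra.
rewrite mulrC; apply: ler_wpM2r; first exact: ltW.
have m1 : M g <= 1 := M1 g; have m2 : M h <= 1 := M1 h.
by rewrite -/(M g) -/(M h); lra.
Qed.

(** Division by a bound [C] of the row sums brings the kernel under [sqrt_kernel]; the rows of the
    approximate root, scaled back, are the vectors. *)
Lemma density_ex (k : G -> G -> R) (e : R) : 0 < e -> e <= 1 ->
  tkern Gd k -> symk k -> psdk k -> (forall g, k g g <= 1) ->
  exists L P phi, density L P phi /\
    forall g h (th : G -> R), (forall z, `|th z| <= 1) ->
      1 - e ^+ 2 / 48 <= k g g -> 1 - e ^+ 2 / 48 <= k h h ->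
      1 - e ^+ 2 / 48 <= k g h ->
      `|average L P phi g th - average L P phi h th| <= e.
Proof.
move=> e0 e1 tk sk pk k1; have [C C0 kC] := tkern_rowsum tk.
pose a g h := C^-1 * k g h; have rk := tkern_rowfin lcG etG tk.
have ta : tkern Gd a by exact: tkernZ.
have sa : symk a by move=> g h; rewrite /a sk.
have ra := tkern_rowfin lcG etG ta.
have pa : psdk a by apply: psdkZ => //; rewrite invr_ge0 ltW.
have a1 g : fsum (fun h => `|a g h|) <= 1.
  have -> : (fun h => `|a g h|) = fun h => C^-1 * `|k g h|.
    by apply: funext => h; rewrite /a normrM gtr0_norm ?invr_gt0.
  rewrite fsumZ; last by apply: sub_finsupp (rk g) => h; rewrite normr_eq0.
  by rewrite ler_pdivrMl// mulr1.
(* With [e / 4] and [3 d] in [density_of_vectors] the error terms are [e / 4], [e / 2] and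
   [e^2 / 8 <= e / 8], in total less than [e]. *)
set d := e ^+ 2 / 48.
have d0 : 0 < d by rewrite divr_gt0// exprn_gt0.
have [n hn] := sqrt_kernel sa ra pa a1 (divr_gt0 d0 C0).
set S := sqrtk a n in hn.
have tS : tkern Gd S by exact: tkern_sqrtk.
have sS : symk S.
  move=> g h; rewrite /S /sqrtk symk_idk; congr (_ - _); apply: symk_sqk.
  by move=> i j; rewrite symk_idk sa.
(* The factor [1 + d] absorbs the error of the root: squared norms are at most
   [(k g g + d) / (1 + d) <= 1], and [k x y >= 1 - d] still gives an inner product of at least
   [(1 - 2 d) / (1 + d) >= 1 - 3 d]. *)
pose c := Num.sqrt (C / (1 + d)).
have c2 : c ^+ 2 = C / (1 + d).
  by rewrite sqr_sqrtr// divr_ge0 ?ltW// addr_gt0.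
pose xi g h := c * S g h.
have txi : tkern Gd xi by exact: tkernZ.
have rS := tkern_rowfin lcG etG tS.
have xiE g h : fsum (fun z => xi g z * xi h z) = C / (1 + d) * km S S g h.
  rewrite -c2 /km -fsumZ; last exact: finsuppMl.
  by apply: eq_fsum => z; rewrite /xi (sS z h); ring.
have xib g h : (k g h - d) / (1 + d) <= fsum (fun z => xi g z * xi h z) <=
    (k g h + d) / (1 + d).
  have := hn g h; rewrite ler_distl /a => /andP[h1 h2].
  have {}h1 : k g h - d <= C * km S S g h.
    by rewrite -ler_pdivrMl// mulrBr (mulrC _ d).
  have {}h2 : C * km S S g h <= k g h + d.
    by rewrite -ler_pdivlMl// mulrDr (mulrC _ d).
  by rewrite xiE mulrAC !ler_wpM2r// invr_ge0 ltW// addr_gt0.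
have xi2 g : fsum (fun z => xi g z ^+ 2) = fsum (fun z => xi g z * xi g z).
  by apply: eq_fsum => z; rewrite expr2.
have d1 : 0 < 1 + d by rewrite addr_gt0.
have [|||L [P [phi [dphi H]]]] := @density_of_vectors xi (e / 4) (3 * d) _ _ txi _.
- by rewrite divr_gt0.
- by rewrite mulr_ge0 ?ltW.
- move=> g; rewrite xi2; have /andP[_ h] := xib g g; apply: le_trans h _.
  by rewrite ler_pdivrMr// mul1r lerD2r.
exists L, P, phi; split => // g h th th1 kg kh kgh.
have low x y : 1 - d <= k x y -> 1 - 3 * d <= fsum (fun z => xi x z * xi y z).
  move=> kxy; have /andP[hl _] := xib x y; apply: le_trans hl.
  rewrite ler_pdivlMr//; have : 0 <= d * d by rewrite mulr_ge0 ?ltW.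
  by lra.
have {}H := H g h th th1.
apply: le_trans (H _ _ _) _; rewrite ?xi2; try exact: low.
have e2 : e ^+ 2 <= e by rewrite expr2 ger_pMr.
have -> : (e / 4)^-1 * (3 * d) = e / 4 by rewrite /d; field; rewrite gt_eqF.
by rewrite /d; lra.
Qed.

End Densities.

(** * From complex positive definite kernels to real ones *)

Section ComplexKernels.
Variable R : realType.

Lemma Re_le_norm (z : R[i]) (e : R) : `|z| <= e%:C%C -> `|complex.Re z| <= e.
Proof. by move=> h; rewrite -lecR; apply: le_trans h; exact: normc_ge_Re. Qed.

Lemma cvg_Re (I : Type) (F : set_system I) {FF : Filter F} (f : I -> R[i]) (a : R[i]) :
  (f : I -> R[i]^o) @ F --> (a : R[i]^o) ->
  (fun i => complex.Re (f i)) @ F --> complex.Re a.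
Proof.
move=> /cvgrPdist_lt fa; apply/cvgrPdist_lt => e e0.
have e0' : 0 < e%:C%C :> R[i] by rewrite ltcR.
apply: filterS (fa _ e0') => i; rewrite -ltcR; apply: le_lt_trans.
by rewrite -raddfB; exact: normc_ge_Re.
Qed.

Lemma normc_real (x : R) : `|x%:C%C| = `|x|%:C%C :> R[i].
Proof. by rewrite normc_def /= expr0n addr0 sqrtr_sqr. Qed.

Lemma cvg_realc (I : Type) (F : set_system I) {FF : Filter F} (f : I -> R) (a : R) :
  f @ F --> a -> (fun i => (f i)%:C%C : R[i]^o) @ F --> (a%:C%C : R[i]^o).
Proof.
move=> /cvgrPdist_lt fa; apply/cvgrPdist_lt => e e0.
have [eE] : e = (complex.Re e)%:C%C.
  by case: e e0 => x y; rewrite ltcE /= => /andP[/eqP -> _].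
have e0' : 0 < complex.Re e by rewrite -ltcR -eE.
apply: filterS (fa _ e0') => i; rewrite -ltcR -eE -normc_real.
by rewrite rmorphB.
Qed.

Lemma conj_real (x : R) : ((x%:C%C : R[i])^* = x%:C%C)%R.
Proof. exact: conjc_real. Qed.

Lemma conj_i : ((Complex 0 1 : R[i])^* = Complex 0 (-1))%R.
Proof. by []. Qed.

(** In [R[i]] nonnegativity includes a vanishing imaginary part. At the vector [(1, i)], knowing
    that the diagonal is real, this equates the real parts of the two off-diagonal entries. *)
Lemma psd_sym (M : 'M[R[i]]_2) : psd M ->
  complex.Re (M ord0 ord_max) = complex.Re (M ord_max ord0).
Proof.
move=> hM.
have := hM (fun i => if i == ord0 then 1 else Complex 0 1).
have := hM (fun i => 1).
have := hM (fun i => if i == ord0 then 1 else 0).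
have := hM (fun i => if i == ord0 then 0 else 1).
have E0 : ord_max == ord0 :> 'I_2 = false by [].
have E1 : lift ord0 ord0 = ord_max :> 'I_2 by apply: val_inj.
rewrite !big_ord_recl !big_ord0 !E1 !E0 !eqxx conj_i !rmorph1 !rmorph0.
case: (M ord0 ord0) => a a'; case: (M ord0 ord_max) => b b'.
case: (M ord_max ord0) => c c'; case: (M ord_max ord_max) => d d'.
rewrite !lecE /=.
move=> /andP[/eqP h1 _] /andP[/eqP h2 _] /andP[/eqP h3 _] /andP[/eqP h4 _].
move: h1 h2 h3 h4; rewrite !(mul0r, mulr0, mul1r, mulr1, addr0, add0r, subr0, mulN1r, oppr0, opprK).
lra.
Qed.

Lemma Re_sum (I : Type) (l : seq I) (P : pred I) (F : I -> R[i]) :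
  complex.Re (\sum_(i <- l | P i) F i) = \sum_(i <- l | P i) complex.Re (F i).
Proof. exact: (raddf_sum (@complex.Re R : Rcomplex R -> R)). Qed.

Variables (X G : topologicalType) (Gd : groupoid X G).
Hypotheses (lcG : lc_groupoid Gd) (etG : etale Gd).
Local Notation r := (gr Gd).
Local Notation s := (gs Gd).
Local Notation u := (gu Gd).
Local Notation inv := (ginv Gd).
Local Notation "g ** h" := (gmul Gd g h) (at level 40, left associativity).

(** The 0 replaces the arbitrary values of [k] off [rprod], so that sums may range over all of
    [G]. *)
Definition re_kernel (k : G * G -> R[i]) (g h : G) : R :=
  if r g == r h then complex.Re (k (g, h)) else 0.

Lemma symk_re_kernel k : positive_definite Gd k -> symk (re_kernel k).
Proof.
move=> pk g h; rewrite /re_kernel eq_sym; case: eqP => // e.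
pose f (i : 'I_2) := if i == ord0 then g else h.
have := psd_sym (pk (r g) 2 f _); rewrite !mxE /=; apply.
by move=> i; rewrite /f; case: ifP.
Qed.

(** Extended by 0 the matrix is block diagonal over the units, so the form splits according to
    ranges; on a block it is the real part of the complex form at a real vector. *)
Lemma psdk_re_kernel k : positive_definite Gd k -> psdk (re_kernel k).
Proof.
move=> pk v [t vt]; set sq := undup t; have usq : uniq sq := undup_uniq t.
have vs i : v i != 0 -> i \in sq by move=> /vt; rewrite mem_undup.
have -> : fsum (fun i => v i * ap (re_kernel k) v i) =
    \sum_(i <- sq) \sum_(j <- sq) v i * v j * re_kernel k i j.
  rewrite (@fsumE _ _ _ sq)//; last first.
    by move=> i; rewrite mulf_eq0 negb_or => /andP[/vs].
  apply: eq_bigr => i _; rewrite /ap (@fsumE _ _ _ sq)//; last first.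
    by move=> j; rewrite mulf_eq0 negb_or => /andP[_ /vs].
  by rewrite mulr_sumr; apply: eq_bigr => j _; ring.
pose F i := \sum_(j <- sq) v i * v j * re_kernel k i j.
rewrite -/(F _).
have -> : \sum_(i <- sq) F i =
    \sum_(x <- undup (map r sq)) \sum_(i <- sq | r i == x) F i.
  under [RHS]eq_bigr do rewrite big_mkcond /=.
  rewrite [RHS]exchange_big /= big_seq [RHS]big_seq; apply: eq_bigr => i si.
  rewrite -big_mkcond /=.
  under eq_bigl do rewrite eq_sym.
  rewrite -big_filter filter_pred1_uniq ?undup_uniq// ?big_seq1//.
  by rewrite mem_undup map_f.
apply: sumr_ge0 => x _.
rewrite -big_filter; set sx := [seq i <- sq | r i == x].
have FE i : i \in sx -> F i = \sum_(j <- sx) v i * v j * complex.Re (k (i, j)).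
  rewrite mem_filter => /andP[/eqP rix _]; rewrite /F /sx big_filter [RHS]big_mkcond /=.
  apply: eq_bigr => j _; rewrite /re_kernel rix eq_sym.
  by case: ifP => // _; rewrite mulr0.
rewrite big_seq (eq_bigr _ FE) -big_seq.
pose g := tnth (in_tuple sx).
have rg i : r (g i) = x.
  by have := mem_tnth i (in_tuple sx); rewrite mem_filter => /andP[/eqP].
have := pk x (size sx) g rg (fun i => (v (g i))%:C%C).
rewrite lecE /= => /andP[_]; rewrite Re_sum (big_tnth _ _ sx).
congr (0 <= _); apply: eq_bigr => i _; rewrite Re_sum (big_tnth _ _ sx).
apply: eq_bigr => j _; rewrite mxE conj_real -/(g i) -/(g j).
case: (k (g i, g j)) => a b /=.
by rewrite !(mul0r, mulr0, addr0, subr0); ring.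
Qed.

Lemma tkern_re_kernel k : bounded_kernel Gd k -> continuous_kernel Gd k ->
  supported_in_tube Gd k -> tkern Gd (re_kernel k).
Proof.
move=> [M kM] kc [T [[Tr Tp] kT]]; split.
- exists (closure [set inv gh.1 ** gh.2 | gh in T]).
    by apply: (thin_compact R lcG etG); rewrite -precompactE.
  move=> g h; rewrite /re_kernel; have [gh kgh|_] := eqVneq (r g) (r h); last by rewrite eqxx.
  split => //; apply: subset_closure; exists (g, h) => //; apply: kT => //.
  by apply: contraNneq kgh => ->.
- exists `|M| => g h; rewrite /re_kernel; case: eqP => [gh|_].
    apply: le_trans (ler_norm M); exact/Re_le_norm/kM.
  by rewrite normr0.
- move=> g h gh; set F := within _ _.
  have kgh : (k : G * G -> R[i]^o) @ F --> (k (g, h) : R[i]^o).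
    by have /subspace_continuousP := kc; apply.
  have rF : \forall z \near F, r z.1 = r z.2.
    by rewrite /F near_withinE; apply: nearW.
  apply: cvg_trans (_ : (fun z => complex.Re (k z)) @ F --> _).
    apply: near_eq_cvg; apply: filterS rF => z rz.
    by rewrite /re_kernel rz eqxx -surjective_pairing.
  by rewrite /re_kernel gh eqxx; exact: cvg_Re.
Qed.

Lemma re_kernel_diag k g : bounded_by1_on_diagonal k -> re_kernel k g g <= 1.
Proof.
move=> k1; rewrite /re_kernel eqxx; apply: le_trans (ler_norm _) _.
by apply: Re_le_norm; exact: k1.
Qed.

Lemma re_kernel_close k g h (e : R) : r g = r h -> `|k (g, h) - 1| <= e%:C%C ->
  1 - e <= re_kernel k g h.
Proof.
move=> gh /Re_le_norm; rewrite /re_kernel gh eqxx.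
case: (k (g, h)) => a b /=; rewrite ler_distl => /andP[]; lra.
Qed.

Lemma density_of_net (I : Type) (le : I -> I -> Prop) (k : I -> G * G -> R[i])
    (O : set G) (e : R) :
  directed le ->
  (forall i, [/\ bounded_kernel Gd (k i), positive_definite Gd (k i),
                  continuous_kernel Gd (k i) & supported_in_tube Gd (k i)]) ->
  (forall i, bounded_by1_on_diagonal (k i)) ->
  tends_to1_on_tubes Gd le k -> precompact O -> 0 < e -> e <= 1 ->
  exists (L : nat) (P : nat -> wsec R Gd) (phi : nat -> G -> R), density L P phi /\
    forall g h (th : G -> R), (forall z, `|th z| <= 1) -> r g = r h ->
      O (inv g ** h) -> `|average L P phi g th - average L P phi h th| <= e.
Proof.
move=> dir hk k1 klim; rewrite precompactE => cO e0 e1.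
(* Besides [(g, h)] the tube has to contain [(g, g)] and [(h, h)], as norms are needed too; their
   quotients are the units at the range and at the source of [g^-1 h]. *)
pose C := closure O `|` (u \o r) @` closure O `|` (u \o s) @` closure O.
have cC : compact C.
  apply: compactU; first apply: compactU => //; apply: continuous_compact => //;
    apply: continuous_subspaceT => g.
    by apply: continuous_comp; [exact: (r_cont lcG)|exact: (u_cont lcG)].
  by apply: continuous_comp; [exact: (s_cont lcG)|exact: (u_cont lcG)].
pose T := [set gh : G * G | r gh.1 = r gh.2 /\ C (inv gh.1 ** gh.2)].
have tT : tube Gd T.
  split; first by move=> gh [].
  apply: (@precompact_subset _ _ C); first by move=> _ [gh [_ h] <-].
  by apply: compact_precompact => //; exact: (G_haus lcG).
have d0 : 0 < e ^+ 2 / 48 by rewrite divr_gt0// exprn_gt0.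
have [i0 hi0] := klim T tT _ d0.
have {hi0} hi0 := hi0 i0 (directed_refl dir i0).
have [kb kp kc ks] := hk i0.
have [|L [P [phi [dphi H]]]] := density_ex lcG etG e0 e1 (tkern_re_kernel kb kc ks)
  (symk_re_kernel kp) (psdk_re_kernel kp) _.
  by move=> g; apply: re_kernel_diag.
exists L, P, phi; split => // g h th th1 gh Ogh.
have Oc := subset_closure Ogh.
apply: H => //; apply: re_kernel_close => //; apply: hi0; split => //=.
- left; right; exists (inv g ** h) => //=.
  by rewrite gmul_Vl rinv_mul.
- by right; exists (inv g ** h) => //=; rewrite gmul_Vl gs_mul// gs_inv.
- by left; left.
Qed.

End ComplexKernels.

(** * The universal space of densities *)

Section GeneralTopology.

Lemma second_countable_seq (T : topologicalType) : @second_countable T ->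
  exists U : nat -> set T, (forall n, open (U n)) /\
    forall x A, nbhs x A -> exists2 n, U n x & U n `<=` A.
Proof.
move=> [B /countable_injP[f fi] [Bo Bn]].
(* The union has at most one member; it is empty for an index that the enumeration does not
   attain. *)
exists (fun n => \bigcup_(b in [set b | B b /\ f b = n]) b); split.
  by move=> n; apply: bigcup_open => b [/Bo].
move=> x A /Bn[b [Bb bx] bA]; exists (f b); first by exists b.
move=> y [b' [Bb' fb] b'y]; apply: bA.
by rewrite (_ : id b = b') //; apply: fi; rewrite ?inE.
Qed.

(** The second hypothesis says that the sets form a subbase, phrased with filters so that
    [dspace_cvg] can discharge it. *)
Lemma subbase_second_countable (T : topologicalType) (I : countType)
    (U : I -> set T) :
  (forall i, open (U i)) ->
  (forall x (F : set_system T), Filter F -> (forall i, U i x -> F (U i)) ->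
     F --> x) ->
  @second_countable T.
Proof.
move=> oU hU; pose V (l : seq I) := [set x | forall i, i \in l -> U i x].
have VE i l : V (i :: l) = U i `&` V l.
  rewrite eqEsubset; split=> x.
    move=> h; split; first by apply: h; rewrite inE eqxx.
    by move=> j jl; apply: h; rewrite inE jl orbT.
  by move=> [Ux h] j; rewrite inE => /orP[/eqP ->//|]; exact: h.
exists (range V); first by apply: (card_le_trans (card_image_le V setT)); exact: countableP.
split.
  move=> _ [l _ <-]; elim: l => [|i l IH]; last by rewrite VE; exact: openI.
  by rewrite (_ : V [::] = setT)//; [exact: openT|rewrite -subTset => x _ j].
move=> x; pose F := filter_from [set l | V l x] V.
have FF : Filter F.
  apply: filter_from_filter; first by exists [::].
  move=> l l' lx l'x; exists (l ++ l').
    by move=> i; rewrite mem_cat => /orP[/lx|/l'x].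
  by move=> y h; split=> i il; apply: h; rewrite mem_cat il ?orbT.
have Fx : F --> x.
  apply: hU => i Ui; exists [:: i]; first by move=> j; rewrite inE => /eqP ->.
  by move=> y; apply; rewrite inE eqxx.
move=> A /Fx[l lx lA]; exists (V l) => //; split => //; by exists l.
Qed.

Lemma cluster_ultra_cvg (I : Type) (T : topologicalType) (F : set_system I)
    (f : I -> T) (x : T) : UltraFilter F -> cluster (f @ F) x -> f @ F --> x.
Proof.
move=> UF cl A /= Ax; have [//|FA] := in_ultra_setVsetC (f @^-1` A) UF.
have /(_ (~` A)) [] := cl _ _ _ Ax; first exact: FA.
by move=> y [].
Qed.

Lemma hausdorff_image (S T : topologicalType) (f : S -> T) (p q : S) :
  hausdorff_space T -> continuous f -> cluster (nbhs p) q -> f p = f q.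
Proof.
move=> hT cf cl; apply: hT => A B Ap Bq.
have [x [Ax Bx]] := cl _ _ (cf _ _ Ap) (cf _ _ Bq).
by exists (f x).
Qed.

End GeneralTopology.

(** * Continuous test functions and a countable cover by sections *)

Section Interpolation.
Variable R : realType.
Variables (X G : topologicalType) (Gd : groupoid X G).
Hypotheses (lcG : lc_groupoid Gd) (etG : etale Gd).
Local Notation r := (gr Gd).
Local Notation s := (gs Gd).
Local Notation u := (gu Gd).
Local Notation inv := (ginv Gd).
Local Notation "g ** h" := (gmul Gd g h) (at level 40, left associativity).

Lemma wsec_at (g : G) : exists p : wsec R Gd, chi p g = 1.
Proof.
have [p [hp _]] := wsec_ex R lcG etG (filterT : nbhs g setT).
by exists p; exact: nbhs_singleton hp.
Qed.

(** A bump along a section through [h] is 0 at all other arrows of the same fibre, so a combination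
    of such bumps takes prescribed values at finitely many arrows of one fibre; truncation restores
    the bound. *)
Lemma interpolation (x : X) (pts : seq G) (th : G -> R) :
  (forall g, `|th g| <= 1) ->
  exists th' : G -> R, [/\ continuous th', forall g, `|th' g| <= 1 &
    forall g, g \in pts -> r g = x -> th' g = th g].
Proof.
move=> th1; have [p hp] := choice wsec_at.
pose S g := \sum_(h <- [seq h <- undup pts | r h == x]) th h * chi (p h) g.
have Sc : continuous S.
  move=> g; apply: cvg_sumr => h; apply: cvgM; first exact: cvg_cst.
  exact: (chi_cont lcG etG).
have SE g : g \in pts -> r g = x -> S g = th g.
  move=> gp rg; rewrite /S (bigD1_seq g)/=; last 2 first.
  - by rewrite mem_filter mem_undup gp rg eqxx.
  - by rewrite filter_uniq// undup_uniq.
  rewrite hp mulr1 big_seq_cond big1 ?addr0// => h /andP[].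
  rewrite mem_filter => /andP[/eqP rh _] hg; apply/eqP; rewrite mulf_eq0.
  apply/orP; right; apply: contraNT hg => /chi_neq0[kg _].
  have [|kh _] := @chi_neq0 _ _ _ _ (p h) h; first by rewrite hp oner_neq0.
  by rewrite -kg -[eqbLHS]kh rg rh.
exists (fun g => Num.max (-1) (Num.min 1 (S g))); split.
- move=> g; apply: (@continuous_max _ _ (fun=> -1 : R) (fun g => Num.min 1 (S g))).
    exact: cvg_cst.
  apply: (@continuous_min _ _ (fun=> 1 : R) S); first exact: cvg_cst.
  exact: Sc.
- move=> g; rewrite ler_norml ge_max le_max lexx/= ge_min lexx/= andbT.
  by rewrite (@le_trans _ _ 0)// lerN10.
- move=> g gp rg; rewrite SE//; have := th1 g; rewrite ler_norml => /andP[h1 h2].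
  by rewrite (min_idPr h2) (max_idPr h1).
Qed.

(** For each set of a countable basis, a section with precompact support that does not vanish on it
    is chosen if there is one, and the zero section otherwise. Around every arrow some basic set
    admits one. *)
Lemma countable_wsecs : exists Q : nat -> wsec R Gd,
  (forall g, exists n, chi (Q n) g != 0) /\
  forall n, precompact [set g | chi (Q n) g != 0].
Proof.
have [_ _ /second_countable_seq[U [oU hU]]] := G_lc lcG.
pose good (p : wsec R Gd) := precompact [set g | chi p g != 0].
have zero01 (x : X) : 0 <= (0 : R) <= 1 by rewrite lexx ler01.
have zero_sec (x : X) : (0 : R) != 0 -> r (u x) = x by rewrite eqxx.
have zero_cont (x : X) : (0 : R) != 0 -> {for x, continuous u} by rewrite eqxx.
have zero_c : continuous (fun _ : X => 0 : R) by move=> x; exact: cvg_cst.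
pose Z : wsec R Gd := Wsec zero_c zero01 zero_sec zero_cont.
have Zgood : good Z.
  rewrite /good (_ : [set g | chi Z g != 0] = set0).
    by apply: compact_precompact; [exact: (G_haus lcG)|exact: compact0].
  rewrite -subset0 => g /=; rewrite /chi /=; case: ifP => _; rewrite eqxx//.
have /choice[Q hQ] : forall n, exists p, good p /\
    ((exists q, good q /\ U n `<=` [set g | chi q g != 0]) ->
     U n `<=` [set g | chi p g != 0]).
  move=> n; have [[q [gq Uq]]|nq] := pselect (exists q, good q /\
      U n `<=` [set g | chi q g != 0]); first by exists q.
  by exists Z.
exists Q; split; last by move=> n; case: (hQ n).
move=> g; have [V [gV cV clV]] := lc_nbhs (G_lc lcG) g.
have [p [p1 pV]] := wsec_ex R lcG etG gV.
have pn : nbhs g [set h | chi p h != 0].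
  by apply: filterS p1 => h /= ->; exact: oner_neq0.
have [n Ung UnA] := hU _ _ pn; exists n.
have [_ /(_ _ g Ung)] := hQ n; apply; exists p; split => //.
apply: (@precompact_subset _ _ V); last by apply: compact_precompact => //; exact: (G_haus lcG).
by move=> h /= /chi_neq0[kh /pV]; rewrite kh.
Qed.

End Interpolation.

(** * The space of densities on single fibres and its topology *)

Section UniversalSpace.
Variable R : realType.
Variables (X G : topologicalType) (Gd : groupoid X G).
Hypotheses (lcG : lc_groupoid Gd) (etG : etale Gd).
Local Notation r := (gr Gd).
Local Notation s := (gs Gd).
Local Notation u := (gu Gd).
Local Notation inv := (ginv Gd).
Local Notation "g ** h" := (gmul Gd g h) (at level 40, left associativity).

Variables (Q : nat -> wsec R Gd) (L : nat -> nat) (P : nat -> nat -> wsec R Gd).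
Variables (O : nat -> set G) (e : nat -> R).
Hypothesis Qcov : forall g, exists l, chi (Q l) g != 0.
Hypothesis oO : forall n, open (O n).

(** [fd_out] makes a point depend only on its values on the fibre; [fd_bnd] keeps these in [[0, 1]],
    which yields compactness; the arbitrary test functions of [fd_inv] are what a total variation
    estimate needs. *)
Record fibre_density (x : X) (phi : nat -> nat -> G -> R) : Prop := FibreDensity {
  fd_out : forall n j g, r g != x -> phi n j g = 0;
  fd_bnd : forall n j g, r g = x -> 0 <= phi n j g <= pw (P n j) (s g);
  fd_sum : forall n g, r g = x -> \sum_(j < L n) phi n j g = 1;
  fd_inv : forall n g h (th : G -> R), r g = x -> r h = x ->
    O n (inv g ** h) -> (forall z, `|th z| <= 1) ->
    `|average (L n) (P n) (phi n) g th - average (L n) (P n) (phi n) h th| <= e n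
}.

(* The topology below depends on [Q], hence its vacuous occurrence. *)
Definition dspace : Type := let _ := Q in
  {y : X * (nat -> nat -> G -> R) | `[< fibre_density y.1 y.2 >]}.

HB.instance Definition _ := Choice.on dspace.

Definition dbase (y : dspace) : X := (val y).1.
Definition dval (y : dspace) : nat -> nat -> G -> R := (val y).2.

(** The weight makes the coordinate continuous even where the section is not. Since [Q] covers [G],
    the base point and the coordinates determine the point. *)
Definition dcoord (i : nat * nat * nat) (y : dspace) : R :=
  let x := dbase y in
  let: (l, n, j) := i in pw (Q l) x * dval y n j (pk (Q l) x).

Definition dmap (y : dspace) : X * {ptws (nat * nat * nat) -> R} :=
  (dbase y, fun i => dcoord i y).

HB.instance Definition _ := Topological.copy dspace (initial_topology dmap).

Lemma dspaceP (y : dspace) : fibre_density (dbase y) (dval y).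
Proof. by apply/asboolP; exact: (valP y). Qed.

Lemma dval01 y n j g : 0 <= dval y n j g <= 1.
Proof.
have [E|ne] := eqVneq (r g) (dbase y).
  have /andP[h0 h1] := fd_bnd (dspaceP y) n j E.
  by rewrite h0 (le_trans h1)//; case/andP: (pw01 (P n j) (s g)).
by rewrite (fd_out (dspaceP y))// lexx ler01.
Qed.

Lemma dspace_eq (y y' : dspace) : dbase y = dbase y' ->
  (forall n j g, r g = dbase y -> dval y n j g = dval y' n j g) -> y = y'.
Proof.
move=> E h; apply: val_inj; rewrite [LHS]surjective_pairing [RHS]surjective_pairing.
congr (_, _); first exact: E.
apply: funext => n; apply: funext => j; apply: funext => g.
have [Eg|ne] := eqVneq (r g) (dbase y); first exact: h.
by rewrite -/(dval y) -/(dval y') (fd_out (dspaceP y))// (fd_out (dspaceP y'))// -E.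
Qed.

Lemma dmap_continuous : continuous dmap.
Proof. exact: (@initial_continuous dspace _ dmap). Qed.

Lemma dbase_continuous : continuous dbase.
Proof.
move=> y; apply: (@continuous_comp _ _ _ dmap fst); first exact: dmap_continuous.
exact: cvg_fst.
Qed.

Lemma dcoord_continuous i : continuous (dcoord i).
Proof.
move=> y; apply: (@continuous_comp _ _ _ (snd \o dmap) (fun f => f i)).
  apply: continuous_comp; first exact: dmap_continuous.
  exact: cvg_snd.
exact: (@proj_continuous _ (fun=> R) i).
Qed.

Lemma dspace_cvg (I : Type) (F : set_system I) {FF : Filter F} (f : I -> dspace)
    (y : dspace) : (dbase \o f) @ F --> dbase y ->
  (forall i, (dcoord i \o f) @ F --> dcoord i y) -> f @ F --> y.
Proof.
move=> fb fc; have fm : (dmap \o f) @ F --> dmap y.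
  have fp : (fun k => (fun i => dcoord i (f k)) : {ptws (nat * nat * nat) -> R}) @ F
      --> ((fun i => dcoord i y) : {ptws (nat * nat * nat) -> R}).
    apply/cvg_sup => i A [_ [[W oW <-] Wy WA]].
    have nW : nbhs (dcoord i y) W by exact: open_nbhs_nbhs.
    have fW : \forall k \near F, W (dcoord i (f k)) := fc i _ nW.
    by apply: filterS fW => k Wk; exact: WA.
  exact: (cvg_pair fb fp).
move=> A [_ [[W oW <-] Wy WA]].
have nW : nbhs (dmap y) W by exact: open_nbhs_nbhs.
have fW : \forall k \near F, W (dmap (f k)) := fm _ nW.
by apply: filterS fW => k Wk; exact: WA.
Qed.

Lemma Qat g : exists l, pw (Q l) (r g) != 0 /\ pk (Q l) (r g) = g.
Proof. by have [l /chi_neq0[h k]] := Qcov g; exists l. Qed.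

(** Some [Q l] passes through [g] with nonzero weight; near the limit it passes through [h i] as
    well, and the value there is a coordinate divided by its weight. *)
Lemma eval_cvg (I : Type) (F : set_system I) {FF : Filter F} (f : I -> dspace)
    (y : dspace) (h : I -> G) (g : G) n j :
  f @ F --> y -> h @ F --> g -> (\forall i \near F, r (h i) = dbase (f i)) ->
  r g = dbase y -> (fun i => dval (f i) n j (h i)) @ F --> dval y n j g.
Proof.
move=> fy hg hf gy; have [l [w0 kg]] := Qat g.
have fb : (fun i => dbase (f i)) @ F --> dbase y.
  by apply: (cvg_comp _ _ fy); exact: dbase_continuous.
have fc : (fun i => dcoord (l, n, j) (f i)) @ F --> dcoord (l, n, j) y.
  by apply: (cvg_comp _ _ fy); exact: dcoord_continuous.
rewrite gy in w0 kg.
have fw : (fun i => pw (Q l) (dbase (f i))) @ F --> pw (Q l) (dbase y).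
  by apply: (cvg_comp _ _ fb); exact: pw_cont.
have wn : \forall i \near F, pw (Q l) (dbase (f i)) != 0 by exact: cvgr_neq0 fw w0.
have fk : (fun i => pk (Q l) (dbase (f i))) @ F --> g.
  by rewrite -kg; apply: (cvg_comp _ _ fb); exact: pk_cont.
have kh : \forall i \near F, pk (Q l) (dbase (f i)) = h i.
  apply: (arrow_eq_near etG fk hg).
  by apply: filterS2 hf wn => i -> /pk_sec.
have -> : dval y n j g = dcoord (l, n, j) y / pw (Q l) (dbase y).
  by rewrite /dcoord kg mulrAC divff// mul1r.
apply: cvg_trans (_ : (fun i => dcoord (l, n, j) (f i) / pw (Q l) (dbase (f i))) @ F --> _).
  apply: near_eq_cvg; apply: filterS2 kh wn => i ki wi.
  by rewrite /dcoord ki mulrAC divff// mul1r.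
by apply: cvgM => //; apply: cvgV.
Qed.

Lemma dspace_hausdorff : hausdorff_space dspace.
Proof.
move=> p q cl; have [hX _ _] := X_lc lcG.
have bE : dbase p = dbase q.
  exact: (hausdorff_image hX dbase_continuous cl).
apply: dspace_eq => // n j g gp; have [l [w0 kg]] := Qat g.
rewrite gp in w0 kg.
have : dcoord (l, n, j) p = dcoord (l, n, j) q.
  apply: (hausdorff_image _ (@dcoord_continuous (l, n, j)) cl).
  exact: Rhausdorff.
by rewrite /dcoord -bE kg => /(mulfI w0).
Qed.

Lemma dspace_second_countable : @second_countable dspace.
Proof.
have [_ _ /second_countable_seq[U [oU hU]]] := X_lc lcG.
pose V (i : nat + (nat * nat * nat) * rat * bool) : set dspace :=
  match i with
  | inl n => dbase @^-1` U n
  | inr (c, q, true) => dcoord c @^-1` [set t | t < ratr q]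
  | inr (c, q, false) => dcoord c @^-1` [set t | ratr q < t]
  end.
apply: (@subbase_second_countable dspace _ V).
  move=> [n|[[c q] [|]]] /=.
  - apply: open_comp; last exact: oU.
    by move=> y _; exact: dbase_continuous.
  - apply: open_comp; last exact: open_lt.
    by move=> y _; exact: dcoord_continuous.
  - apply: open_comp; last exact: open_gt.
    by move=> y _; exact: dcoord_continuous.
move=> y F FF FV; apply: (@dspace_cvg _ _ _ id).
  move=> A /hU[n Un UA]; apply: filterS (FV (inl n) Un) => z; exact: UA.
move=> c; apply/cvgrPdist_lt => d d0.
have [q1 /andP[h1 h2]] : exists q, dcoord c y - d < ratr q < dcoord c y.
  have [|q] := @rat_in_itvoo R (dcoord c y - d) (dcoord c y); first by lra.
  by rewrite in_itv /= => ?; exists q.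
have [q2 /andP[h3 h4]] : exists q, dcoord c y < ratr q < dcoord c y + d.
  have [|q] := @rat_in_itvoo R (dcoord c y) (dcoord c y + d); first by lra.
  by rewrite in_itv /= => ?; exists q.
apply: filterS2 (FV (inr (c, q1, false)) h2) (FV (inr (c, q2, true)) h3) => z /= k1 k2.
by rewrite distrC ltr_distl; apply/andP; split;
  [exact: lt_trans k1|exact: lt_trans h4].
Qed.

End UniversalSpace.

(** * Properness over the unit space *)

Section UniversalSpaceProper.
Variable R : realType.
Variables (X G : topologicalType) (Gd : groupoid X G).
Hypotheses (lcG : lc_groupoid Gd) (etG : etale Gd).
Local Notation r := (gr Gd).
Local Notation s := (gs Gd).
Local Notation u := (gu Gd).
Local Notation inv := (ginv Gd).
Local Notation "g ** h" := (gmul Gd g h) (at level 40, left associativity).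

Variables (Q : nat -> wsec R Gd) (L : nat -> nat) (P : nat -> nat -> wsec R Gd).
Variables (O : nat -> set G) (e : nat -> R).
Hypothesis Qcov : forall g, exists l, chi (Q l) g != 0.
Hypothesis oO : forall n, open (O n).
Local Notation Y := (dspace Q L P O e).

Lemma sec_gmul_cvg (I : Type) (F : set_system I) {FF : Filter F} (h : I -> G) (g : G)
    (p : wsec R Gd) : h @ F --> g -> pw p (s g) != 0 ->
  (fun i => h i ** pk p (s (h i))) @ F --> g ** pk p (s g).
Proof.
move=> hg w0.
have cs : (fun i => s (h i)) @ F --> s g by apply: (cvg_comp _ _ hg); exact: (s_cont lcG).
have cw : (fun i => pw p (s (h i))) @ F --> pw p (s g).
  by apply: (cvg_comp _ _ cs); exact: pw_cont.
have ck : (fun i => pk p (s (h i))) @ F --> pk p (s g).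
  by apply: (cvg_comp _ _ cs); exact: pk_cont.
have wn : \forall i \near F, pw p (s (h i)) != 0 by exact: cvgr_neq0 cw w0.
apply: gmul_cvg => //; last by rewrite pk_sec.
by apply: filterS wn => z /pk_sec ->.
Qed.

Lemma average_cvg (I : Type) (F : set_system I) {FF : Filter F}
    (m : nat) (p : nat -> wsec R Gd) (f : I -> nat -> G -> R) (f0 : nat -> G -> R)
    (h : I -> G) (g : G) (th : G -> R) :
  continuous th -> (forall g, `|th g| <= 1) ->
  h @ F --> g -> (forall j, (fun i => f i j (h i)) @ F --> f0 j g) ->
  (\forall i \near F, forall j, 0 <= f i j (h i) <= pw (p j) (s (h i))) ->
  (forall j, 0 <= f0 j g <= pw (p j) (s g)) ->
  (fun i => average m p (f i) (h i) th) @ F --> average m p f0 g th.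
Proof.
move=> cth th1 hg fc fb f0b; rewrite /average; apply: cvg_sumr => j.
have cs : (fun i => s (h i)) @ F --> s g by apply: (cvg_comp _ _ hg); exact: (s_cont lcG).
have cw : (fun i => pw (p j) (s (h i))) @ F --> pw (p j) (s g).
  by apply: (cvg_comp _ _ cs); exact: pw_cont.
have [w0|w0] := eqVneq (pw (p j) (s g)) 0.
  have -> : f0 j g = 0 by have := f0b j; rewrite w0 -eq_le => /eqP ->.
  rewrite mul0r; apply: (@cvg_dom0 _ _ _ _ _ (fun i => pw (p j) (s (h i)))).
    by rewrite -w0.
  apply: filterS fb => i /(_ j) /andP[h0 h1]; rewrite normrM.
  apply: le_trans (ler_piMr _ (th1 _)) _ => //.
  by rewrite !ger0_norm//; exact: le_trans h1.
apply: cvgM; first exact: fc.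
by apply: (cvg_comp _ _ (sec_gmul_cvg hg w0)); exact: cth.
Qed.

(** Along an ultrafilter the base points converge in [K] and all values converge in [[0, 1]]; what
    remains is that the limits satisfy [fibre_density]. *)
Lemma dspace_proper (K : set X) : compact K -> compact ((@dbase _ _ _ _ Q L P O e) @^-1` K).
Proof.
move=> cK; rewrite compact_ultra => F UF FK.
have [x [Kx clx]] : K `&` cluster ((fun y : Y => dbase y) @ F) !=set0.
  by apply: cK; exact: FK.
have bx := cluster_ultra_cvg UF clx.
(* These values are not weighted: they stay in [[0, 1]] even where [pk (Q l)] is meaningless. *)
have lim l n j : exists t : R,
    (fun y : Y => dval y n j (pk (Q l) (dbase y))) @ F --> t.
  have [t [_ clt]] : `[0, 1]%classic `&` cluster
      ((fun y : Y => dval y n j (pk (Q l) (dbase y))) @ F) !=set0.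
    have h01 : F [set y : Y | `[0, 1]%classic (dval y n j (pk (Q l) (dbase y)))].
      by apply: filterE => y; rewrite /= in_itv /=; exact: dval01.
    by apply: (@segment_compact R 0 1); exact: h01.
  by exists t; exact: cluster_ultra_cvg.
have /choice[a ha] : forall lnj : nat * nat * nat, exists t : R,
    (fun y : Y => dval y lnj.1.2 lnj.2 (pk (Q lnj.1.1) (dbase y))) @ F --> t.
  by move=> [[l n] j]; exact: lim.
have /choice[la hla] := fun g => Qat Qcov g.
(* The limit is read along one chosen section through [g]; [key] shows that any other approach to
   [g] over the base points gives the same value. *)
pose phi n j g := if r g == x then a (la g, n, j) else 0.
have key (h : Y -> G) g n j : h @ F --> g -> (\forall y \near F, r (h y) = dbase y) ->
    r g = x -> (fun y : Y => dval y n j (h y)) @ F --> phi n j g.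
  move=> hg hb gx; rewrite /phi gx eqxx; have [w0 kg] := hla g; rewrite gx in w0 kg.
  have fk : (fun y : Y => pk (Q (la g)) (dbase y)) @ F --> pk (Q (la g)) x.
    by apply: (cvg_comp _ _ bx); exact: pk_cont.
  rewrite kg in fk.
  have fw : (fun y : Y => pw (Q (la g)) (dbase y)) @ F --> pw (Q (la g)) x.
    by apply: (cvg_comp _ _ bx); exact: pw_cont.
  have wn : \forall y \near F, pw (Q (la g)) (dbase y) != 0 by exact: cvgr_neq0 fw w0.
  have kh : \forall y \near F, pk (Q (la g)) (dbase y) = h y.
    apply: (arrow_eq_near etG fk hg).
    by apply: filterS2 hb wn => y -> /pk_sec.
  apply: cvg_trans (ha (la g, n, j)); apply: near_eq_cvg.
  by apply: filterS kh => y /= ->.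
have near_sec g : r g = x -> exists h : Y -> G,
    h @ F --> g /\ \forall y \near F, r (h y) = dbase y.
  move=> gx; have [w0 kg] := hla g; rewrite gx in w0 kg.
  have fk : (fun y : Y => pk (Q (la g)) (dbase y)) @ F --> pk (Q (la g)) x.
    by apply: (cvg_comp _ _ bx); exact: pk_cont.
  rewrite kg in fk; exists (fun y => pk (Q (la g)) (dbase y)); split => //.
  have fw : (fun y : Y => pw (Q (la g)) (dbase y)) @ F --> pw (Q (la g)) x.
    by apply: (cvg_comp _ _ bx); exact: pw_cont.
  have wn : \forall y \near F, pw (Q (la g)) (dbase y) != 0 by exact: cvgr_neq0 fw w0.
  by apply: filterS wn => y /pk_sec.
have scvg (h : Y -> G) g : h @ F --> g -> (fun y => s (h y)) @ F --> s g.
  by move=> hg; apply: (cvg_comp _ _ hg); exact: (s_cont lcG).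
have pbnd n j g : r g = x -> 0 <= phi n j g <= pw (P n j) (s g).
  move=> gx; have [h [hg hb]] := near_sec g gx; have kc := key h g n j hg hb gx.
  have wc : (fun y => pw (P n j) (s (h y))) @ F --> pw (P n j) (s g).
    by apply: (cvg_comp _ _ (scvg _ _ hg)); exact: pw_cont.
  apply/andP; split.
    apply: (ler_cvg_to (cvg_cst (0 : R)) kc).
    by apply: filterE => y; case/andP: (dval01 y n j (h y)).
  apply: (ler_cvg_to kc wc); apply: filterS hb => y hy.
  by case/andP: (fd_bnd (dspaceP y) n j hy).
have bnd_near (h : Y -> G) n : (\forall y \near F, r (h y) = dbase y) ->
    \forall y \near F, forall j, 0 <= dval y n j (h y) <= pw (P n j) (s (h y)).
  by apply: filterS => y hy j; exact: (fd_bnd (dspaceP y) n j hy).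
have fdx : fibre_density L P O e x phi.
  split=> //.
  - by move=> n j g gx; rewrite /phi (negPf gx).
  - move=> n g gx; have [h [hg hb]] := near_sec g gx.
    have c1 : (fun y : Y => \sum_(j < L n) dval y n j (h y)) @ F -->
       \sum_(j < L n) phi n j g.
      by apply: cvg_sumr => j; exact: key.
    have c2 : (fun y : Y => \sum_(j < L n) dval y n j (h y)) @ F --> (1 : R).
      apply: (@cvg_trans _ ((fun=> 1 : R) @ F)); last exact: cvg_cst.
      apply: near_eq_cvg.
      by apply: filterS hb => y hy; rewrite (fd_sum (dspaceP y)).
    exact: (cvg_unique _ c1 c2).
  - move=> n g h th gx hx Ogh th1.
    (* Averages of a discontinuous [th] need not converge. Only its values at the finitely many
       points charged at [g] and [h] count, and a continuous [th'] reproduces them. *)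
    have [th' [cth' th'1 th'E]] := interpolation lcG etG x
      ([seq g ** pk (P n j) (s g) | j <- iota 0 (L n)] ++
       [seq h ** pk (P n j) (s h) | j <- iota 0 (L n)]) th1.
    have avE k : (k = g \/ k = h) ->
        average (L n) (P n) (phi n) k th = average (L n) (P n) (phi n) k th'.
      move=> kgh; have kx : r k = x by case: kgh => ->.
      apply: eq_bigr => j _; have [->|p0] := eqVneq (phi n j k) 0.
        by rewrite !mul0r.
      have w0 : pw (P n j) (s k) != 0.
        apply: contraNneq p0 => w0; have := pbnd n j k kx.
        by rewrite w0 -eq_le => /eqP ->.
      rewrite th'E//; last by rewrite gr_mul ?pk_sec.
      rewrite mem_cat; apply/orP; case: kgh => ->; [left|right];
        by apply/mapP; exists (j : nat) => //; rewrite mem_iota /= add0n ltn_ord.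
    rewrite !avE; [|by right|by left].
    have [hg [hgg hgb]] := near_sec g gx; have [hh [hhh hhb]] := near_sec h hx.
    have cg : (fun y => average (L n) (P n) (dval y n) (hg y) th') @ F -->
        average (L n) (P n) (phi n) g th'.
      apply: average_cvg => //; first by move=> j; exact: key.
      - exact: bnd_near.
      - by move=> j; exact: pbnd.
    have ch : (fun y => average (L n) (P n) (dval y n) (hh y) th') @ F -->
        average (L n) (P n) (phi n) h th'.
      apply: average_cvg => //; first by move=> j; exact: key.
      - exact: bnd_near.
      - by move=> j; exact: pbnd.
    have cgh : (fun y => `|average (L n) (P n) (dval y n) (hg y) th' -
        average (L n) (P n) (dval y n) (hh y) th'|) @ F -->
        `|average (L n) (P n) (phi n) g th' - average (L n) (P n) (phi n) h th'|.
      by apply: cvg_norm; exact: cvgB.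
    apply: (ler_cvg_to cgh (cvg_cst (e n))).
    have cinv : (fun y => inv (hg y)) @ F --> inv g.
      by apply: (cvg_comp _ _ hgg); exact: (inv_cont lcG).
    have cm : (fun y => inv (hg y) ** hh y) @ F --> inv g ** h.
      apply: gmul_cvg => //; last by rewrite gs_inv gx hx.
      by apply: filterS2 hgb hhb => y a1 a2; rewrite gs_inv a1 a2.
    (* Since [O n] is open, the approximating pairs also satisfy the condition under which their
       almost invariance holds. *)
    have nO : nbhs (inv g ** h) (O n) by exact: open_nbhs_nbhs.
    have On : \forall y \near F, O n (inv (hg y) ** hh y) := cm _ nO.
    apply: filterS3 hgb hhb On => y a1 a2 a3.
    exact: (fd_inv (dspaceP y)).
have fdx' : `[< fibre_density L P O e (x, phi).1 (x, phi).2 >] by apply/asboolP.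
pose y0 : Y := exist _ (x, phi) fdx'.
exists y0; split; first exact: Kx.
apply: (@dspace_cvg _ _ _ _ Q L P O e _ _ _ id); first exact: bx.
move=> [[l n] j]; rewrite /comp /dcoord.
have fw : (fun y : Y => pw (Q l) (dbase y)) @ F --> pw (Q l) x.
  by apply: (cvg_comp _ _ bx); exact: pw_cont.
have [w0|w0] := eqVneq (pw (Q l) x) 0.
  rewrite /dbase/= w0 mul0r.
  apply: (@cvg_dom0 _ _ _ _ _ (fun y : Y => pw (Q l) (dbase y))).
    by rewrite -w0.
  apply: filterE => y; rewrite normrM ler_piMr//.
  by have /andP[h0 h1] := dval01 y n j (pk (Q l) (dbase y)); rewrite ger0_norm.
apply: cvgM => //; apply: key.
- by apply: (cvg_comp _ _ bx); exact: pk_cont.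
- have wn : \forall y \near F, pw (Q l) (dbase y) != 0 by exact: cvgr_neq0 fw w0.
  by apply: filterS wn => y /pk_sec.
- exact: pk_sec.
Qed.

Lemma dspace_lc : lc_space Y.
Proof.
split; first exact: (dspace_hausdorff lcG Qcov).
- move=> y _; have [V [bV cV clV]] := lc_nbhs (X_lc lcG) (dbase y).
  exists ((@dbase _ _ _ _ Q L P O e) @^-1` V).
    rewrite /within /=; have : nbhs y ((@dbase _ _ _ _ Q L P O e) @^-1` V).
      exact: (@dbase_continuous _ _ _ _ Q L P O e y _ bV).
    by apply: filterS.
  split; first exact: dspace_proper.
  apply: preimage_closed clV => z _; exact: dbase_continuous.
- exact: (dspace_second_countable lcG).
Qed.

End UniversalSpaceProper.

(** * The action by translation and the continuous section *)

Section Action.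
Variable R : realType.
Variables (X G : topologicalType) (Gd : groupoid X G).
Hypotheses (lcG : lc_groupoid Gd) (etG : etale Gd).
Local Notation r := (gr Gd).
Local Notation s := (gs Gd).
Local Notation u := (gu Gd).
Local Notation inv := (ginv Gd).
Local Notation "g ** h" := (gmul Gd g h) (at level 40, left associativity).

Variables (Q : nat -> wsec R Gd) (L : nat -> nat) (P : nat -> nat -> wsec R Gd).
Variables (O : nat -> set G) (e : nat -> R).
Hypothesis Qcov : forall g, exists l, chi (Q l) g != 0.
Hypothesis oO : forall n, open (O n).
Local Notation Y := (dspace Q L P O e).
Local Notation base := (@dbase _ _ _ _ Q L P O e).

Definition ract (g : G) (phi : nat -> nat -> G -> R) n j k : R :=
  if r k == r g then phi n j (inv g ** k) else 0.

Lemma s_invmul g k : r k = r g -> s (inv g ** k) = s k.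
Proof. by move=> kg; rewrite gs_mul// gs_inv. Qed.

(** Sections are evaluated at sources, which left multiplication keeps; the points belonging to [k]
    are those of [inv g ** k] moved by [g]. *)
Lemma average_act x phi g k n (th : G -> R) :
  fibre_density L P O e x phi -> s g = x -> r k = r g ->
  average (L n) (P n) (ract g phi n) k th =
  average (L n) (P n) (phi n) (inv g ** k) (fun z => th (g ** z)).
Proof.
move=> fd gx kg; apply: eq_bigr => j _; rewrite /ract kg eqxx s_invmul//.
have gk : r (inv g ** k) = s g by rewrite rinv_mul.
have [->|p0] := eqVneq (phi n j (inv g ** k)) 0; first by rewrite !mul0r.
have w0 : pw (P n j) (s k) != 0.
  apply: contraNneq p0 => w0; have := fd_bnd fd n j (etrans gk gx).
  by rewrite s_invmul// w0 -eq_le => /eqP ->.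
by rewrite -gmulA ?s_invmul ?pk_sec// arrow_mulVK.
Qed.

Lemma inv_invmul g h k : r h = r g -> r k = r g ->
  inv (inv g ** h) ** (inv g ** k) = inv h ** k.
Proof.
move=> hg kg; rewrite ginv_mul ?gs_inv// ginvK gmulA ?gs_inv ?rinv_mul//.
by rewrite arrow_mulVK.
Qed.

(** The conditions involve only sources and quotients [inv h ** k], both invariant under left
    translation. *)
Lemma fibre_density_act x phi g : s g = x -> fibre_density L P O e x phi ->
  fibre_density L P O e (r g) (ract g phi).
Proof.
move=> gx fd; split.
- by move=> n j k kg; rewrite /ract (negPf kg).
- move=> n j k kg; rewrite /ract kg eqxx -(s_invmul kg).
  by apply: (fd_bnd fd); rewrite rinv_mul.
- move=> n k kg; rewrite -(@fd_sum _ _ _ _ _ _ _ _ _ _ fd n (inv g ** k)).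
    by apply: eq_bigr => j _; rewrite /ract kg eqxx.
  by rewrite rinv_mul.
- move=> n h k th hg kg Ohk th1; rewrite !(average_act _ _ fd)//.
  apply: (fd_inv fd); rewrite ?rinv_mul//.
  by rewrite inv_invmul.
Qed.

Lemma dact_subproof (g : G) (y : Y) : s g = dbase y ->
  `[< fibre_density L P O e (r g, ract g (dval y)).1 (r g, ract g (dval y)).2 >].
Proof. by move=> gy; apply/asboolP; exact: fibre_density_act (dspaceP y). Qed.

Definition dact (g : G) (y : Y) : Y :=
  match pselect (s g = dbase y) with
  | left E => exist _ (r g, ract g (dval y)) (dact_subproof E)
  | right _ => y
  end.

Lemma dbase_act g y : s g = dbase y -> dbase (dact g y) = r g.
Proof. by move=> gy; rewrite /dact; case: pselect. Qed.

Lemma dval_act g y n j k : s g = dbase y -> r k = r g ->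
  dval (dact g y) n j k = dval y n j (inv g ** k).
Proof.
by move=> gy kg; rewrite /dact; case: pselect => // E; rewrite /dval /= /ract kg eqxx.
Qed.

Lemma dact_u y : dact (u (dbase y)) y = y.
Proof.
have uy : s (u (dbase y)) = dbase y by rewrite gs_u.
apply: dspace_eq; first by rewrite dbase_act// gr_u.
move=> n j g; rewrite dbase_act// gr_u => gy.
by rewrite dval_act// ?gr_u// ginv_u -gy gmul_ul.
Qed.

Lemma dactA g h y : s g = r h -> s h = dbase y ->
  dact (g ** h) y = dact g (dact h y).
Proof.
move=> gh hy; have ghy : s (g ** h) = dbase y by rewrite gs_mul.
have ghy' : s g = dbase (dact h y) by rewrite dbase_act.
apply: dspace_eq; first by rewrite !dbase_act// gr_mul.
move=> n j k; rewrite dbase_act// gr_mul// => kg.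
have hk : r (inv g ** k) = r h by rewrite rinv_mul.
rewrite dval_act// ?gr_mul// dval_act// dval_act//.
by rewrite ginv_mul// gmulA ?gs_inv ?gr_inv.
Qed.

Definition dgspace : gspace Y Gd := Gspace dbase_act dact_u dactA.

Lemma dgspace_lc : lc_gspace dgspace.
Proof.
split; [exact: dspace_lc|exact: dbase_continuous|].
apply/subspace_continuousP => -[g y] /= gy; set F := within _ _.
have c1 : (fun z : G * Y => z.1) @ F --> g.
  by apply: cvg_trans (cvg_app _ (cvg_within _)) _; exact: cvg_fst.
have c2 : (fun z : G * Y => z.2) @ F --> y.
  by apply: cvg_trans (cvg_app _ (cvg_within _)) _; exact: cvg_snd.
have rF : \forall z \near F, s z.1 = dbase z.2 by rewrite /F near_withinE; apply: nearW.
have cr : (fun z : G * Y => r z.1) @ F --> r g.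
  by apply: (cvg_comp _ _ c1); exact: (r_cont lcG).
apply: dspace_cvg.
  rewrite /comp dbase_act//; apply: cvg_trans cr; apply: near_eq_cvg.
  by apply: filterS rF => z sz; rewrite dbase_act.
move=> [[l n] j]; rewrite /comp /dcoord dbase_act//.
have cw : (fun z : G * Y => pw (Q l) (r z.1)) @ F --> pw (Q l) (r g).
  by apply: (cvg_comp _ _ cr); exact: pw_cont.
have [w0|w0] := eqVneq (pw (Q l) (r g)) 0.
  rewrite w0 mul0r.
  apply: (@cvg_dom0 _ _ _ _ _ (fun z : G * Y => pw (Q l) (r z.1))).
    by rewrite -w0.
  apply: filterS rF => z sz; rewrite dbase_act// normrM ler_piMr//.
  by have /andP[h0 h1] := dval01 (dact z.1 z.2) n j (pk (Q l) (r z.1)); rewrite ger0_norm.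
have wn : \forall z \near F, pw (Q l) (r z.1) != 0 by exact: cvgr_neq0 cw w0.
have ck : (fun z : G * Y => pk (Q l) (r z.1)) @ F --> pk (Q l) (r g).
  by apply: (cvg_comp _ _ cr); exact: pk_cont.
have cm : (fun z : G * Y => inv z.1 ** pk (Q l) (r z.1)) @ F --> inv g ** pk (Q l) (r g).
  apply: gmul_cvg => //; last by rewrite gs_inv pk_sec.
    by apply: (cvg_comp _ _ c1); exact: (inv_cont lcG).
  by apply: filterS wn => z /pk_sec k; rewrite gs_inv k.
rewrite dval_act ?pk_sec//.
apply: (@cvg_trans _ ((fun z : G * Y => pw (Q l) (r z.1) *
   dval z.2 n j (inv z.1 ** pk (Q l) (r z.1))) @ F)).
  apply: near_eq_cvg; apply: filterS2 rF wn => z sz wz.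
  by rewrite dbase_act// dval_act// pk_sec.
apply: cvgM => //.
apply: (@eval_cvg _ _ _ _ etG Q L P O e Qcov _ F _ snd y) => //.
  by apply: filterS2 rF wn => z sz /pk_sec k; rewrite rinv_mul.
by rewrite rinv_mul// pk_sec.
Qed.

Section ContinuousSection.
Variable phi : nat -> nat -> G -> R.
Hypothesis phi_density : forall n, density (L n) (P n) (phi n).
Hypothesis phi_inv : forall n g h (th : G -> R), (forall z, `|th z| <= 1) ->
  r g = r h -> O n (inv g ** h) ->
  `|average (L n) (P n) (phi n) g th - average (L n) (P n) (phi n) h th| <= e n.

Lemma dsection_subproof x : `[< fibre_density L P O e
  (x, fun n j g => if r g == x then phi n j g else 0).1
  (x, fun n j g => if r g == x then phi n j g else 0).2 >].
Proof.
apply/asboolP => /=; split.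
- by move=> n j g gx; rewrite (negPf gx).
- move=> n j g ->; rewrite eqxx; have [_ h _] := phi_density n; exact: h.
- move=> n g ->; rewrite eqxx; have [_ _ h] := phi_density n; exact: h.
- move=> n g h th gx hx Ogh th1; rewrite /average gx hx eqxx.
  by apply: phi_inv => //; rewrite gx.
Qed.

Definition dsection (x : X) : Y := exist _ (_, _) (dsection_subproof x).

Lemma dsection_continuous : continuous dsection.
Proof.
move=> x; apply: dspace_cvg; first exact: cvg_id.
move=> [[l n] j]; rewrite /comp /dcoord /dbase /dval /=.
have cw : pw (Q l) @ x --> pw (Q l) x by exact: pw_cont.
have [w0|w0] := eqVneq (pw (Q l) x) 0.
  rewrite w0 mul0r; apply: (@cvg_dom0 _ _ _ _ _ (pw (Q l))).
    by rewrite -w0.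
  apply: nearW => z; have /andP[h0 h1] := dval01 (dsection z) n j (pk (Q l) z).
  by rewrite normrM ler_piMr// ger0_norm.
have wn : \forall z \near x, pw (Q l) z != 0 by exact: cvgr_neq0 cw w0.
rewrite pk_sec// eqxx.
apply: (@cvg_trans _ ((fun z => pw (Q l) z * phi n j (pk (Q l) z)) @ x)).
  by apply: near_eq_cvg; apply: filterS wn => z wz; rewrite pk_sec// eqxx.
apply: cvgM => //; apply: (@continuous_comp _ _ _ (pk (Q l)) (phi n j)).
  exact: pk_cont.
by have [h _ _] := phi_density n; exact: h.
Qed.

End ContinuousSection.
End Action.

(** * Amenability of the universal space *)

Section FiniteProbability.
Variables (R : realType) (d : measure_display) (T : measurableType d).
Variables (N : nat) (w : nat -> R) (a : nat -> T).
Hypotheses (w0 : forall j, 0 <= w j) (w1 : \sum_(j < N) w j = 1).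

Definition weighted_dirac (j : nat) : {measure set T -> \bar R} :=
  mscale (NngNum (w0 j)) (\d_(a j)).

Definition finprob : set T -> \bar R := msum weighted_dirac N.

HB.instance Definition _ := Measure.on finprob.

Lemma finprobE (A : set T) : finprob A = (\sum_(j < N) w j * \1_A (a j))%:E.
Proof.
by rewrite /finprob /msum -sumEFin; apply: eq_bigr => j _; rewrite /= /mscale /dirac EFinM.
Qed.

Lemma finprob_setT : finprob setT = 1%E.
Proof.
by rewrite finprobE; congr (_%:E); rewrite -w1; apply: eq_bigr => j _; rewrite indicT mulr1.
Qed.

HB.instance Definition _ := Measure_isProbability.Build _ _ _ finprob finprob_setT.

Definition finite_probability : probability T R := finprob.

Lemma finprob_Rintegral (f : T -> R) : measurable_fun setT f ->
  Rintegral finprob setT f = \sum_(j < N) w j * f (a j).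
Proof.
move=> mf; have mEf : measurable_fun setT (EFin \o f) by exact/measurable_EFinP.
have pos (g : T -> \bar R) (h : T -> R) : (forall t, g t = (h t)%:E) ->
    (forall t, 0 <= h t) -> measurable_fun setT g ->
    (\int[finprob]_(t in setT) g t = (\sum_(j < N) w j * h (a j))%:E)%E.
  move=> gh h0 mg; rewrite ge0_integral_measure_sum//; last first.
    by move=> t _; rewrite gh lee_fin.
  rewrite -sumEFin; apply: eq_bigr => j _.
  rewrite ge0_integral_mscale//; last by move=> t _; rewrite gh lee_fin.
  by rewrite integral_dirac// diracT mul1e gh EFinM.
rewrite /Rintegral integralE.
rewrite (pos _ (fun t => Num.max (f t) 0)); last 3 first.
- by move=> t; rewrite funeposE EFin_max.
- by move=> t; rewrite le_max lexx orbT.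
- exact: measurable_funepos.
rewrite (pos _ (fun t => Num.max (- f t) 0)); last 3 first.
- by move=> t; rewrite funenegE -EFinN EFin_max.
- by move=> t; rewrite le_max lexx orbT.
- exact: measurable_funeneg.
rewrite -EFinB /= -sumrB; apply: eq_bigr => j _; rewrite -mulrBr; congr (_ * _).
by case: (leP (f (a j)) 0) => h; case: (leP (- f (a j)) 0) => h'; lra.
Qed.

End FiniteProbability.

(** * Discreteness of the fibres of the semidirect product *)

Section SemidirectFibres.
Variables (X G Y : topologicalType) (Gd : groupoid X G) (A : gspace Y Gd).
Hypotheses (lcG : lc_groupoid Gd) (etG : etale Gd).

Lemma sd_snd_continuous : continuous (fun a : sd_arrow A => (val a).2).
Proof.
move=> a; apply: (@continuous_comp _ _ _ (val : sd_arrow A -> Y * G) snd).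
  exact: (@initial_continuous (sd_arrow A) _ val).
exact: cvg_snd.
Qed.

Lemma fibre_val_continuous y :
  continuous (fun h : fibre (semidirect A) y => val h : sd_arrow A).
Proof. exact: (@initial_continuous (fibre (semidirect A) y) _ val). Qed.

Lemma fibre_fst y (h : fibre (semidirect A) y) : (val (val h)).1 = y.
Proof. exact: (set_mem (valP h)). Qed.

Lemma fibre_eq y (h h' : fibre (semidirect A) y) :
  (val (val h)).2 = (val (val h')).2 -> h = h'.
Proof.
move=> e; apply: val_inj; apply: sd_val_inj => //.
by rewrite !fibre_fst.
Qed.

(** An arrow over [y] is determined by its component in [G]; these components all have range
    [gp A y], and [r] is locally injective. Hence every subset of a fibre is measurable. *)
Lemma fibre_open y (B : set (fibre (semidirect A) y)) : open B.
Proof.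
rewrite openE => h Bh; have [U [gU inj]] := r_inj_near etG (val (val h)).2.
have nU : nbhs h [set h' : fibre (semidirect A) y | U (val (val h')).2].
  exact: (continuous_comp (@fibre_val_continuous y h) (@sd_snd_continuous _)) gU.
apply: filterS nU => h' /= Uh'; suff -> : h' = h by [].
apply: fibre_eq; apply: inj => //; first exact: nbhs_singleton gU.
by rewrite -!sd_p !fibre_fst.
Qed.

Lemma fibre_measurable y (B : set (borel_fibre (semidirect A) y)) : measurable B.
Proof. by apply: sub_gen_smallest; exact: fibre_open. Qed.

Lemma fibre_measurable_fun (R : realType) y (f : borel_fibre (semidirect A) y -> R) :
  measurable_fun setT f.
Proof. by move=> _ B _; exact: fibre_measurable. Qed.

End SemidirectFibres.

Section UniversalAmenable.
Variable R : realType.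
Variables (X G : topologicalType) (Gd : groupoid X G).
Hypotheses (lcG : lc_groupoid Gd) (etG : etale Gd).
Local Notation r := (gr Gd).
Local Notation s := (gs Gd).
Local Notation u := (gu Gd).
Local Notation inv := (ginv Gd).
Local Notation "g ** h" := (gmul Gd g h) (at level 40, left associativity).

Variables (Q : nat -> wsec R Gd) (L : nat -> nat) (P : nat -> nat -> wsec R Gd).
Variables (O : nat -> set G) (e : nat -> R).
Hypothesis Qcov : forall g, exists l, chi (Q l) g != 0.
Hypothesis oO : forall n, open (O n).
Hypothesis Oinc : forall n m, (n <= m)%N -> O n `<=` O m.
Hypothesis Ocov : forall K, compact K -> exists n, K `<=` O n.
Hypothesis e0 : forall d : R, 0 < d -> exists n, forall m, (n <= m)%N -> e m <= d.
Local Notation Y := (dspace Q L P O e).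
Local Notation base := (@dbase _ _ _ _ Q L P O e).
Local Notation A := (dgspace Q L P O e).
Local Notation S := (semidirect A).

Definition sdpair (y : Y) (g : G) : sd_arrow A := insubd (sd_u A y) (y, g).

Lemma sdpairE y g : r g = base y -> val (sdpair y g) = (y, g).
Proof. by move=> gy; rewrite /sdpair val_insubd ifT//; apply/mem_set. Qed.

Lemma sdpair_r y g : sd_r (sdpair y g) = y.
Proof. by rewrite /sd_r /sdpair val_insubd; case: ifP. Qed.

Definition fpair (y : Y) (g : G) : borel_fibre S y :=
  exist _ (sdpair y g) (mem_set (sdpair_r y g)).

Definition dweight n (y : Y) j := dval y n j (u (base y)).

Lemma dweight0 n y j : 0 <= dweight n y j.
Proof. by case/andP: (dval01 y n j (u (base y))). Qed.

Lemma dweight1 n y : \sum_(j < L n) dweight n y j = 1.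
Proof. by rewrite /dweight (fd_sum (dspaceP y))// gr_u. Qed.

Definition dpoint n (y : Y) j := fpair y (pk (P n j) (base y)).

Definition dmeas n (y : Y) : probability (borel_fibre S y) R :=
  finite_probability (dpoint n y) (dweight0 n y) (dweight1 n y).

Lemma dmeasE n y B : dmeas n y B = (\sum_(j < L n) dweight n y j * \1_B (dpoint n y j))%:E.
Proof. exact: finprobE. Qed.

Lemma dmeas_Rintegral n y (f : borel_fibre S y -> R) :
  Rintegral (dmeas n y) setT f = \sum_(j < L n) dweight n y j * f (dpoint n y j).
Proof.
exact: (@finprob_Rintegral R _ (borel_fibre S y) (L n) (dweight n y) (dpoint n y)
  (dweight0 n y) f (fibre_measurable_fun etG f)).
Qed.

Lemma cintegral_dmeas n y (f : sd_arrow A -> R[i]) :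
  cintegral (dmeas n y) (fun h => f (val h)) =
  Complex (\sum_(j < L n) dweight n y j * complex.Re (f (val (dpoint n y j))))
          (\sum_(j < L n) dweight n y j * complex.Im (f (val (dpoint n y j)))).
Proof. by rewrite /cintegral !dmeas_Rintegral. Qed.

Lemma dweight_bnd n y j : 0 <= dweight n y j <= pw (P n j) (base y).
Proof.
rewrite -[X in pw _ X](gs_u Gd).
by apply: (fd_bnd (dspaceP y)); rewrite gr_u.
Qed.

Lemma sdpair_cvg (I : Type) (F : set_system I) {FF : Filter F} (f : I -> Y)
    (h : I -> G) (y : Y) (g : G) : f @ F --> y -> h @ F --> g ->
  (\forall i \near F, r (h i) = base (f i)) -> r g = base y ->
  (fun i => sdpair (f i) (h i)) @ F --> sdpair y g.
Proof.
move=> fy hg hf gy B [_ [[W oW <-] Wy WB]].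
have nW : nbhs (y, g) W.
  by apply: open_nbhs_nbhs; split => //; rewrite -(sdpairE gy).
have fyh : (fun i => (f i, h i)) @ F --> (y, g) by exact: (cvg_pair fy hg).
have fW : \forall i \near F, W (f i, h i) := fyh _ nW.
suff : \forall i \near F, B (sdpair (f i) (h i)) by [].
apply: filterS2 fW hf => i Wi hi; apply: WB => /=.
by rewrite /preimage /= /set_val /= sdpairE.
Qed.

(** As a weight tends to 0 its point may jump, so the term vanishes in the limit only because [f] is
    bounded. *)
Lemma dmean_cvg n (f : sd_arrow A -> R) (M : R) : continuous f ->
  (forall a, `|f a| <= M) ->
  continuous (fun y : Y => \sum_(j < L n) dweight n y j * f (val (dpoint n y j))).
Proof.
move=> cf fM y; rewrite /continuous_at.
apply: (@cvg_sumr _ _ _ (nbhs y) (nbhs_filter y)) => j.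
have cb : base @ y --> base y by exact: dbase_continuous.
have cw : (fun y => pw (P n j) (base y)) @ y --> pw (P n j) (base y).
  by apply: (cvg_comp _ _ cb); exact: pw_cont.
have [w0|w0] := eqVneq (pw (P n j) (base y)) 0.
  have -> : dweight n y j = 0.
    by have := dweight_bnd n y j; rewrite w0 -eq_le => /eqP ->.
  rewrite mul0r; apply: (@cvg_dom0 _ _ _ _ _ (fun y => pw (P n j) (base y) * M)).
    by rewrite -[0](mul0r M) -w0; apply: cvgM => //; exact: cvg_cst.
  apply: nearW => z; have /andP[h0 h1] := dweight_bnd n z j.
  rewrite normrM [leRHS]normrM; apply: ler_pM => //.
    by rewrite !ger0_norm//; exact: le_trans h1.
  by rewrite (le_trans (fM _))// ler_norm.
have wn : \forall z \near y, pw (P n j) (base z) != 0 by exact: cvgr_neq0 cw w0.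
have ck : (fun y => pk (P n j) (base y)) @ y --> pk (P n j) (base y).
  by apply: (cvg_comp _ _ cb); exact: pk_cont.
apply: cvgM.
  apply: (@eval_cvg _ _ _ _ etG Q L P O e Qcov _ _ _ id y) => //.
  - by apply: (cvg_comp _ _ cb); exact: (u_cont lcG).
  - by apply: nearW => z; rewrite gr_u.
  - by rewrite gr_u.
have cp : (fun y => sdpair y (pk (P n j) (base y))) @ y -->
    sdpair y (pk (P n j) (base y)).
  apply: (@sdpair_cvg _ (nbhs y) (nbhs_filter y) id) => //; last by rewrite pk_sec.
  by apply: filterS wn => z /pk_sec.
by apply: (cvg_comp _ _ cp); exact: cf.
Qed.

Lemma Cc_bounded (f : sd_arrow A -> R[i]) : Cc f -> exists M : R,
  forall a, `|f a| <= M%:C%C.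
Proof.
move=> [cf cK]; have [l hl] : exists l : seq nat, forall a,
    closure [set g | f g != 0] a -> has (fun n => `|f a| <= (n%:R)%:C%C) l.
  apply: (@compact_seq _ nat (fun n a => `|f a| <= (n%:R)%:C%C) _ cK) => a _.
  have cn : (fun a => complex.Re `|f a|) @ a --> complex.Re `|f a|.
    have cn0 : (fun a => `|f a| : R[i]^o) @ a --> (`|f a| : R[i]^o).
      exact: (@cvg_norm R[i] R[i]^o _ (nbhs a) (nbhs_filter a)
        (fun a => f a : R[i]^o) (f a) (cf a)).
    exact: (@cvg_Re R _ (nbhs a) (nbhs_filter a) _ _ cn0).
  have nE b : `|f b| = (complex.Re `|f b|)%:C%C by rewrite normc_def.
  set t := complex.Re `|f a| in cn.
  exists (Num.bound t).+1.
  have tb : t < (Num.bound t).+1%:R.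
    have t0 : 0 <= t by rewrite -ler0c -nE.
    by apply: lt_trans (archi_boundP t0) _; rewrite ltr_nat.
  have nb : \forall b \near a, complex.Re `|f b| < (Num.bound t).+1%:R.
    exact: (@cvgr_lt _ _ (nbhs a) (nbhs_filter a) _ _ cn _ tb).
  apply: (@filterS _ (nbhs a) (nbhs_filter a) _ _ _ nb) => b hb.
  by rewrite nE lecR ltW.
exists (\max_(n <- l) n)%:R => a.
have [->|fa] := eqVneq (f a) 0; first by rewrite normr0 ler0c.
have /hasP[n nl h] := hl a (@subset_closure _ _ a fa).
apply: le_trans h _; rewrite lecR ler_nat.
by rewrite (big_rem n)//= leq_maxl.
Qed.

Lemma cvg_Complex (I : Type) (F : set_system I) {FF : Filter F} (f g : I -> R) (a b : R) :
  f @ F --> a -> g @ F --> b ->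
  (fun i => Complex (f i) (g i) : R[i]^o) @ F --> (Complex a b : R[i]^o).
Proof.
move=> fa gb; have E x y : Complex x y = x%:C%C + Complex 0 1 * y%:C%C :> R[i].
  by rewrite [LHS]complexE.
under eq_fun do rewrite E; rewrite E.
apply: (@cvgD _ R[i]^o); first exact: cvg_realc.
exact: (@cvgM R[i] I F FF (fun=> Complex 0 1) (fun i => (g i)%:C%C) _ _ (cvg_cst _) (cvg_realc gb)).
Qed.

Lemma dmeas_continuous n (f : sd_arrow A -> R[i]) : Cc f ->
  continuous (fun y : Y => cintegral (dmeas n y) (fun h => f (val h)) : R[i]^o).
Proof.
move=> cf; have [M fM] := Cc_bounded cf; have [cf' _] := cf.
have -> : (fun y => cintegral (dmeas n y) (fun h => f (val h))) = fun y =>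
   Complex (\sum_(j < L n) dweight n y j * complex.Re (f (val (dpoint n y j))))
          (\sum_(j < L n) dweight n y j * complex.Im (f (val (dpoint n y j)))).
  by apply: funext => y; exact: cintegral_dmeas.
move=> y; rewrite /continuous_at.
apply: (@cvg_Complex _ (nbhs y) (nbhs_filter y)).
  apply: (@dmean_cvg n (fun a => complex.Re (f a)) M).
    move=> a; rewrite /continuous_at.
    exact: (@cvg_Re R _ (nbhs a) (nbhs_filter a) f (f a) (cf' a)).
  by move=> a; exact: Re_le_norm.
have ImE z : complex.Im z = complex.Re (- Complex 0 1 * z : R[i]).
  by case: z => p q /=; ring.
apply: (@dmean_cvg n (fun a => complex.Im (f a)) M).
  move=> a; rewrite /continuous_at ImE; under eq_fun do rewrite ImE.
  apply: (@cvg_Re R _ (nbhs a) (nbhs_filter a)).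
  exact: (@cvgM R[i] _ (nbhs a) _ (fun=> - Complex 0 1) f _ _ (cvg_cst _) (cf' a)).
move=> a; rewrite ImE; apply: Re_le_norm; rewrite normrM.
have -> : `|- Complex 0 1 : R[i]| = 1.
  by rewrite normrN normc_def /= expr0n expr1n add0r sqrtr1.
by rewrite mul1r.
Qed.

(** By equivariance the translated measure is the one that [y] has at the arrow [g], and the other
    is the one at the unit; the quotient of unit and [g] is [g], which lies in [O n]. *)
Lemma tv_norm_dmeas n (a : sd_arrow A) : O n (val a).2 ->
  (tv_norm (fun B => pushforward (dmeas n (gs S a)) (@translate _ _ S a) B
                     - dmeas n (gr S a) B) <= (e n)%:E)%E.
Proof.
move=> Oa; apply: ge_ereal_sup => _ [m [F [mF tF ->]]].
set g := (val a).2 in Oa; set y := (val a).1.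
have gy : r g = base y by have := sd_p a.
have ry : gr S a = y by [].
have sgy : base (sd_s a) = s g by rewrite /sd_s dbase_act ?gs_inv// gr_inv.
pose nu B : R := average (L n) (P n) (dval y n) g (fun z => \1_B (fpair y z)) -
   average (L n) (P n) (dval y n) (u (base y)) (fun z => \1_B (fpair y z)).
have nuE B : (pushforward (dmeas n (gs S a)) (@translate _ _ S a) B
                     - dmeas n (gr S a) B)%E = (nu B)%:E.
  rewrite /pushforward !dmeasE -EFinB; congr (_ - _)%:E.
    apply: eq_bigr => j _.
    have -> : dweight n (sd_s a) j = dval y n j g.
      rewrite /dweight sgy dval_act ?gs_inv ?gr_u ?gr_inv//.
      rewrite ginvK; congr (dval y n j _).
      by rewrite gmul_ur.
    have [->|p0] := eqVneq (dval y n j g) 0; first by rewrite !mul0r.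
    have w0 : pw (P n j) (s g) != 0.
      apply: contraNneq p0 => w0; have := fd_bnd (dspaceP y) n j gy.
      by rewrite w0 -eq_le => /eqP ->.
    congr (_ * _); rewrite /indic; congr (nat_of_bool _)%:R.
    have tE : @translate _ _ S a (dpoint n (sd_s a) j) = fpair y (g ** pk (P n j) (s g)).
      apply: fibre_eq; rewrite /translate /= sd_mulE ?sdpair_r//=.
      by rewrite !sdpairE ?sgy ?pk_sec// gr_mul ?pk_sec.
    by rewrite -tE; apply/idP/idP => /set_mem ?; apply/mem_set.
  rewrite /average; apply: eq_bigr => j _; rewrite /dweight /dpoint gs_u.
  have [->|p0] := eqVneq (dval y n j (u (base y))) 0; first by rewrite !mul0r.
  have w0 : pw (P n j) (base y) != 0.
    apply: contraNneq p0 => w0; have := dweight_bnd n y j.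
    by rewrite /dweight w0 -eq_le => /eqP ->.
  have ku : u (base y) ** pk (P n j) (base y) = pk (P n j) (base y).
    by rewrite -{1}(pk_sec w0) gmul_ul.
  by rewrite ku.
under eq_bigr do rewrite nuE /=.
rewrite sumEFin lee_fin.
(* At each point at most one summand is nonzero since the sets are disjoint, so [th] is bounded by
   1; pairing with it yields the sum of the absolute values. *)
pose th z := \sum_(i < m) Num.sg (nu (F i)) * \1_(F i) (fpair y z) : R.
have avE k : average (L n) (P n) (dval y n) k th =
    \sum_(i < m) Num.sg (nu (F i)) *
      average (L n) (P n) (dval y n) k (fun z => \1_(F i) (fpair y z)).
  rewrite /average /th; under eq_bigr do rewrite mulr_sumr.
  rewrite exchange_big /=; apply: eq_bigr => i _; rewrite mulr_sumr.
  by apply: eq_bigr => j _; rewrite mulrCA.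
have -> : \sum_(i < m) `|nu (F i)| = average (L n) (P n) (dval y n) g th -
    average (L n) (P n) (dval y n) (u (base y)) th.
  rewrite !avE -sumrB; apply: eq_bigr => i _.
  by rewrite -mulrBr -/(nu (F i)) normrEsg.
apply: le_trans (ler_norm _) _; rewrite distrC.
apply: (fd_inv (dspaceP y)); rewrite ?gr_u//.
  by rewrite ginv_u -gy gmul_ul.
move=> z; rewrite /th; have [[i Fi]|nF] := pselect (exists i, F i (fpair y z)).
  rewrite (bigD1 i)//= big1 ?addr0.
    rewrite /indic mem_set// mulr1.
    by rewrite normr_sg; case: (_ != 0).
  move=> k ki; rewrite /indic memNset ?mulr0// => Fk.
  by move: ki; rewrite (tF k i I I) ?eqxx//; exists (fpair y z).
rewrite big1 ?normr0// => i _; rewrite /indic memNset ?mulr0// => Fi.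
by apply: nF; exists i.
Qed.

Lemma dspace_amenable : amenable R S.
Proof.
exists nat, (fun n m => (n <= m)%N), dmeas; split.
- split; [exact: (inhabits 0%N)|exact: leqnn|by move=> i j k; exact: leq_trans|].
  by move=> i j; exists (maxn i j); rewrite leq_maxl leq_maxr.
- by move=> n f cf; exact: dmeas_continuous.
- move=> K cK d d0.
  have cK2 : compact ((fun a : sd_arrow A => (val a).2) @` K).
    apply: continuous_compact => //; apply: continuous_subspaceT.
    exact: sd_snd_continuous.
  have [n0 Kn] := Ocov cK2; have [n1 en] := e0 d0.
  exists (maxn n0 n1) => n; rewrite geq_max => /andP[h0 h1] a Ka.
  apply: le_trans (tv_norm_dmeas _) _.
    by apply: (Oinc h0); apply: Kn; exists a.
  by rewrite lee_fin en.
Qed.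

End UniversalAmenable.

Section Exhaustion.
Variable R : realType.
Variables (X G : topologicalType) (Gd : groupoid X G).
Variable Q : nat -> wsec R Gd.
Hypothesis Qpre : forall n, precompact [set g | chi (Q n) g != 0].

(** For [Q] as in [countable_wsecs], an increasing exhaustion of [G] by relatively compact open
    sets. *)
Definition csupp n := [set g | exists2 l, (l <= n)%N & chi (Q l) g != 0].

Lemma csupp_precompact n : precompact (csupp n).
Proof.
elim: n => [|n IH].
  by apply: precompact_subset (Qpre 0%N) => g [l]; rewrite leqn0 => /eqP ->.
apply: (@precompact_subset _ _ (csupp n `|` [set g | chi (Q n.+1) g != 0])).
  move=> g [l]; rewrite leq_eqVlt => /orP[/eqP->|ln] gl; first by right.
  by left; exists l.
by rewrite precompactE closureU; apply: compactU; rewrite -precompactE.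
Qed.

End Exhaustion.

Section KernelsToAmenability.
Variable R : realType.
Variables (X G : topologicalType) (Gd : groupoid X G).
Hypotheses (lcG : lc_groupoid Gd) (etG : etale Gd).

Lemma amenable_of_kernels (I : Type) (le : I -> I -> Prop) (k : I -> G * G -> R[i]) :
  directed le ->
  (forall i, [/\ bounded_kernel Gd (k i), positive_definite Gd (k i),
                 continuous_kernel Gd (k i) & supported_in_tube Gd (k i)]) ->
  (forall i, bounded_by1_on_diagonal (k i)) ->
  tends_to1_on_tubes Gd le k ->
  strongly_amenable_at_infinity R Gd.
Proof.
move=> dir hk k1 klim.
have [Q [Qcov Qpre]] := countable_wsecs R lcG etG.
pose O := csupp Q.
have oO n : open (O n).
  rewrite openE => g [l ln gl].
  have c : chi (Q l) @ g --> chi (Q l) g by exact: (chi_cont lcG etG).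
  by apply: filterS (cvgr_neq0 _ c gl) => h hl; exists l.
have Oinc n m : (n <= m)%N -> O n `<=` O m.
  by move=> nm g [l ln gl]; exists l => //; exact: leq_trans nm.
have Opre n : precompact (O n) := csupp_precompact Qpre n.
have Ocov K : compact K -> exists n, K `<=` O n.
  move=> cK; have [l hl] : exists l : seq nat, forall g, K g ->
      has (fun n => chi (Q n) g != 0) l.
    apply: (@compact_seq _ _ (fun n g => chi (Q n) g != 0) _ cK) => g _.
    have [n gn] := Qcov g; exists n.
    have c : chi (Q n) @ g --> chi (Q n) g by exact: (chi_cont lcG etG).
    exact: cvgr_neq0 c gn.
  exists (\max_(n <- l) n)%N => g /hl/hasP[n nl gn]; exists n => //.
  by rewrite (big_rem n)//= leq_maxl.
pose e n : R := n.+1%:R^-1.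
have e0 n : 0 < e n by rewrite invr_gt0.
have e1 n : e n <= 1 by rewrite invf_le1// ler1n.
have elim d : 0 < d -> exists n, forall m, (n <= m)%N -> e m <= d.
  move=> d0; exists (Num.bound d^-1) => m nm.
  rewrite -[d]invrK lef_pV2 ?posrE ?invr_gt0//.
  apply: ltW; apply: lt_le_trans (archi_boundP _) _; first by rewrite invr_ge0 ltW.
  by rewrite ler_nat ltnW.
have /choice[L /choice[P /choice[phi hphi]]] := fun n =>
  density_of_net lcG etG dir hk k1 klim (Opre n) (e0 n) (e1 n).
have phid n : density (L n) (P n) (phi n) by case: (hphi n).
have phii n g h (th : G -> R) : (forall z, `|th z| <= 1) -> gr Gd g = gr Gd h ->
    O n (gmul Gd (ginv Gd g) h) ->
    `|average (L n) (P n) (phi n) g th - average (L n) (P n) (phi n) h th| <= e n.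
  by have [_ H] := hphi n; exact: H.
pose sigma := @dsection _ _ _ _ Q L P O e phi phid phii.
exists (dspace Q L P O e), (dgspace Q L P O e); split.
- exact: dgspace_lc.
- by move=> K cK; exact: dspace_proper.
- by move=> x; exists (sigma x).
- by exists sigma; split => //; exact: dsection_continuous.
- exact: dspace_amenable.
Qed.

End KernelsToAmenability.

(** * Kernels from measures *)

Section PointMasses.
Variable R : realType.
Variables (X G Y : topologicalType) (Gd : groupoid X G) (A : gspace Y Gd).
Hypotheses (lcG : lc_groupoid Gd) (etG : etale Gd).
Local Notation r := (gr Gd).
Local Notation s := (gs Gd).
Local Notation u := (gu Gd).
Local Notation inv := (ginv Gd).
Local Notation "g ** h" := (gmul Gd g h) (at level 40, left associativity).
Local Notation S := (semidirect A).
Local Notation p := (gp A).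

Definition fibre_arrow y (f : borel_fibre S y) : G := (val (val f)).2.

Lemma fibre_arrow_r y (f : borel_fibre S y) : r (fibre_arrow f) = p y.
Proof. by rewrite /fibre_arrow -sd_p fibre_fst. Qed.

Definition pmass y (mu : probability (borel_fibre S y) R) (h : G) : R :=
  fine (mu [set f | fibre_arrow f = h]).

Section FixedPoint.
Variables (y : Y) (mu : probability (borel_fibre S y) R).

Lemma fine_prob_ge0 (B : set (borel_fibre S y)) : 0 <= fine (mu B).
Proof. by rewrite fine_ge0. Qed.

Lemma pmass_ge0 h : 0 <= pmass mu h.
Proof. exact: fine_prob_ge0. Qed.

Lemma pmass_neq0 h : pmass mu h != 0 -> r h = p y.
Proof.
apply: contra_neqP => hy; rewrite /pmass (_ : [set f | _] = set0) ?measure0//.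
by rewrite -subset0 => f /= fh; apply: hy; rewrite -fh fibre_arrow_r.
Qed.

Lemma pmass_sum (l : seq G) : uniq l ->
  \sum_(h <- l) pmass mu h = fine (mu [set f | fibre_arrow f \in l]).
Proof.
elim: l => [_|h l IH /= /andP[hl ul]].
  rewrite big_nil (_ : [set f | _] = set0) ?measure0//.
  by rewrite -subset0 => f.
rewrite big_cons IH// /pmass -fineD ?fin_num_measure//; try exact: fibre_measurable.
rewrite -measureU; try exact: fibre_measurable.
  congr (fine (mu _)); apply/seteqP; split => f /=; rewrite in_cons.
    by case=> [->|->]; rewrite ?eqxx ?orbT.
  by case/orP => [/eqP|]; [left|right].
by rewrite -subset0 => f /= [-> h']; rewrite h' in hl.
Qed.

Lemma pmass_sum_le1 (l : seq G) : uniq l -> \sum_(h <- l) pmass mu h <= 1.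
Proof.
move=> ul; rewrite pmass_sum// -lee_fin fineK ?fin_num_measure//.
  by apply: probability_le1; exact: fibre_measurable.
exact: fibre_measurable.
Qed.

Lemma pmass_le1 h : pmass mu h <= 1.
Proof. by have := @pmass_sum_le1 [:: h] isT; rewrite big_seq1. Qed.

(** The sections [Q] enumerate the fibre, and [mu] is continuous from below. *)
Lemma pmass_exhaust (Q : nat -> wsec R Gd) (e : R) :
  (forall g, exists n, chi (Q n) g != 0) -> 0 < e ->
  exists2 l : seq G, uniq l & 1 - e < \sum_(h <- l) pmass mu h.
Proof.
move=> Qcov e0; pose pts n := undup [seq pk (Q l) (p y) | l <- iota 0 n].
pose E n : set (borel_fibre S y) := [set f | fibre_arrow f \in pts n].
have mE n : measurable (E n) by exact: fibre_measurable.
have Ecov : \bigcup_n E n = setT.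
  apply/seteqP; split => // f _; have [n fn] := Qcov (fibre_arrow f).
  exists n.+1 => //; rewrite /E /= mem_undup; apply/mapP; exists n.
    by rewrite mem_iota /= add0n ltnSn.
  by have [+ _] := chi_neq0 fn; rewrite fibre_arrow_r.
have nE : nondecreasing_seq E.
  move=> n k nk; apply/subsetPset => f; rewrite /E /= !mem_undup.
  move=> /mapP[l + ->]; rewrite mem_iota /= add0n => ln; apply/mapP; exists l => //.
  by rewrite mem_iota /= add0n (leq_trans ln).
have c : mu (E n) @[n --> \oo] --> (1%:E : \bar R).
  rewrite -(probability_setT mu) -Ecov; apply: nondecreasing_cvg_mu => //.
  exact: fibre_measurable.
have c' : fine (mu (E n)) @[n --> \oo] --> (1 : R) by exact: fine_cvg c.
have [N _ hN] : \forall n \near \oo, 1 - e < fine (mu (E n)).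
  by apply: (cvgr_gt _ c'); rewrite ltrBlDr ltrDl.
exists (pts N); first exact: undup_uniq.
by rewrite pmass_sum ?undup_uniq//; apply: (hN N) => /=.
Qed.

(** On this fibre [chi q] lives at a single arrow. Continuity of integrals of test functions thus
    becomes continuity of point masses. *)
Lemma Rintegral_chi (q : wsec R Gd) :
  Rintegral mu setT (fun f => chi q (fibre_arrow f)) =
  pw q (p y) * pmass mu (pk q (p y)).
Proof.
set B : set (borel_fibre S y) := [set f | fibre_arrow f = pk q (p y)].
rewrite /pmass -/B -(@Rintegral_cst _ _ _ mu B); last exact: fibre_measurable.
rewrite [RHS]Rintegral_mkcond; apply: eq_Rintegral => f _.
rewrite patchE /chi fibre_arrow_r; case: ifPn => [/eqP e|e].
  by rewrite mem_set.
by rewrite memNset// => /esym/eqP; exact/negP.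
Qed.

End FixedPoint.


Hypotheses (lcA : lc_gspace A) (pP : proper_map p).

Lemma gp_cont : continuous p.
Proof. by case: lcA. Qed.

(** Properness of [p] enters here: the component in [Y] stays in the preimage of the compact set of
    ranges of [V]. *)
Lemma sd_compact (V : set G) : compact V ->
  compact [set a : sd_arrow A | V (val a).2].
Proof.
move=> cV; rewrite compact_ultra => F UF FV.
have [g [Vg clg]] : V `&` cluster ((fun a : sd_arrow A => (val a).2) @ F) !=set0.
  by apply: cV; exact: FV.
have cg := cluster_ultra_cvg UF clg.
have crV : compact (r @` V).
  by apply: continuous_compact => //; apply: continuous_subspaceT; exact: r_cont.
have [y [_ cly]] : p @^-1` (r @` V) `&`
    cluster ((fun a : sd_arrow A => (val a).1) @ F) !=set0.
  apply: (pP crV).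
  have : \forall a \near F, (p @^-1` (r @` V)) (val a).1 by
    apply: filterS FV => a /= Va; exists (val a).2; rewrite ?sd_p.
  exact.
have cy := cluster_ultra_cvg UF cly.
have gy : p y = r g.
  apply: (cvg_unique (X_haus lcG) (F := (fun a : sd_arrow A => r (val a).2) @ F)).
    rewrite /= (_ : (fun a : sd_arrow A => r (val a).2) = fun a => p (val a).1); last
      by apply: funext => a; rewrite sd_p.
    by apply: (cvg_comp _ _ cy); exact: gp_cont.
  by apply: (cvg_comp _ _ cg); exact: (r_cont lcG).
exists (exist _ (y, g) (mem_set gy)); split => //.
move=> B [_ [[W oW <-] Wy WB]].
have nW : nbhs (y, g) W by apply: open_nbhs_nbhs.
have cyg : (fun a : sd_arrow A => ((val a).1, (val a).2)) @ F --> (y, g).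
  exact: (cvg_pair cy cg).
have fW : \forall a \near F, W ((val a).1, (val a).2) := cyg _ nW.
apply: filterS fW => a Wa; apply: WB => /=.
by rewrite /preimage /= /set_val /= [val a]surjective_pairing.
Qed.

Lemma gprod_compact (V W : set G) : compact V -> compact W ->
  compact (gprod Gd V W).
Proof.
move=> cV cW; rewrite compact_ultra => F UF FVW.
have /choice[ab hab] : forall k, exists ab : G * G, gprod Gd V W k ->
    [/\ V ab.1, W ab.2, s ab.1 = r ab.2 & k = ab.1 ** ab.2].
  move=> k; have [[a [b h]]|nk] := pselect (gprod Gd V W k); first by exists (a, b).
  by exists (k, k).
have [a [Va cla]] : V `&` cluster ((fun k => (ab k).1) @ F) !=set0.
  apply: cV; have : \forall k \near F, V (ab k).1 by apply: filterS FVW => k /hab[].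
  exact.
have [b [Wb clb]] : W `&` cluster ((fun k => (ab k).2) @ F) !=set0.
  apply: cW; have : \forall k \near F, W (ab k).2 by apply: filterS FVW => k /hab[].
  exact.
have ca := cluster_ultra_cvg UF cla; have cb := cluster_ultra_cvg UF clb.
have sr : \forall k \near F, s (ab k).1 = r (ab k).2.
  by apply: filterS FVW => k /hab[].
have ab0 : s a = r b.
  apply: (cvg_unique (X_haus lcG) (F := (fun k => s (ab k).1) @ F)).
    by apply: (cvg_comp _ _ ca); exact: (s_cont lcG).
  apply: cvg_trans (cvg_comp _ _ cb (r_cont lcG (x := b))).
  by apply: near_eq_cvg; apply: filterS sr => k ->.
exists (a ** b); split; first by exists a, b.
apply: cvg_trans (gmul_cvg lcG ca cb sr ab0).
apply: (@near_eq_cvg _ _ F _ (fun k => (ab k).1 ** (ab k).2) id).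
by apply: filterS FVW => k /hab[].
Qed.

Variable m : forall y, probability (borel_fibre S y) R.
Hypothesis m_cont : forall f : sd_arrow A -> R[i], Cc f ->
  continuous (fun y : Y => cintegral (m y) (fun h => f (val h)) : R[i]^o).

Lemma chi_Cc (q : wsec R Gd) : precompact [set g | chi q g != 0] ->
  Cc (fun a : sd_arrow A => (chi q (val a).2)%:C%C).
Proof.
move=> preq; split.
  move=> a; rewrite /continuous_at.
  apply: (@cvg_realc R _ (nbhs a) (nbhs_filter a)).
  apply: (@cvg_comp _ _ _ (fun a : sd_arrow A => (val a).2) (chi q) (nbhs a)
    (nbhs (val a).2)).
    exact: sd_snd_continuous.
  exact: (chi_cont lcG etG).
move: preq; rewrite precompactE => /sd_compact cK.
set K := [set a | _] in cK; have clK : closed K.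
  apply: (@preimage_closed _ _ (fun a : sd_arrow A => (val a).2)).
    by move=> a _; exact: sd_snd_continuous.
  exact: closed_closure.
apply: (subclosed_compact _ cK); first exact: closed_closure.
rewrite [X in _ `<=` X]((closure_id K).1 clK).
apply: closureS => a /= h; apply: subset_closure => /=.
by apply: contra_neq h => ->.
Qed.

Lemma chi_mean_cont (q : wsec R Gd) : precompact [set g | chi q g != 0] ->
  continuous (fun y : Y => pw q (p y) * pmass (m y) (pk q (p y))).
Proof.
move=> /chi_Cc/m_cont c y; rewrite /continuous_at.
have := @cvg_Re R _ (nbhs y) (nbhs_filter y) _ _ (c y).
rewrite /= -Rintegral_chi.
by under [X in _ -> X @ _ --> _]eq_fun do rewrite -Rintegral_chi.
Qed.

(** With a section of weight 1 around [g], the mass at [h i] is eventually one of the integrals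
    shown continuous in [chi_mean_cont]. *)
Lemma pmass_cvg (I : Type) (F : set_system I) {FF : Filter F} (f : I -> Y)
    (h : I -> G) (y : Y) (g : G) : f @ F --> y -> h @ F --> g ->
  (\forall i \near F, r (h i) = p (f i)) -> r g = p y ->
  (fun i => pmass (m (f i)) (h i)) @ F --> pmass (m y) g.
Proof.
move=> fy hg rh gy; have [V [gV cV clV]] := lc_nbhs (G_lc lcG) g.
have [q [q1 qV]] := wsec_ex R lcG etG gV.
have preq : precompact [set g | chi q g != 0].
  apply: (@precompact_subset _ _ V); last by rewrite precompact_closed.
  by move=> h' /chi_neq0[kh /qV]; rewrite kh.
have qE (z : Y) k : r k = p z -> chi q k = 1 ->
    pw q (p z) * pmass (m z) (pk q (p z)) = pmass (m z) k.
  move=> kz k1; have [|gram_kernel _] := @chi_neq0 _ _ _ _ q k; first by rewrite k1 oner_neq0.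
  by move: k1; rewrite /chi gram_kernel eqxx kz => ->; rewrite mul1r -{1}kz gram_kernel.
rewrite -(qE y g)//; last exact: nbhs_singleton q1.
apply: cvg_trans (cvg_comp _ _ fy (chi_mean_cont preq (x := y))).
apply: near_eq_cvg; have q1F : \forall i \near F, chi q (h i) = 1 := hg _ q1.
by apply: filterS2 rh q1F => i /= hi1 hi2; rewrite (qE _ _ hi1 hi2).
Qed.

End PointMasses.

(** * Cut-off of the measures, with uniformly small loss on compact sets *)

Section Truncation.
Variable R : realType.
Variables (X G Y : topologicalType) (Gd : groupoid X G) (A : gspace Y Gd).
Hypotheses (lcG : lc_groupoid Gd) (etG : etale Gd).
Local Notation r := (gr Gd).
Local Notation s := (gs Gd).
Local Notation u := (gu Gd).
Local Notation inv := (ginv Gd).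
Local Notation "g ** h" := (gmul Gd g h) (at level 40, left associativity).
Local Notation S := (semidirect A).
Local Notation p := (gp A).
Hypotheses (lcA : lc_gspace A) (pP : proper_map p).

Variable Q : nat -> wsec R Gd.
Hypothesis Qcov : forall g, exists n, chi (Q n) g != 0.
Hypothesis Qpre : forall n, precompact [set g | chi (Q n) g != 0].

(** At a given arrow some [chi (Q l)] is only known to be nonzero; the factor [n.+1] lifts it to 1
    for large [n], and keeps the sequence increasing. *)
Definition cutoff n (g : G) : R :=
  Num.min 1 (n.+1%:R * \sum_(l < n.+1) chi (Q l) g).

Lemma cutoff01 n g : 0 <= cutoff n g <= 1.
Proof.
rewrite ge_min lexx /= andbT le_min ler01 mulr_ge0// sumr_ge0// => l _.
exact: chi_ge0.
Qed.

Lemma cutoff_cont n : continuous (cutoff n).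
Proof.
move=> g; rewrite /continuous_at /cutoff.
apply: (@continuous_min R G (fun=> 1) (fun g => n.+1%:R * \sum_(l < n.+1) chi (Q l) g) g).
  exact: cvg_cst.
apply: cvgM; first exact: cvg_cst.
by apply: cvg_sumr => l; exact: (chi_cont lcG etG).
Qed.

Lemma cutoff_mono n k g : (n <= k)%N -> cutoff n g <= cutoff k g.
Proof.
move=> nk; rewrite /cutoff le_min ge_min lexx /= ge_min; apply/orP; right.
apply: ler_pM => //; first by apply: sumr_ge0 => l _; exact: chi_ge0.
  by rewrite ler_nat.
rewrite -!(big_mkord xpredT (fun l => chi (Q l) g)).
rewrite (big_cat_nat (n := n.+1) (p := k.+1))//= lerDl.
by apply: sumr_ge0 => l _; exact: chi_ge0.
Qed.

Lemma cutoff_neq0 n g : cutoff n g != 0 -> csupp Q n g.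
Proof.
apply: contra_neqP => gn; rewrite /cutoff big1; first by rewrite mulr0 min_r.
move=> l _; apply/eqP; apply: contraT => gl; exfalso; apply: gn.
by exists l => //; rewrite -ltnS.
Qed.

Lemma cutoff_eq1 g : exists N, forall n, (N <= n)%N -> cutoff n g = 1.
Proof.
have [l gl] := Qcov g; set c := chi (Q l) g in gl.
have c0 : 0 < c by rewrite lt_neqAle eq_sym gl chi_ge0.
exists (maxn l (Num.bound c^-1)) => n; rewrite geq_max => /andP[ln bn].
rewrite /cutoff min_l//.
have cs : c <= \sum_(l < n.+1) chi (Q l) g.
  rewrite (bigD1 (Ordinal (ln : (l < n.+1)%N)))//= lerDl.
  by apply: sumr_ge0 => i _; exact: chi_ge0.
apply: le_trans (_ : n.+1%:R * c <= _); last by rewrite ler_wpM2l.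
rewrite -ler_pdivrMr// div1r; apply: ltW.
apply: lt_le_trans (archi_boundP _) _; first by rewrite invr_ge0 ltW.
by rewrite ler_nat ltnW.
Qed.

Variable m : forall y, probability (borel_fibre S y) R.
Hypothesis m_cont : forall f : sd_arrow A -> R[i], Cc f ->
  continuous (fun y : Y => cintegral (m y) (fun h => f (val h)) : R[i]^o).

Definition cut_mass n y g := cutoff n g * pmass (m y) g.
Definition total_cut_mass n y := fsum (cut_mass n y).

Lemma cut_mass_ge0 n y g : 0 <= cut_mass n y g.
Proof. by rewrite mulr_ge0 ?pmass_ge0//; case/andP: (cutoff01 n g). Qed.

Lemma cut_mass_le n y g : cut_mass n y g <= pmass (m y) g.
Proof. by rewrite ler_piMl ?pmass_ge0//; case/andP: (cutoff01 n g). Qed.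

Lemma cut_mass_neq0 n y g : cut_mass n y g != 0 -> r g = p y /\ csupp Q n g.
Proof.
rewrite mulf_eq0 negb_or => /andP[/cutoff_neq0 ? /pmass_neq0 ?]; split => //.
Qed.

Lemma total_cut_mass_sum n : exists l : seq (wsec R Gd), forall y, finsupp (cut_mass n y) /\
  total_cut_mass n y = \sum_(q <- l) pw q (p y) * cut_mass n y (pk q (p y)).
Proof.
have [l hl] := thin_partition lcG etG (thin_precompact R lcG etG (csupp_precompact Qpre n)).
exists l; move=> y; rewrite /total_cut_mass.
have [|fs ->] := @fibre_sum _ _ _ _ _ l (u (p y)) (cut_mass n y) hl.
  move=> g /cut_mass_neq0[gy gn]; rewrite gr_u ginv_u -gy gmul_ul; split => //.
split => //; apply: eq_bigr => q _; rewrite gs_u.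
have [->|w0] := eqVneq (pw q (p y)) 0; first by rewrite !mul0r.
by rewrite -{2}(pk_sec w0) gmul_ul.
Qed.

Lemma finsupp_cut_mass n y : finsupp (cut_mass n y).
Proof. by have [l /(_ y)[]] := total_cut_mass_sum n. Qed.

Lemma total_cut_mass_le1 n y : total_cut_mass n y <= 1.
Proof.
have [t _ [ht _]] := finsuppU (finsupp_cut_mass n y) (finsupp_cut_mass n y).
rewrite /total_cut_mass (@fsumE _ _ _ (undup t)) ?undup_uniq//; last first.
  by move=> g /ht; rewrite mem_undup.
apply: le_trans (pmass_sum_le1 etG (m y) (undup_uniq t)).
by apply: ler_sum => g _; exact: cut_mass_le.
Qed.

Lemma cut_mass_cvg n (I : Type) (F : set_system I) {FF : Filter F} (f : I -> Y)
    (h : I -> G) (y : Y) (g : G) : f @ F --> y -> h @ F --> g ->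
  (\forall i \near F, r (h i) = p (f i)) -> r g = p y ->
  (fun i => cut_mass n (f i) (h i)) @ F --> cut_mass n y g.
Proof.
move=> fy hg hf gy; apply: cvgM.
  by apply: (cvg_comp _ _ hg); exact: cutoff_cont.
exact: (pmass_cvg lcG etG lcA pP m_cont fy hg hf gy).
Qed.

Lemma cut_mass01 n y g : 0 <= cut_mass n y g <= 1.
Proof. by rewrite cut_mass_ge0 (le_trans (cut_mass_le _ _ _))// pmass_le1. Qed.

Lemma total_cut_mass_cont n : continuous (total_cut_mass n).
Proof.
have [l hl] := total_cut_mass_sum n.
have -> : total_cut_mass n = fun y => \sum_(q <- l) pw q (p y) * cut_mass n y (pk q (p y)).
  by apply: funext => y; case: (hl y).
move=> y; rewrite /continuous_at.
apply: (@cvg_sumr _ _ _ (nbhs y) (nbhs_filter y)) => q.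
have cb : p @ y --> p y by exact: gp_cont.
have cw : (fun y => pw q (p y)) @ y --> pw q (p y).
  by apply: (cvg_comp _ _ cb); exact: pw_cont.
have [w0|w0] := eqVneq (pw q (p y)) 0.
  rewrite w0 mul0r; apply: (@cvg_dom0 _ _ _ _ _ (fun y => pw q (p y))).
    by rewrite -w0.
  apply: nearW => z; rewrite normrM ler_piMr//.
  by case/andP: (cut_mass01 n z (pk q (p z))) => ? ?; rewrite ger0_norm.
have wn : \forall z \near y, pw q (p z) != 0 by exact: cvgr_neq0 cw w0.
apply: cvgM => //; apply: (@cut_mass_cvg n _ (nbhs y) (nbhs_filter y) id) => //.
- by apply: (cvg_comp _ _ cb); exact: pk_cont.
- by apply: filterS wn => z /pk_sec.
- by rewrite pk_sec.
Qed.

Lemma total_cut_mass_mono n k y : (n <= k)%N -> total_cut_mass n y <= total_cut_mass k y.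
Proof.
move=> nk; apply: ler_fsum; [exact: finsupp_cut_mass..|] => g.
by rewrite ler_wpM2r ?pmass_ge0// cutoff_mono.
Qed.

(** Nearly all the mass sits on finitely many arrows, and one cut-off equals 1 at all of them. *)
Lemma total_cut_mass_exhaust y (e : R) : 0 < e -> exists n, 1 - e < total_cut_mass n y.
Proof.
move=> e0; have [l ul hl] := pmass_exhaust etG (m y) Qcov e0.
have [N hN] : exists N, forall g, g \in l -> cutoff N g = 1.
  elim: l {ul hl} => [|g l [N hN]]; first by exists 0%N.
  have [M hM] := cutoff_eq1 g; exists (maxn N M) => k; rewrite in_cons.
  case/predU1P => [->|kl]; first by rewrite hM// leq_maxr.
  apply/le_anti; case/andP: (cutoff01 (maxn N M) k) => _ -> /=.
  by rewrite -{1}(hN k kl) cutoff_mono// leq_maxl.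
exists N; apply: lt_le_trans hl _.
rewrite (_ : \sum_(g <- l) _ = \sum_(g <- l) cut_mass N y g).
  apply: ler_fsum_seq => //; first exact: finsupp_cut_mass.
  exact: cut_mass_ge0.
by apply: eq_big_seq => g gl; rewrite /cut_mass hN// mul1r.
Qed.

Lemma total_cut_mass_uniform (C : set Y) (e : R) : compact C -> 0 < e ->
  exists n, forall y, C y -> 1 - e <= total_cut_mass n y.
Proof.
move=> cC e0; have [l hl] : exists l : seq nat, forall y, C y ->
    has (fun n => 1 - e <= total_cut_mass n y) l.
  apply: (@compact_seq _ _ (fun n y => 1 - e <= total_cut_mass n y) _ cC) => y _.
  have [n hn] := total_cut_mass_exhaust y e0; exists n.
  have c : total_cut_mass n @ y --> total_cut_mass n y by exact: total_cut_mass_cont.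
  have cy := @cvgr_gt _ _ (nbhs y) (nbhs_filter y) _ _ c _ hn.
  by apply: (@filterS _ (nbhs y) (nbhs_filter y) _ _ _ cy) => z /ltW.
exists (\max_(n <- l) n)%N => y /hl/hasP[n nl hn].
apply: le_trans hn _; apply: total_cut_mass_mono.
by rewrite (big_rem n)//= leq_maxl.
Qed.

End Truncation.

(** * The Gram kernel of the truncated measures *)

Section KernelOfMeasures.
Variable R : realType.
Variables (X G Y : topologicalType) (Gd : groupoid X G) (A : gspace Y Gd).
Hypotheses (lcG : lc_groupoid Gd) (etG : etale Gd).
Local Notation r := (gr Gd).
Local Notation s := (gs Gd).
Local Notation u := (gu Gd).
Local Notation inv := (ginv Gd).
Local Notation "g ** h" := (gmul Gd g h) (at level 40, left associativity).
Local Notation S := (semidirect A).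
Local Notation p := (gp A).
Hypotheses (lcA : lc_gspace A) (pP : proper_map p).

Variable Q : nat -> wsec R Gd.
Hypothesis Qcov : forall g, exists n, chi (Q n) g != 0.
Hypothesis Qpre : forall n, precompact [set g | chi (Q n) g != 0].
Variable sigma : X -> Y.
Hypotheses (sigma_cont : continuous sigma) (sigmaK : forall x, p (sigma x) = x).

Definition pullback_pt g := gact A (inv g) (sigma (r g)).

Lemma gp_pullback_pt g : p (pullback_pt g) = s g.
Proof. by rewrite gp_act ?gr_inv// gs_inv sigmaK. Qed.

(** This makes [(pullback_pt g, inv g ** h)] an arrow from the point of [h] to the point of [g];
    almost invariance is applied to it. *)
Lemma pullback_pt_trans g h : r g = r h ->
  gact A (inv (inv g ** h)) (pullback_pt g) = pullback_pt h.
Proof.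
move=> gh; have gh' : s (inv g) = r h by rewrite gs_inv.
rewrite ginv_mul// ginvK /pullback_pt -gactA ?gs_mul ?gs_inv ?gr_inv ?sigmaK// gh.
by rewrite gmulA ?gs_inv ?gr_inv// gmul_Vr gh -(gs_inv Gd h) gmul_ur.
Qed.

Lemma gact_cvg (I : Type) (F : set_system I) {FF : Filter F} (f : I -> G)
    (h : I -> Y) g y : f @ F --> g -> h @ F --> y ->
  (\forall i \near F, s (f i) = p (h i)) -> s g = p y ->
  (fun i => gact A (f i) (h i)) @ F --> gact A g y.
Proof.
move=> fg hy fh gy; have [_ _ /subspace_continuousP/(_ (g, y) gy) ca] := lcA.
have fhc : (fun i => (f i, h i)) @ F -->
    within [set gy : G * Y | s gy.1 = p gy.2] (nbhs (g, y)).
  move=> B nB; have c : (fun i => (f i, h i)) @ F --> (g, y) by exact: cvg_pair.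
  by have := c _ nB; apply: filterS2 fh => i si; apply.
exact: (cvg_comp _ _ fhc ca).
Qed.

Lemma pullback_pt_cont : continuous pullback_pt.
Proof.
move=> g; apply: gact_cvg.
- exact: (inv_cont lcG).
- by apply: continuous_comp; [exact: (r_cont lcG)|exact: sigma_cont].
- by apply: nearW => h; rewrite gs_inv sigmaK.
- by rewrite gs_inv sigmaK.
Qed.

Variable m : forall y, probability (borel_fibre S y) R.
Hypothesis m_cont : forall f : sd_arrow A -> R[i], Cc f ->
  continuous (fun y : Y => cintegral (m y) (fun h => f (val h)) : R[i]^o).

Definition gram_vec n g h :=
  if r g == r h then Num.sqrt (cut_mass Q m n (pullback_pt g) (inv g ** h)) else 0.

Lemma gram_vec_ge0 n g h : 0 <= gram_vec n g h.
Proof. by rewrite /gram_vec; case: ifP => // _; rewrite sqrtr_ge0. Qed.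

Lemma gram_vec_neq0 n g h : gram_vec n g h != 0 -> r g = r h /\ csupp Q n (inv g ** h).
Proof.
rewrite /gram_vec; case: (r g =P r h) => [gh|]; last by rewrite eqxx.
have [->|/cut_mass_neq0[_ cs] _] :=
  eqVneq (cut_mass Q m n (pullback_pt g) (inv g ** h)) 0; last by [].
by rewrite sqrtr0 eqxx.
Qed.

Lemma gram_vec_sqr n g h : r g = r h ->
  gram_vec n g h ^+ 2 = cut_mass Q m n (pullback_pt g) (inv g ** h).
Proof. by move=> gh; rewrite /gram_vec gh eqxx sqr_sqrtr// cut_mass_ge0. Qed.

Lemma tkern_gram_vec n : tkern Gd (gram_vec n).
Proof.
split.
- exists (csupp Q n); last exact: gram_vec_neq0.
  apply: (thin_precompact R lcG etG); exact: csupp_precompact.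
- exists 1 => g h; rewrite ger0_norm ?gram_vec_ge0//.
  rewrite -(@ler_pXn2r _ 2%N) ?nnegrE ?gram_vec_ge0// expr1n.
  have [gh|gh] := eqVneq (r g) (r h).
    by rewrite gram_vec_sqr//; case/andP: (cut_mass01 etG Q m n (pullback_pt g) (inv g ** h)).
  by rewrite /gram_vec (negbTE gh) expr0n.
- move=> g h gh.
  set F := within _ _; have FF : Filter F by exact: within_filter.
  have c1 : fst @ F --> g by apply: cvg_within_filter; exact: cvg_fst.
  have c2 : snd @ F --> h by apply: cvg_within_filter; exact: cvg_snd.
  have rr : \forall z \near F, r z.1 = r z.2 by exact: withinT.
  have ct : (fun z => cut_mass Q m n (pullback_pt z.1) (inv z.1 ** z.2)) @ F -->
      cut_mass Q m n (pullback_pt g) (inv g ** h).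
    apply: (@cut_mass_cvg _ _ _ _ _ _ lcG etG lcA pP Q m m_cont n _ F FF
      (fun z => pullback_pt z.1) (fun z => inv z.1 ** z.2) (pullback_pt g) (inv g ** h)).
    + by apply: (cvg_comp _ _ c1); exact: pullback_pt_cont.
    + apply: (gmul_cvg lcG) => //; last by rewrite gs_inv.
        by apply: (cvg_comp _ _ c1); exact: (inv_cont lcG).
      by apply: filterS rr => z; rewrite gs_inv.
    + by apply: filterS rr => z zz; rewrite gp_pullback_pt rinv_mul.
    + by rewrite gp_pullback_pt rinv_mul.
  rewrite [X in _ --> X]/gram_vec gh eqxx.
  apply: cvg_trans (cvg_comp _ _ ct (@sqrt_continuous R _)).
  by apply: near_eq_cvg; apply: filterS rr => z zz; rewrite /gram_vec zz eqxx.
Qed.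

(** Transposition inverts the quotient, and the inverse of a precompact set is contained in a
    compact one. *)
Lemma tkern_gram_vecT n : tkern Gd (fun g h => gram_vec n h g).
Proof.
have tv := tkern_gram_vec n; have [_ [M hM] _] := tv; split.
- exists (inv @` closure (csupp Q n)).
    apply: (thin_compact R lcG etG); apply: continuous_compact.
      by apply: continuous_subspaceT; exact: (inv_cont lcG).
    by rewrite -precompactE; exact: csupp_precompact.
  move=> g h /gram_vec_neq0[hg cs]; split => //; exists (inv h ** g).
    exact: subset_closure.
  by rewrite ginv_mul ?gs_inv// ginvK.
- by exists M => g h; exact: hM.
- move=> g h gh; set F := within _ _; have FF : Filter F by exact: within_filter.
  apply: (tkern_cvg tv) => //.
  + by apply: cvg_within_filter; exact: cvg_snd.
  + by apply: cvg_within_filter; exact: cvg_fst.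
  + by apply: filterS (withinT _ _) => z /= zz; rewrite zz.
Qed.

Definition gram_kernel n := km (gram_vec n) (fun g h => gram_vec n h g).

Lemma tkern_gram_kernel n : tkern Gd (gram_kernel n).
Proof. exact: (tkern_km lcG etG (tkern_gram_vec n) (tkern_gram_vecT n)). Qed.

Lemma finsupp_gram_vec n g : finsupp (gram_vec n g).
Proof. exact: (tkern_rowfin lcG etG (tkern_gram_vec n)). Qed.

(** Substitute [g ** h] for the summation variable. *)
Lemma fsum_gram_vec_sqr n g :
  fsum (fun h => gram_vec n g h ^+ 2) = total_cut_mass Q m n (pullback_pt g).
Proof.
have fin := finsupp_cut_mass lcG etG Qpre m n (pullback_pt g).
have [t ut [ht _]] := finsuppU fin fin.
pose l := [seq h <- t | r h == s g].
have rl h : h \in l -> r h = s g by rewrite mem_filter => /andP[/eqP].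
have ul : uniq l by rewrite filter_uniq.
rewrite (@fsumE _ _ _ [seq g ** h | h <- l]); last 2 first.
- rewrite map_inj_in_uniq// => h k /rl hg /rl kg e.
  by rewrite -(arrow_mulK (esym hg)) e arrow_mulK.
- move=> h; rewrite expf_eq0 /= => vh; have [gh _] := gram_vec_neq0 vh.
  apply/mapP; exists (inv g ** h); last by rewrite arrow_mulVK.
  rewrite mem_filter rinv_mul// eqxx ht// -gram_vec_sqr//.
  by rewrite expf_eq0.
rewrite /total_cut_mass (@fsumE _ _ _ l ul); last first.
  move=> h h0; rewrite mem_filter ht// andbT.
  by have [-> _] := cut_mass_neq0 h0; rewrite gp_pullback_pt.
rewrite big_map; apply: eq_big_seq => h /rl hg.
by rewrite gram_vec_sqr ?gr_mul// arrow_mulK.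
Qed.

Lemma gram_kernel_le1 n g h : gram_kernel n g h <= 1.
Proof.
have fg := finsupp_gram_vec n g; have fh := finsupp_gram_vec n h.
have : gram_kernel n g h <=
    2^-1 * (total_cut_mass Q m n (pullback_pt g) + total_cut_mass Q m n (pullback_pt h)).
  rewrite -!fsum_gram_vec_sqr -fsumD; try exact: finsupp_sqr.
  rewrite -fsumZ; last by apply: finsuppD; exact: finsupp_sqr.
  apply: ler_fsum => [||z]; first exact: finsuppMl.
    by apply: (@finsuppMr _ _ (fun=> 2^-1)); apply: finsuppD; exact: finsupp_sqr.
  have := sqr_ge0 (gram_vec n g z - gram_vec n h z); lra.
have := total_cut_mass_le1 lcG etG Qpre m n (pullback_pt g).
have := total_cut_mass_le1 lcG etG Qpre m n (pullback_pt h).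
by rewrite /gram_kernel; lra.
Qed.

Lemma gram_kernel_ge0 n g h : 0 <= gram_kernel n g h.
Proof.
apply: fsum_ge0 => [|z]; first exact/finsuppMl/finsupp_gram_vec.
by rewrite mulr_ge0 ?gram_vec_ge0.
Qed.

(** For [z] charged by both vectors, [g^-1 h = (g^-1 z) (h^-1 z)^-1]. *)
Lemma gram_kernel_support n : exists2 C, compact C &
  forall g h, r g = r h -> gram_kernel n g h != 0 -> C (inv g ** h).
Proof.
have cD : compact (closure (csupp Q n)).
  by rewrite -precompactE; exact: csupp_precompact.
exists (gprod Gd (closure (csupp Q n)) (inv @` closure (csupp Q n))).
  apply: (gprod_compact lcG) => //; apply: continuous_compact => //.
  by apply: continuous_subspaceT; exact: (inv_cont lcG).
move=> g h gh kgh; have [z] : exists z, gram_vec n g z * gram_vec n h z != 0.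
  apply: contrapT => /forallNP H; move: kgh; rewrite /gram_kernel /km /fsum fsbig1 ?eqxx//.
  by move=> z _; apply/eqP; apply: contraT => /H.
rewrite mulf_eq0 negb_or => /andP[/gram_vec_neq0[gz cg] /gram_vec_neq0[hz ch]].
exists (inv g ** z), (inv (inv h ** z)); split.
- exact: subset_closure.
- by exists (inv h ** z) => //; exact: subset_closure.
- by rewrite gr_inv !gs_mul ?gs_inv.
- rewrite ginv_mul ?gs_inv// ginvK gmulA ?gs_inv ?gr_mul ?gr_inv ?gs_inv//.
  by rewrite arrow_mulVK// hz.
Qed.

Lemma translate_arrow (a : sd_arrow A) (f : borel_fibre S (sd_s a)) :
  fibre_arrow (@translate _ _ S a f) = (val a).2 ** fibre_arrow f.
Proof.
rewrite /fibre_arrow /translate /= sd_mulE//.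
by have /set_mem/= -> := valP f.
Qed.

(** The singletons of the listed arrows are one of the finite disjoint families in the supremum
    defining [tv_norm]. *)
Lemma tv_pmass (a : sd_arrow A) (l : seq G) (e : R) : uniq l ->
  (forall h, h \in l -> r h = r (val a).2) ->
  (tv_norm (fun B => pushforward (m (gs S a)) (@translate _ _ S a) B
                     - m (gr S a) B) <= e%:E)%E ->
  \sum_(h <- l) `|pmass (m (sd_s a)) (inv (val a).2 ** h) - pmass (m (sd_r a)) h| <= e.
Proof.
move=> ul hl; apply: contraTT; rewrite -!ltNge => elt.
pose F (i : 'I_(size l)) : set (borel_fibre S (sd_r a)) :=
  [set f | fibre_arrow f = tnth (in_tuple l) i].
have mF i : measurable (F i) by exact: (fibre_measurable etG).
have tF : trivIset [set: 'I_(size l)] F.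
  move=> i j _ _ [f [/= fi fj]]; apply: val_inj; apply/eqP.
  rewrite -(@nth_uniq _ (fibre_arrow f) l i j)//; apply/eqP.
  by rewrite -!(tnth_nth _ (in_tuple l)) -fi -fj.
apply: lt_le_trans (ereal_sup_ubound _); last by exists (size l), F; split.
rewrite /= -lte_fin in elt; apply: lt_le_trans elt _.
rewrite big_tnth -sumEFin le_eqVlt; apply/orP; left; apply/eqP.
apply: eq_bigr => i _.
set h := tnth _ _; have hh : r h = r (val a).2 by apply: hl; exact: mem_tnth.
rewrite -abse_EFin EFinB /pmass !fineK ?fin_num_measure//; try exact: (fibre_measurable etG).
congr (`|m _ _ - _|)%E; apply/seteqP; split => f fE.
  by rewrite /F /preimage /= translate_arrow fE arrow_mulVK.
have sf : s (val a).2 = r (fibre_arrow f).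
  by rewrite fibre_arrow_r /sd_s gp_act ?gr_inv// gs_inv sd_p.
by rewrite /= -(arrow_mulK sf) -translate_arrow fE.
Qed.

(** The cut-off is not invariant, so the comparison passes through the full masses [P] and [P'].
    Summing [pt] gives, for total cut masses [M] and [M'], [M + M' - 2 k <= e + (1 - M) + (1 - M')],
    hence [2 k >= 2 - 5 e]. *)
Lemma gram_kernel_close n (a : sd_arrow A) g h (e : R) : r g = r h ->
  val a = (pullback_pt g, inv g ** h) ->
  1 - e <= total_cut_mass Q m n (pullback_pt g) -> 1 - e <= total_cut_mass Q m n (pullback_pt h) ->
  (tv_norm (fun B => pushforward (m (gs S a)) (@translate _ _ S a) B
                     - m (gr S a) B) <= e%:E)%E ->
  1 - 3 * e <= gram_kernel n g h.
Proof.
move=> gh aE mg mh tv; have fg := finsupp_gram_vec n g; have fh := finsupp_gram_vec n h.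
have [l ul [lg lh]] := finsuppU fg fh.
pose l' := [seq z <- l | r z == r g].
have rz z : z \in l' -> r z = r g.
  by rewrite mem_filter => /andP[/eqP].
have mem_l k z : r k = r g -> gram_vec n k z != 0 -> z \in l -> z \in l'.
  by move=> kg /gram_vec_neq0[kz _] zl; rewrite mem_filter zl -kz kg eqxx.
have ul' : uniq l' by rewrite filter_uniq.
have lg' z : gram_vec n g z != 0 -> z \in l' by move=> h0; apply: (mem_l g) => //; exact: lg.
have lh' z : gram_vec n h z != 0 -> z \in l' by move=> h0; apply: (mem_l h) => //; exact: lh.
have ra : sd_r a = pullback_pt g by rewrite /sd_r aE.
have sa : sd_s a = pullback_pt h by rewrite /sd_s aE /= pullback_pt_trans.
have a2 : (val a).2 = inv g ** h by rewrite aE.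
pose P z := pmass (m (pullback_pt g)) (inv g ** z).
pose P' z := pmass (m (pullback_pt h)) (inv h ** z).
have uq k : r k = r g -> uniq [seq inv k ** z | z <- l'].
  move=> kg; rewrite map_inj_in_uniq// => z w /rz zg /rz wg e'.
  by rewrite -(arrow_mulVK (_ : r k = r z)) ?e' ?arrow_mulVK ?zg ?wg.
have tvP : \sum_(z <- l') `|P' z - P z| <= e.
  have := @tv_pmass a [seq inv g ** z | z <- l'] e (uq g erefl) _ tv.
  rewrite ra sa a2 big_map => /(_ _)/wrap[].
    move=> _ /mapP[z /rz zg ->]; by rewrite !gr_mul ?gr_inv ?gs_inv ?zg.
  apply: le_trans; rewrite le_eqVlt; apply/orP; left; apply/eqP.
  apply: eq_big_seq => z /rz zg; rewrite /P' /P ginv_mul ?gs_inv// ginvK.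
  by rewrite gmulA ?gs_inv ?gr_mul ?gr_inv ?gs_inv// arrow_mulVK ?zg.
have sP k : r k = r g -> \sum_(z <- l') pmass (m (pullback_pt k)) (inv k ** z) <= 1.
  by move=> kg; rewrite -(big_map _ xpredT) pmass_sum_le1 ?uq.
have sv k : r k = r g -> (forall z, gram_vec n k z != 0 -> z \in l') ->
    total_cut_mass Q m n (pullback_pt k) = \sum_(z <- l') gram_vec n k z ^+ 2.
  move=> kg hk; rewrite -fsum_gram_vec_sqr (@fsumE _ _ _ l')// => z.
  by rewrite expf_eq0 /= => /hk.
have kE : gram_kernel n g h = \sum_(z <- l') gram_vec n g z * gram_vec n h z.
  by rewrite /gram_kernel /km (@fsumE _ _ _ l')// => z; rewrite mulf_eq0 negb_or => /andP[/lg'].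
(* For nonnegative [v], [w] one has [(v - w)^2 <= |v^2 - w^2|]; inserting [P] and [P'] bounds this
   by their distance plus the losses from the cut-off. *)
have pt z : z \in l' ->
    gram_vec n g z ^+ 2 + gram_vec n h z ^+ 2 - 2 * (gram_vec n g z * gram_vec n h z) <=
    `|P' z - P z| + (P z - gram_vec n g z ^+ 2) + (P' z - gram_vec n h z ^+ 2).
  move=> /rz zg; have v0 := gram_vec_ge0 n g z; have w0 := gram_vec_ge0 n h z.
  have vP : gram_vec n g z ^+ 2 <= P z by rewrite gram_vec_sqr// cut_mass_le.
  have wP : gram_vec n h z ^+ 2 <= P' z by rewrite gram_vec_sqr ?cut_mass_le// -gh zg.
  have : P' z - P z <= `|P' z - P z| by exact: ler_norm.
  have : P z - P' z <= `|P' z - P z| by rewrite distrC ler_norm.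
  move: v0 w0 vP wP; rewrite !expr2; set v := gram_vec n g z; set w := gram_vec n h z.
  move=> v0 w0 vP wP; have [vw|wv] := leP v w.
    have : 0 <= v * (w - v) by rewrite mulr_ge0// subr_ge0.
    by lra.
  have : 0 <= w * (v - w) by rewrite mulr_ge0// subr_ge0 ltW.
  by lra.
have : \sum_(z <- l')
    (gram_vec n g z ^+ 2 + gram_vec n h z ^+ 2 - 2 * (gram_vec n g z * gram_vec n h z)) <=
  \sum_(z <- l') (`|P' z - P z| + (P z - gram_vec n g z ^+ 2) + (P' z - gram_vec n h z ^+ 2)).
  by rewrite !big_seq; apply: ler_sum => z; exact: pt.
rewrite !big_split /= !sumrN -mulr_sumr -kE -!sv//.
have sPg : \sum_(z <- l') P z <= 1 := sP g erefl.
have sPh : \sum_(z <- l') P' z <= 1 := sP h (esym gh).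
have e0 : 0 <= e by apply: le_trans tvP; apply: sumr_ge0.
lra.
Qed.

(** Over a finite list containing all the supports, the form is a sum of squared moduli of [w h]. *)
Lemma gram_kernel_psd n : positive_definite Gd (fun gh => (gram_kernel n gh.1 gh.2)%:C%C).
Proof.
move=> x N g gx z.
have [l ul hl] : exists2 l : seq G, uniq l & forall i h, gram_vec n (g i) h != 0 -> h \in l.
  have /choice[t ht] := fun i => finsupp_gram_vec n (g i).
  exists (undup (flatten [seq t i | i <- enum 'I_N])); first exact: undup_uniq.
  move=> i h /ht hi; rewrite mem_undup; apply/flattenP; exists (t i) => //.
  by apply: map_f; rewrite mem_enum.
pose w h := \sum_(j < N) (gram_vec n (g j) h)%:C%C * z j.
rewrite (_ : \sum_(i < N) _ = \sum_(h <- l) (w h)^* * w h).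
  by apply: sumr_ge0 => h _; rewrite mulrC mul_conjC_ge0.
transitivity (\sum_(h <- l) \sum_(i < N) \sum_(j < N)
    ((z i)^* * (gram_vec n (g i) h)%:C%C * ((gram_vec n (g j) h)%:C%C * z j))).
  rewrite [RHS]exchange_big /=; apply: eq_bigr => i _.
  rewrite [RHS]exchange_big /=; apply: eq_bigr => j _.
  rewrite mxE /= /gram_kernel /km (@fsumE _ _ _ l)//; last first.
    by move=> h; rewrite mulf_eq0 negb_or => /andP[/hl].
  rewrite rmorph_sum mulr_sumr mulr_suml; apply: eq_bigr => h _.
  by rewrite rmorphM /= !mulrA.
apply: eq_bigr => h _; rewrite /w rmorph_sum mulr_suml; apply: eq_bigr => i _.
rewrite mulr_sumr; apply: eq_bigr => j _; congr (_ * _).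
by rewrite rmorphM /= conj_real mulrC.
Qed.

Lemma gram_kernel_continuous n : continuous_kernel Gd (fun gh => (gram_kernel n gh.1 gh.2)%:C%C).
Proof.
apply/subspace_continuousP => -[g h] gh; have [_ _ kc] := tkern_gram_kernel n.
set F := within _ _; have FF : Filter F by exact: within_filter.
exact: (@cvg_realc R _ F FF _ _ (kc g h gh)).
Qed.

Lemma gram_kernel_tube n : supported_in_tube Gd (fun gh => (gram_kernel n gh.1 gh.2)%:C%C : R[i]).
Proof.
have [C cC hC] := gram_kernel_support n.
exists [set gh | rprod Gd gh /\ C (inv gh.1 ** gh.2)]; split.
  split; first by move=> gh [].
  apply: (@precompact_subset _ _ C); first by move=> _ [gh [_ ?] <-].
  by apply: compact_precompact => //; exact: (G_haus lcG).
move=> gh rgh k0; split => //; apply: hC => //.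
by apply: contra_neq k0 => ->.
Qed.

End KernelOfMeasures.

Section AmenabilityToKernels.
Variable R : realType.
Variables (X G : topologicalType) (Gd : groupoid X G).
Hypotheses (lcG : lc_groupoid Gd) (etG : etale Gd).

Lemma kernels_of_amenable : strongly_amenable_at_infinity R Gd ->
  exists (I : Type) (le : I -> I -> Prop) (k : I -> (G * G)%type -> R[i]),
    [/\ directed le,
        forall i, [/\ bounded_kernel Gd (k i), positive_definite Gd (k i),
                      continuous_kernel Gd (k i) & supported_in_tube Gd (k i)],
        forall i, bounded_by1_on_diagonal (k i) &
        tends_to1_on_tubes Gd le k].
Proof.
move=> [Y [A [lcA pP _ [sigma [sc sK]] [J [leJ [m [dJ mc mtv]]]]]]].
have [Q [Qcov Qpre]] := countable_wsecs R lcG etG.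
have key (K : set G) (e : R) : compact K -> 0 < e -> exists jn : J * nat,
    forall g h, gr Gd g = gr Gd h -> K (gmul Gd (ginv Gd g) h) ->
      1 - e <= gram_kernel Q sigma (m jn.1) jn.2 g h.
  (* A third, because [gram_kernel_close] loses three times its parameter. *)
  move=> cK e0; have e3 : 0 < e / 3 by rewrite divr_gt0.
  have [j hj] := mtv _ (sd_compact lcG lcA pP cK) _ e3.
  have jj := hj j (directed_refl dJ j).
  (* The points attached to [g] and [h] lie over [s g] and [s h], the range and source of [g^-1 h];
     one cut-off level has to serve all of them. *)
  have cC : compact (gp A @^-1` (gr Gd @` K `|` gs Gd @` K)).
    apply: pP; apply: compactU; apply: continuous_compact => //;
      apply: continuous_subspaceT; [exact: (r_cont lcG)|exact: (s_cont lcG)].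
  have [n hn] := total_cut_mass_uniform lcG etG lcA pP Qcov Qpre (mc j) cC e3.
  exists (j, n) => g h gh Kgh /=.
  pose a : sd_arrow A := insubd (sd_u A (sigma (gr Gd g)))
    (pullback_pt A sigma g, gmul Gd (ginv Gd g) h).
  have aE : val a = (pullback_pt A sigma g, gmul Gd (ginv Gd g) h).
    by rewrite val_insubd ifT//; apply/mem_set; rewrite /sd_arrow /= gp_pullback_pt// rinv_mul.
  rewrite (_ : e = 3 * (e / 3)); last by rewrite mulrC divfK// pnatr_eq0.
  apply: (gram_kernel_close lcG etG lcA pP Qpre sc sK (mc j) gh aE).
  - apply: hn; left; exists (gmul Gd (ginv Gd g) h) => //.
    by rewrite gp_pullback_pt// rinv_mul.
  - apply: hn; right; exists (gmul Gd (ginv Gd g) h) => //.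
    by rewrite gp_pullback_pt// gs_mul// gs_inv.
  - by apply: jj; rewrite /= aE.
(* The cut-off level depends on both the compact set and the index in [J], so the net is reindexed
   by compact sets and precisions. *)
pose I := ({K : set G | compact K} * nat)%type.
have /choice[jn hjn] : forall i : I, exists jn : J * nat,
    forall g h, gr Gd g = gr Gd h -> (proj1_sig i.1) (gmul Gd (ginv Gd g) h) ->
      1 - i.2.+1%:R^-1 <= gram_kernel Q sigma (m jn.1) jn.2 g h.
  by move=> [[K cK] n]; apply: key; rewrite ?invr_gt0.
exists I, (fun i i' => proj1_sig i.1 `<=` proj1_sig i'.1 /\ (i.2 <= i'.2)%N).
exists (fun i gh => (gram_kernel Q sigma (m (jn i).1) (jn i).2 gh.1 gh.2)%:C%C); split.
- split.
  + exact: (inhabits (exist _ set0 compact0, 0%N)).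
  + by move=> i; split.
  + move=> i j k [s1 h1] [s2 h2]; split; first exact: subset_trans s2.
    exact: leq_trans h2.
  + move=> [[K cK] n] [[K' cK'] n'].
    exists (exist _ (K `|` K') (compactU cK cK'), maxn n n') => /=.
    by rewrite leq_maxl leq_maxr; split.
- move=> i; split.
  + have [_ [M hM] _] := tkern_gram_kernel lcG etG lcA pP Qpre sc sK (mc (jn i).1) (jn i).2.
    by exists M => -[g h] _; rewrite normc_real lecR.
  + exact: (gram_kernel_psd lcG etG lcA pP Qpre sc sK (mc _)).
  + exact: (gram_kernel_continuous lcG etG lcA pP Qpre sc sK (mc _)).
  + exact: (gram_kernel_tube lcG Qpre).
- move=> i g; rewrite normc_real ger0_norm; last first.
    exact: (gram_kernel_ge0 lcG etG lcA pP Qpre sc sK (mc _)).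
  by rewrite lecR; exact: (gram_kernel_le1 lcG etG lcA pP Qpre sc sK (mc _)).
- move=> T [Tr preT] e e0; set K := [set _ | _ in T] in preT.
  have cK : compact (closure K) by rewrite -precompactE.
  exists (exist _ (closure K) cK, Num.bound e^-1) => i [/= sKi ni] [g h] Tgh.
  have gh : gr Gd g = gr Gd h := Tr _ Tgh.
  have := hjn i g h gh (sKi _ (@subset_closure _ K _ (ex_intro2 _ _ (g, h) Tgh erefl))).
  set k := gram_kernel _ _ _ _ _ _ => kle.
  have k1 : k <= 1 by exact: (gram_kernel_le1 lcG etG lcA pP Qpre sc sK (mc _)).
  rewrite -(rmorph1 (real_complex R)) -rmorphB /= normc_real lecR.
  rewrite ler0_norm ?subr_le0// opprB lerBlDl -lerBlDr.
  apply: le_trans kle; rewrite lerB// -[e]invrK lef_pV2 ?posrE ?invr_gt0//.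
  apply: ltW; apply: lt_le_trans (archi_boundP _) _; first by rewrite invr_ge0 ltW.
  by rewrite ler_nat ltnW.
Qed.

End AmenabilityToKernels.

Theorem theorem6p22 (R : realType) (X G : topologicalType) (Gd : groupoid X G)
    (lcG : lc_groupoid Gd) (etG : etale Gd) :
  strongly_amenable_at_infinity R Gd <->
  exists (I : Type) (le : I -> I -> Prop) (k : I -> (G * G)%type -> complex R),
    [/\ directed le,
        forall i, [/\ bounded_kernel Gd (k i), positive_definite Gd (k i),
                      continuous_kernel Gd (k i) & supported_in_tube Gd (k i)],
        forall i, bounded_by1_on_diagonal (k i) &
        tends_to1_on_tubes Gd le k].
Proof.
split; first exact: kernels_of_amenable.
by move=> [I [le [k [dir hk k1 klim]]]]; exact: (amenable_of_kernels lcG etG dir hk k1 klim).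
Qed.
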